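(* There exists an absolute constant $\delta_0>0$ such that for every constant $\epsilon>0$ the following promise problem is SSE-hard: given a finite graph $G=(V,E)$, distinguish between (YES) there exists a set $S\subset V$ with $|S|\le|V|/2$ and $\phi^{\sf V}(S)\le\epsilon$; and (NO) for all sets $S\subset V$, $\phi^{\sf V}(S)\ge\delta_0$.
   Context: For a finite undirected graph $G=(V,E)$ with $n=|V|$ and $S\subseteq V$, let $N(S)=\{v\in V\setminus S:\exists u\in S,\ \{u,v\}\in E\}$ and, for $\emptyset\ne S\subsetneq V$, $\phi^{\sf V}(S)= n\cdot\frac{|N(S)|}{|S|\,|V\setminus S|}$. For a regular graph $G=(V,E)$ with uniform measure $\mu(S)=|S|/|V|$, the edge expansion of $S$ is $\Phi_G(S)=|E(S,V\setminus S)|/(k|S|)$ where $k$ is the degree. The problem Small-Set Expansion$(\gamma,\delta)$ is: given a regular graph $G$, distinguish (YES) some $S$ with $\mu(S)=\delta$ has $\Phi_G(S)\le\gamma$, from (NO) every $S$ with $\mu(S)=\delta$ has $\Phi_G(S)\ge 1-\gamma$. The Small-Set Expansion Hypothesis states that for every $\gamma>0$ there is $\delta>0$ such that Small-Set Expansion$(\gamma,\delta)$ is NP-hard. A promise problem is called SSE-hard if it is NP-hard assuming the Small-Set Expansion Hypothesis (via a reduction from Small-Set Expansion). *)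

(* Defs.v *)
From mathcomp Require Import all_boot all_order all_algebra reals.
Set Implicit Arguments.
Unset Strict Implicit.
Unset Printing Implicit Defensive.
Import Order.TTheory GRing.Theory Num.Theory.
Local Open Scope ring_scope.

Definition word := seq bool.

(* Deterministic multi-tape Turing machines.  A cell is blank ([None]), a bit
   ([Some (inl b)]) or an auxiliary symbol ([Some (inr a)]). *)

Definition cell (aux : finType) : finType := option (bool + aux)%type.

Variant move := MoveLeft | Stay | MoveRight.

(* Two-way infinite tape: [tape_left] is listed from the head outwards, and all
   cells beyond the two lists are blank. *)
Record tape (aux : finType) := Tape {
  tape_left : seq (cell aux);
  tape_head : cell aux;
  tape_right : seq (cell aux)
}.

(* The number of tapes is [extra_tapes.+1]; tape [ord0] is both the input and
   the output tape. *)
Record machine := Machine {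
  extra_tapes : nat;
  state : finType;
  aux : finType;
  start : state;
  halting : {pred state};
  trans : state -> {ffun 'I_extra_tapes.+1 -> cell aux} ->
          state * {ffun 'I_extra_tapes.+1 -> cell aux * move}
}.

Arguments halting : clear implicits.

Definition write_move (A : finType) (t : tape A) (a : cell A * move) : tape A :=
  match a.2 with
  | MoveLeft =>
      Tape (behead (tape_left t)) (head None (tape_left t))
           (a.1 :: tape_right t)
  | Stay => Tape (tape_left t) a.1 (tape_right t)
  | MoveRight =>
      Tape (a.1 :: tape_left t) (head None (tape_right t))
           (behead (tape_right t))
  end.

Definition config (M : machine) : Type :=
  (state M * {ffun 'I_(extra_tapes M).+1 -> tape (aux M)})%type.

(* Halted configurations are fixed, so that [iter t] means at most [t] steps. *)
Definition step (M : machine) (c : config M) : config M :=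
  if c.1 \in halting M then c
  else
    let qa := trans c.1 [ffun i => tape_head (c.2 i)] in
    (qa.1, [ffun i => write_move (c.2 i) (qa.2 i)]).

Definition word_tape (A : finType) (w : word) : tape A :=
  let s := [seq Some (inl b) : cell A | b <- w] in
  Tape [::] (head None s) (behead s).

Definition init (M : machine) (w : word) : config M :=
  (start M, [ffun i => word_tape (aux M) (if i == ord0 then w else [::])]).

Fixpoint read_bits (A : finType) (s : seq (cell A)) : word :=
  if s is Some (inl b) :: s' then b :: read_bits s' else [::].

(* The output is the longest block of bits of tape [ord0] that starts at its
   head and extends to the right. *)
Definition output (M : machine) (c : config M) : word :=
  let t := c.2 ord0 in read_bits (tape_head t :: tape_right t).

Definition polytime (f : word -> word) : Prop :=
  exists (M : machine) (p : {poly nat}), forall w : word,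
    let c := iter p.[size w] (@step M) (init M w) in
    c.1 \in halting M /\ output c = f w.

Record promise_problem := PromiseProblem {
  yes : word -> Prop;
  no : word -> Prop
}.

Definition language_problem (L : word -> Prop) : promise_problem :=
  PromiseProblem L (fun w => ~ L w).

Definition reduces (P Q : promise_problem) : Prop :=
  exists f : word -> word,
    [/\ polytime f,
        forall w, yes P w -> yes Q (f w)
      & forall w, no P w -> no Q (f w)].

(* Injective: the bits of [x] are doubled and [01] marks the end of [x]. *)
Definition pair_word (x y : word) : word :=
  flatten [seq [:: b; b] | b <- x] ++ [:: false, true & y].

Definition NP (L : word -> Prop) : Prop :=
  exists (V : word -> bool) (p : {poly nat}),
    polytime (fun z => [:: V z]) /\
    forall x, L x <-> exists y, (size y <= p.[size x])%N /\ V (pair_word x y).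

Definition NP_hard (P : promise_problem) : Prop :=
  forall L, NP L -> reduces (language_problem L) P.

Record graph := Graph {
  nv : nat;
  adj : rel 'I_nv;
  adj_sym : symmetric adj;
  adj_irr : irreflexive adj
}.

(* The number of vertices in unary, a [0], and the adjacency matrix by rows. *)
Definition encode (G : graph) : word :=
  nseq (nv G) true ++
  false :: [seq adj u v | u <- enum 'I_(nv G), v <- enum 'I_(nv G)].

Definition graph_problem (Yes No : graph -> Prop) : promise_problem :=
  PromiseProblem (fun w => exists2 G, w = encode G & Yes G)
                 (fun w => exists2 G, w = encode G & No G).

Section Expansion.
Variables (R : realType) (G : graph).
Implicit Type S : {set 'I_(nv G)}.

Definition neighborhood S : {set 'I_(nv G)} :=
  [set v | (v \notin S) && [exists u in S, adj u v]].

(* Meaningful only for [S] nonempty and proper. *)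
Definition vertex_expansion S : R :=
  (nv G)%:R * (#|neighborhood S|%:R / (#|S|%:R * #|~: S|%:R)).

Definition regular (k : nat) : Prop :=
  forall u : 'I_(nv G), #|[set v | adj u v]| = k.

Definition measure S : R := #|S|%:R / (nv G)%:R.

(* An edge between [S] and its complement is counted once, as the ordered pair
   whose first component lies in [S]. *)
Definition cut_edges S : {set 'I_(nv G) * 'I_(nv G)} :=
  [set e | [&& e.1 \in S, e.2 \notin S & adj e.1 e.2]].

Definition edge_expansion (k : nat) S : R :=
  #|cut_edges S|%:R / (k%:R * #|S|%:R).

End Expansion.

(* Instances are nonempty regular graphs of positive degree, so that [measure]
   and [edge_expansion] have nonzero denominators. *)
Definition small_set_expansion (R : realType) (gamma delta : R) :
    promise_problem :=
  graph_problem
    (fun G => exists k, [/\ (0 < nv G)%N, (0 < k)%N, regular G k &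
       exists S : {set 'I_(nv G)},
         measure R S = delta /\ edge_expansion R k S <= gamma])
    (fun G => exists k, [/\ (0 < nv G)%N, (0 < k)%N, regular G k &
       forall S : {set 'I_(nv G)},
         measure R S = delta -> 1 - gamma <= edge_expansion R k S]).

Definition SSE_hypothesis (R : realType) : Prop :=
  forall gamma : R, 0 < gamma ->
    exists delta : R, 0 < delta /\ NP_hard (small_set_expansion gamma delta).

(* The reduction must start from Small-Set Expansion with one fixed [gamma] and
   an arbitrary [delta], because the hypothesis does not control the [delta] it
   provides. *)
Definition SSE_hard (R : realType) (P : promise_problem) : Prop :=
  (SSE_hypothesis R -> NP_hard P) /\
  (exists gamma : R, 0 < gamma /\
     forall delta : R, 0 < delta -> reduces (small_set_expansion gamma delta) P).

Definition vertex_expansion_gap (R : realType) (eps delta0 : R) :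
    promise_problem :=
  graph_problem
    (fun G => exists S : {set 'I_(nv G)},
       [/\ S != set0, S != setT, #|S|%:R <= (nv G)%:R / 2 :> R
         & vertex_expansion R S <= eps])
    (fun G => forall S : {set 'I_(nv G)},
       S != set0 -> S != setT -> delta0 <= vertex_expansion R S).

(* Main.v *)
(* Take [2 W] disjoint copies of a regular graph [G] and let the vertices of the
   gadget be the words of [N + L] directed edges [(b_i, d_i)] of this union.  The
   list [b] is folded into lists of [N] vertices by choosing, [L] times in a row,
   which of the next two entries is kept and appended at the end; the same is done
   with [d].  The [2^(L+1)] multisets so obtained are the points of the word.  Two
   words are adjacent when they share a point, and words whose first vertex lies in
   the first copy are adjacent to everything.

   If a small set [S] of the first copy has small edge expansion, let [A] be the
   non-universal words all of whose points meet [S].  A word outside [A] adjacent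
   to [A] is universal, or has some but not all points meeting [S], which forces
   one of its [2 L] first entries into [S] or one of its edges to leave [S]; all of
   this is rare when [L] is much smaller than [N].

   Conversely, let [A] have neighbourhood of density [nu], let [F] be the set of
   points of words of [A], and let [f_k] be the indicator that all [2^k] partial
   choices lead into [F].  Words with both kinds of points lie in the neighbourhood
   of [A], so the density of [f_k] drops by at most [nu] in total over the [L]
   levels, and at some level [f_k] depends little on a random entry.  Averaging
   [f_k] along the random walk on the copies gives a martingale in the entries read.
   By small-set expansion the walk contracts functions that are small on average,
   so the increments are tiny as long as the influence of the entries is small, and
   that it becomes large is unlikely enough.  Hence [f_k] is nearly a function of
   the [2 k] first entries, so [F] nearly agrees on two choices that are independent
   and uniform given those entries.  Thus the
   density [mu] of [F] satisfies [mu (1 - mu) <= 9 nu].  The universal words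
   exclude that [nu] is negligible.

   Since [N] and [L] are constants, the gadget is written down by a program with a
   fixed number of nested loops over the edges. *)
Require Import Defs.
From mathcomp Require Import all_boot all_order all_algebra archimedean reals boolp.
From mathcomp Require Import zify ring lra.
Set Implicit Arguments.
Unset Strict Implicit.
Unset Printing Implicit Defensive.
Import Order.TTheory GRing.Theory Num.Theory.
Local Open Scope ring_scope.

(** * Random lists *)

(** The scales are balanced by [L], which is about [1 / delta]. A list of [N = W * L] vertices of
    the [2 W] copies meets a set of measure [delta] of one copy with probability bounded away from 0
    and 1, while [2 L] entries meet it with probability at most [1 / W]. A single level would bound
    the influence of an entry by [2 nu] only, hence the influence of all [N] entries by order
    [N nu]; the best of [L] levels brings this down to order [W nu]. The smoothing costs a term of
    order [W N e], where [e] bounds the edges inside small sets. For fixed [W] this [e] is of order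
    [gamma * delta], so [delta] cancels against [N]. The rest is compared with [nu], which is at
    least [1 / (2 W)] by the universal words, unless [A] contains one of them. Therefore [gamma]
    depends on [eps] alone, as it must because the hypothesis supplies [delta] only after [gamma].
    The constant 1/10 consists of [mu (1 - mu) <= 9 nu] and one more [nu] for the passage from the
    density of [F] to that of [A]. *)

Section ListExpectation.
Variables (R : realFieldType) (T : finType).
Implicit Types (w : T -> R) (ws : seq (T -> R)) (h : seq T -> R).

Definition dist w : Prop := (forall x, 0 <= w x) /\ \sum_x w x = 1.

Fixpoint dists ws : Prop :=
  if ws is w :: ws' then dist w /\ dists ws' else True.

(** The coordinates are independent but may have different laws: [nseq n u] is an i.i.d. list, and
    [map P p] lets every entry of [p] take one independent step of the walk. *)
Fixpoint expect ws h : R :=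
  if ws is w :: ws' then \sum_x w x * expect ws' (fun s => h (x :: s))
  else h [::].

Lemma dists_nseq n w : dist w -> dists (nseq n w).
Proof. by move=> dw; elim: n => //= n IH; split. Qed.

Lemma dists_map (S : Type) (P : S -> T -> R) p :
  (forall b, dist (P b)) -> dists (map P p).
Proof. by move=> dP; elim: p => //= b p IH; split. Qed.

Lemma expect_eq ws h1 h2 :
  (forall s, size s = size ws -> h1 s = h2 s) -> expect ws h1 = expect ws h2.
Proof.
elim: ws h1 h2 => [|w ws IH] h1 h2 e12 /=; first exact: e12.
by apply: eq_bigr => x _; congr (_ * _); apply: IH => s ss; apply: e12 => /=; rewrite ss.
Qed.

Lemma expect_sum (I : Type) (r : seq I) (P : pred I) ws (h : I -> seq T -> R) :
  expect ws (fun s => \sum_(i <- r | P i) h i s) =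
  \sum_(i <- r | P i) expect ws (h i).
Proof.
elim: ws h => [|w ws IH] h //=.
rewrite exchange_big /=; apply: eq_bigr => x _.
by rewrite (IH (fun i s => h i (x :: s))) mulr_sumr.
Qed.

Lemma expectZ ws a h : expect ws (fun s => a * h s) = a * expect ws h.
Proof.
elim: ws h => [|w ws IH] h //=.
by rewrite mulr_sumr; apply: eq_bigr => x _; rewrite IH mulrCA.
Qed.

Lemma expectD ws h1 h2 :
  expect ws (fun s => h1 s + h2 s) = expect ws h1 + expect ws h2.
Proof.
elim: ws h1 h2 => [|w ws IH] h1 h2 //=.
by rewrite -big_split; apply: eq_bigr => x _; rewrite IH mulrDr.
Qed.

Lemma expectB ws h1 h2 :
  expect ws (fun s => h1 s - h2 s) = expect ws h1 - expect ws h2.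
Proof.
rewrite expectD -[X in _ = _ + X]mulN1r -expectZ; congr (_ + _).
by apply: expect_eq => s _; rewrite mulN1r.
Qed.

Lemma le_expect ws h1 h2 : dists ws ->
  (forall s, size s = size ws -> h1 s <= h2 s) -> expect ws h1 <= expect ws h2.
Proof.
elim: ws h1 h2 => [|w ws IH] h1 h2 /=; first by move=> _; apply.
move=> [[w0 _] dws] le12; apply: ler_sum => x _; apply: ler_wpM2l => //.
by apply: IH => // s ss; apply: le12 => /=; rewrite ss.
Qed.

Lemma expect_const ws c : dists ws -> expect ws (fun=> c) = c.
Proof.
elim: ws => [|w ws IH] //= [[_ w1] dws].
by under eq_bigr => x _ do rewrite IH //; rewrite -mulr_suml w1 mul1r.
Qed.

Lemma expect_ge0 ws h : dists ws ->
  (forall s, size s = size ws -> 0 <= h s) -> 0 <= expect ws h.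
Proof.
by move=> dws h0; rewrite -(expect_const 0 dws); apply: le_expect.
Qed.

Lemma expect_norm ws h : dists ws -> `|expect ws h| <= expect ws (fun s => `|h s|).
Proof.
move=> dws; rewrite ler_norml -[X in - X]mul1r -mulNr -expectZ.
apply/andP; split; apply: le_expect => // s _; last exact: ler_norm.
by rewrite mulN1r lerNl -normrN ler_norm.
Qed.

Lemma expect_cat ws1 ws2 h :
  expect (ws1 ++ ws2) h = expect ws1 (fun s1 => expect ws2 (fun s2 => h (s1 ++ s2))).
Proof.
elim: ws1 h => [|w ws1 IH] h //=.
by apply: eq_bigr => x _; rewrite IH.
Qed.

Lemma expect1 w h : expect [:: w] h = \sum_x w x * h [:: x].
Proof. by []. Qed.

Lemma expect_suml ws (S : finType) (v : S -> R) (h : S -> seq T -> R) :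
  expect ws (fun s => \sum_x v x * h x s) = \sum_x v x * expect ws (h x).
Proof.
by rewrite expect_sum; apply: eq_bigr => x _; rewrite expectZ.
Qed.

Lemma expect_rcons n w h :
  expect (nseq n.+1 w) h =
  expect (nseq n w) (fun s => \sum_x w x * h (rcons s x)).
Proof.
have -> : nseq n.+1 w = nseq n w ++ [:: w] by rewrite cats1; elim: n => //= n ->.
by rewrite expect_cat; apply: expect_eq => s _; rewrite expect1;
   apply: eq_bigr => x _; rewrite cats1.
Qed.

Lemma expect_nseqD m n w h :
  expect (nseq (m + n) w) h =
  expect (nseq m w) (fun p => expect (nseq n w) (fun s => h (p ++ s))).
Proof. by rewrite nseqD expect_cat. Qed.

End ListExpectation.

Section Noise.
Variables (R : realFieldType) (U : finType).
Variables (u : U -> R) (P : U -> U -> R).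
Hypothesis du : dist u.
Hypothesis dP : forall b, dist (P b).
Hypothesis stat : forall y, \sum_b u b * P b y = u y.

Lemma noise_stationary1 (h : U -> R) :
  \sum_b u b * (\sum_d P b d * h d) = \sum_b u b * h b.
Proof.
under eq_bigr => b _ do rewrite mulr_sumr.
rewrite exchange_big /=; apply: eq_bigr => d _.
by rewrite -(stat d) mulr_suml; apply: eq_bigr => b _; rewrite mulrA.
Qed.

Lemma noise_stationary n (h : seq U -> R) :
  expect (nseq n u) (fun p => expect (map P p) h) = expect (nseq n u) h.
Proof.
elim: n h => [|n IH] h //=.
rewrite -(noise_stationary1 (fun x => expect (nseq n u) (fun s => h (x :: s)))).
apply: eq_bigr => b _; congr (_ * _).
rewrite expect_suml; apply: eq_bigr => d _; congr (_ * _).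
exact: IH.
Qed.

(** The law of a stationary step. For the walk on a regular graph it is uniform on directed edges,
    which is how words of edges become random lists. *)
Definition edge_weight (p : U * U) : R := u p.1 * P p.1 p.2.

Lemma edge_weight_dist : dist edge_weight.
Proof.
split=> [[b d]|]; first by rewrite mulr_ge0 //= ?(proj1 du) ?(proj1 (dP b)).
rewrite -(pair_big xpredT xpredT (fun b d => u b * P b d)) /= -(proj2 du).
by apply: eq_bigr => b _; rewrite -mulr_sumr (proj2 (dP b)) mulr1.
Qed.

Lemma expect_edge n (h : seq U -> seq U -> R) :
  expect (nseq n edge_weight) (fun s => h (unzip1 s) (unzip2 s)) =
  expect (nseq n u) (fun b => expect (map P b) (h b)).
Proof.
elim: n h => [|n IH] h //=.
rewrite -(pair_big xpredT xpredT (fun b d => edge_weight (b, d) *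
  expect (nseq n edge_weight) (fun s => h (b :: unzip1 s) (d :: unzip2 s)))) /=.
apply: eq_bigr => b _; rewrite expect_suml mulr_sumr; apply: eq_bigr => d _.
by rewrite /edge_weight /= -mulrA (IH (fun s t => h (b :: s) (d :: t))).
Qed.

End Noise.

(** * Smoothing along a random walk *)

Section Smoothing.
Variables (R : realFieldType) (U : finType).
Variables (u : U -> R) (P : U -> U -> R).
Hypothesis du : dist u.
Hypothesis dP : forall b, dist (P b).
Hypothesis stat : forall y, \sum_b u b * P b y = u y.

Definition mass (S : {set U}) : R := \sum_b u b * (b \in S)%:R.

(** The probability that a stationary step has both ends in [S]. Small-set expansion enters the
    analysis only through upper bounds on this quantity. *)
Definition edge_mass (S : {set U}) : R :=
  \sum_b u b * ((b \in S)%:R * \sum_d P b d * (d \in S)%:R).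

Lemma le_mean (w : U -> R) (g h : U -> R) : dist w ->
  (forall x, g x <= h x) -> \sum_x w x * g x <= \sum_x w x * h x.
Proof.
by move=> [w0 _] le_gh; apply: ler_sum => x _; apply: ler_wpM2l.
Qed.

Lemma mean_const (w : U -> R) c : dist w -> \sum_x w x * c = c.
Proof. by move=> [_ w1]; rewrite -mulr_suml w1 mul1r. Qed.

Lemma mean_norm (w : U -> R) h : dist w ->
  `|\sum_x w x * h x| <= \sum_x w x * `|h x|.
Proof.
move=> [w0 _]; apply: le_trans (ler_norm_sum _ _ _) _.
by apply: ler_sum => x _; rewrite normrM ger0_norm.
Qed.

Lemma meanD (w : U -> R) g h :
  \sum_x w x * (g x + h x) = \sum_x w x * g x + \sum_x w x * h x.
Proof. by rewrite -big_split; apply: eq_bigr => x _; rewrite mulrDr. Qed.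

Lemma meanZ (w : U -> R) a h : \sum_x w x * (a * h x) = a * \sum_x w x * h x.
Proof. by rewrite mulr_sumr; apply: eq_bigr => x _; rewrite mulrCA. Qed.

(* A sparse function whose smoothing is somewhere larger than [tau] would have
   many edges inside a small set. *)
Lemma smoothing_sq_bound (h : U -> R) (X lam tau estar : R) :
  (forall x, `|h x| <= 1) -> \sum_x u x * `|h x| <= X -> X <= lam -> 0 < tau ->
  (forall S, mass S <= 3 * lam / tau -> edge_mass S <= estar) ->
  \sum_b u b * (\sum_d P b d * h d) ^+ 2 <= 2 / tau * estar + tau * X.
Proof.
move=> h1 hX Xlam tau0 sse.
pose d b := \sum_d P b d * h d.
have d_le b : `|d b| <= \sum_d P b d * `|h d| by apply: mean_norm.
have d1 b : `|d b| <= 1.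
  apply: le_trans (d_le b) _; rewrite -[leRHS](mean_const 1 (dP b)).
  by apply: le_mean.
have dX : \sum_b u b * `|d b| <= X.
  apply: le_trans hX; rewrite -(noise_stationary1 stat (fun x => `|h x|)); by apply: le_mean.
pose S1 := [set b | tau < `|d b|].
pose S2 := [set b | tau / 2 < `|h b|].
have m1 : tau * mass S1 <= X.
  apply: le_trans dX; rewrite -meanZ; apply: le_mean => // b.
  by rewrite inE; case: ltP => [/ltW|_]; rewrite ?mulr1 ?mulr0.
have m2 : tau / 2 * mass S2 <= X.
  apply: le_trans hX; rewrite -meanZ; apply: le_mean => // b.
  by rewrite inE; case: ltP => [/ltW|_]; rewrite ?mulr1 ?mulr0.
have m12 : mass (S1 :|: S2) <= mass S1 + mass S2.
  rewrite -meanD; apply: le_mean => // b.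
  rewrite in_setU; case: (b \in S1); case: (b \in S2) => /=; lra.
have /sse em : mass (S1 :|: S2) <= 3 * lam / tau.
  rewrite ler_pdivlMr // mulrC.
  have m2b : tau * mass S2 <= 2 * X.
    by move: m2; rewrite mulrAC ler_pdivrMr // (mulrC X).
  have := ler_wpM2l (ltW tau0) m12; rewrite mulrDr => ?; lra.
(* From a point of [S1] the average of [|h|] exceeds [tau]; entries outside [S2] contribute at most
   [tau / 2] and [h] is bounded by 1, so the walk enters the union with probability at least
   [tau / 2]. *)
have key : tau / 2 * mass S1 <= edge_mass (S1 :|: S2).
  rewrite -meanZ; apply: le_mean => // b.
  have P0 (S : {set U}) : 0 <= \sum_d P b d * (d \in S)%:R.
    by apply: sumr_ge0 => x _; rewrite mulr_ge0 ?ler0n ?(proj1 (dP b)).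
  case b1: (b \in S1); last by rewrite mulr0 mulr_ge0 ?ler0n.
  rewrite in_setU b1 /= mulr1 mul1r.
  have : tau <= tau / 2 + \sum_d P b d * (d \in S1 :|: S2)%:R.
    move: b1; rewrite inE => /ltW /le_trans; apply; apply: le_trans (d_le b) _.
    rewrite -[X in X + _](mean_const _ (dP b)) -meanD; apply: le_mean => // x.
    rewrite in_setU [x \in S2]inE; case: ltP => xh.
      by rewrite orbT; apply: le_trans (h1 x) _; rewrite lerDr divr_ge0 // ltW.
    by apply: le_trans xh _; rewrite lerDl.
  by move=> ?; lra.
(* Outside [S1] one factor of the square is at most [tau]; inside, the square is at most 1. *)
have : \sum_b u b * d b ^+ 2 <= \sum_b u b * (tau * `|d b| + (b \in S1)%:R).
  apply: le_mean => // b; rewrite inE -real_normK ?num_real //.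
  move: (d1 b) (normr_ge0 (d b)); set x := `|d b| => x1 x0.
  by case: ltP => ? /=; nra.
rewrite meanD meanZ => le1; apply: le_trans le1 _.
have -> : \sum_b u b * (b \in S1)%:R = mass S1 by [].
rewrite addrC lerD ?ler_pM2l //.
have -> : mass S1 = 2 / tau * (tau / 2 * mass S1) by field; lra.
by rewrite ler_wpM2l ?divr_ge0 //; lra.
Qed.

(* [X] dominates the increments of the martingale [G]; as soon as it exceeds
   [lam] the term [X / lam] pays for the whole variance, so that the increments
   need to be controlled only while [X <= lam]. *)
Lemma martingale_variance K0 M (G X : seq U -> R) (k0 tau lam c : R) :
  0 <= k0 -> 0 <= tau -> 0 < lam -> 0 <= c <= 1 ->
  (forall p, 0 <= X p) -> (forall p, (size p <= M)%N -> 0 <= G p <= 1) ->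
  (forall p, (size p < M)%N -> \sum_b u b * G (rcons p b) = G p) ->
  (forall p, (size p < M)%N -> \sum_b u b * X (rcons p b) <= X p) ->
  (forall p, (K0 <= size p < M)%N -> X p <= lam ->
     \sum_b u b * (G (rcons p b) - G p) ^+ 2 <= k0 + tau * X p) ->
  forall m p, (K0 <= size p)%N -> (size p + m)%N = M ->
  expect (nseq m u) (fun z => (G (p ++ z) - c) ^+ 2) <=
  (G p - c) ^+ 2 + m%:R * k0 + (m%:R * tau + lam^-1) * X p.
Proof.
move=> k00 tau0 lam0 c01 X0 G01 Gm Xm step; elim=> [|m IH] p K0p sp.
  rewrite /= cats0 mul0r mul0r !addr0 add0r lerDl mulr_ge0 ?invr_ge0 //; exact: ltW.
have ltpM : (size p < M)%N by lia.
have lam1 : 0 < lam^-1 by rewrite invr_gt0.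
case: (leP (X p) lam) => [Xl|Xl]; last first.
  have Xl1 : 1 <= lam^-1 * X p by rewrite mulrC ler_pdivlMr ?mul1r // ltW.
  have : expect (nseq m.+1 u) (fun z => (G (p ++ z) - c) ^+ 2) <= 1.
    rewrite -(@expect_const _ _ (nseq m.+1 u) 1); last exact: dists_nseq.
    apply: le_expect; first exact: dists_nseq.
    move=> z; rewrite size_nseq => sz.
    have /andP[? ?] : 0 <= G (p ++ z) <= 1 by apply: G01; rewrite size_cat; lia.
    by move/andP: c01 => [? ?]; nra.
  have ? : 0 <= m.+1%:R * k0 by rewrite mulr_ge0.
  have ? : 0 <= m.+1%:R * tau * X p by rewrite !mulr_ge0.
  have := sqr_ge0 (G p - c).
  rewrite mulrDl => *; lra.
have : expect (nseq m.+1 u) (fun z => (G (p ++ z) - c) ^+ 2) <=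
  \sum_b u b * ((G (rcons p b) - c) ^+ 2 + m%:R * k0 +
     (m%:R * tau + lam^-1) * X (rcons p b)).
  rewrite [leLHS]/=; apply: le_mean => // b.
  rewrite (@expect_eq _ _ _ _ (fun z => (G (rcons p b ++ z) - c) ^+ 2)).
    by apply: IH; rewrite size_rcons; lia.
  by move=> s _; rewrite cat_rcons.
move=> le1; apply: le_trans le1 _.
rewrite !meanD mean_const // meanZ.
(* Orthogonality of increments: the cross term vanishes because [G] is a martingale. *)
have -> : \sum_x u x * (G (rcons p x) - c) ^+ 2 =
   (G p - c) ^+ 2 + \sum_b u b * (G (rcons p b) - G p) ^+ 2.
  have -> : \sum_x u x * (G (rcons p x) - c) ^+ 2 = \sum_x u x *
     (((G p - c) ^+ 2 + (G (rcons p x) - G p) ^+ 2) +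
      (2 * (G p - c)) * (G (rcons p x) + (- 1) * G p)).
    by apply: eq_bigr => x _; congr (_ * _); ring.
  rewrite meanD meanZ meanD meanD Gm // mean_const // mean_const //; ring.
have := step p (introT andP (conj K0p ltpM)) Xl; have := Xm p ltpM; have := X0 p => X0p Xmp stp.
have ? : (m%:R * tau + lam^-1) * (\sum_b u b * X (rcons p b)) <=
   (m%:R * tau + lam^-1) * X p.
  by rewrite ler_wpM2l // addr_ge0 ?mulr_ge0 // ltW.
rewrite -[m.+1]addn1 natrD; lra.
Qed.

Variables (f : seq U -> R) (K0 M : nat).
Hypothesis f01 : forall s, 0 <= f s <= 1.
Hypothesis symf : forall q x r, (K0 <= size q)%N ->
  f (q ++ x :: r) = f (rcons (q ++ r) x).

Definition tail_mean p : R := expect (nseq (M - size p) u) (fun r => f (p ++ r)).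

(** The mean of [f] when the entries read take one step of the walk and the others are fresh.
    Stationarity makes this a martingale in [p], and its increments are averages along the walk, to
    which [smoothing_sq_bound] applies. *)
Definition smooth_mean p : R := expect (map P p) tail_mean.

Definition last_influence q : R :=
  \sum_b u b * \sum_c u c * `|f (rcons q b) - f (rcons q c)|.

(** This plays the part of [X] in [martingale_variance]. It is 0 once all [M] entries are read, and
    it is nonnegative, so that it is a supermartingale up to the end. *)
Definition smooth_influence p : R :=
  if (size p < M)%N then
    expect (map P p)
      (fun q => expect (nseq (M.-1 - size p) u) (fun r => last_influence (q ++ r)))
  else 0.

Let dPm p : dists (map P p). Proof. exact: dists_map. Qed.
Let dun n : dists (nseq n u). Proof. exact: dists_nseq. Qed.
Hint Resolve dPm dun : core.

Lemma expect_in01 ws (h : seq U -> R) : dists ws ->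
  (forall s, size s = size ws -> 0 <= h s <= 1) -> 0 <= expect ws h <= 1.
Proof.
move=> dws h01; apply/andP; split.
  by apply: expect_ge0 => // s /h01 /andP[].
by rewrite -(expect_const 1 dws); apply: le_expect => // s /h01 /andP[].
Qed.

Lemma tail_mean01 p : 0 <= tail_mean p <= 1.
Proof. exact: expect_in01. Qed.

Lemma smooth_mean01 p : 0 <= smooth_mean p <= 1.
Proof. by apply: expect_in01 => // s _; apply: tail_mean01. Qed.

Lemma last_influence_ge0 q : 0 <= last_influence q.
Proof.
apply: sumr_ge0 => b _; rewrite mulr_ge0 ?(proj1 du) //.
by apply: sumr_ge0 => c _; rewrite mulr_ge0 ?(proj1 du).
Qed.

Lemma smooth_influence_ge0 p : 0 <= smooth_influence p.
Proof.
rewrite /smooth_influence; case: ifP => // _.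
apply: expect_ge0 => // q _; apply: expect_ge0 => // r _; exact: last_influence_ge0.
Qed.

Lemma tail_mean_rcons p : (size p < M)%N ->
  tail_mean p = \sum_b u b * tail_mean (rcons p b).
Proof.
move=> sp; rewrite /tail_mean.
have -> : (M - size p = (M - (size p).+1).+1)%N by lia.
apply: eq_bigr => b _; rewrite size_rcons; congr (_ * _).
by apply: expect_eq => s _; rewrite cat_rcons.
Qed.

Lemma expect_map_rcons p b h :
  expect (map P (rcons p b)) h =
  expect (map P p) (fun q => \sum_d P b d * h (rcons q d)).
Proof.
rewrite -cats1 map_cat expect_cat; apply: expect_eq => q _ /=.
by apply: eq_bigr => d _; rewrite cats1.
Qed.

Lemma smooth_mean_martingale p : (size p < M)%N ->
  \sum_b u b * smooth_mean (rcons p b) = smooth_mean p.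
Proof.
move=> sp; under eq_bigr => b _ do rewrite /smooth_mean expect_map_rcons.
rewrite -(expect_suml (map P p) u (fun b q => \sum_d P b d * tail_mean (rcons q d))).
apply: expect_eq => q; rewrite size_map => sq.
by rewrite (noise_stationary1 stat (fun d => tail_mean (rcons q d))) -tail_mean_rcons ?sq.
Qed.

Lemma smooth_influence_martingale p : (size p < M)%N ->
  \sum_b u b * smooth_influence (rcons p b) <= smooth_influence p.
Proof.
move=> sp; case: (ltnP (size p).+1 M) => sp1; last first.
  rewrite big1 ?smooth_influence_ge0 // => b _.
  by rewrite /smooth_influence size_rcons ltnNge sp1 mulr0.
rewrite le_eqVlt; apply/orP; left; apply/eqP.
rewrite /smooth_influence sp.
under eq_bigr => b _ do rewrite size_rcons sp1 expect_map_rcons.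
rewrite -(expect_suml (map P p) u (fun b q => \sum_d P b d *
  expect (nseq (M.-1 - (size p).+1) u) (fun r => last_influence (rcons q d ++ r)))).
apply: expect_eq => q _.
rewrite (noise_stationary1 stat (fun d =>
  expect (nseq (M.-1 - (size p).+1) u) (fun r => last_influence (rcons q d ++ r)))).
have -> : (M.-1 - size p = (M.-1 - (size p).+1).+1)%N by lia.
apply: eq_bigr => b _; congr (_ * _).
by apply: expect_eq => r _; rewrite cat_rcons.
Qed.

(** The increment at [b] is the average along the walk of [h d], the mean change of [tail_mean]
    caused by appending [d]. This [h] is bounded by 1 and its mean absolute value is at most
    [smooth_influence p], which puts it within reach of the smoothing bound. *)
Lemma smooth_mean_step p (lam tau estar : R) :
  (K0 <= size p < M)%N -> smooth_influence p <= lam -> 0 < tau ->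
  (forall S, mass S <= 3 * lam / tau -> edge_mass S <= estar) ->
  \sum_b u b * (smooth_mean (rcons p b) - smooth_mean p) ^+ 2 <=
    2 / tau * estar + tau * smooth_influence p.
Proof.
move=> /andP[K0p sp] Xlam tau0 sse.
pose h d := expect (map P p) (fun q => tail_mean (rcons q d) - tail_mean q).
have -> : \sum_b u b * (smooth_mean (rcons p b) - smooth_mean p) ^+ 2 =
   \sum_b u b * (\sum_d P b d * h d) ^+ 2.
  apply: eq_bigr => b _; congr (_ * _ ^+ 2).
  rewrite /smooth_mean expect_map_rcons -expectB -expect_suml.
  apply: expect_eq => q _.
  rewrite -[X in _ - X](mean_const _ (dP b)) -sumrB.
  by apply: eq_bigr => d _; rewrite mulrBr.
have h_le d : `|h d| <= expect (map P p) (fun q => `|tail_mean (rcons q d) - tail_mean q|).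
  exact: expect_norm.
apply: (smoothing_sq_bound (lam := lam)) => // [d|].
  apply: le_trans (h_le d) _; rewrite -[leRHS](expect_const 1 (dPm p)).
  apply: le_expect => // q _.
  by have := tail_mean01 (rcons q d); have := tail_mean01 q; rewrite ler_norml; lra.
apply: le_trans (le_mean du h_le) _; rewrite /smooth_influence sp.
rewrite -(expect_suml (map P p) u (fun d q => `|tail_mean (rcons q d) - tail_mean q|)).
apply: le_expect => // q; rewrite size_map => sq.
have -> : expect (nseq (M.-1 - size p) u) (fun r => last_influence (q ++ r)) =
  \sum_b u b * \sum_c u c * expect (nseq (M.-1 - size p) u)
     (fun r => `|f (rcons (q ++ r) b) - f (rcons (q ++ r) c)|).
  rewrite expect_suml; apply: eq_bigr => b _; congr (_ * _).
  by rewrite expect_suml.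
apply: le_mean => // b; rewrite (tail_mean_rcons (p := q)) ?sq //.
have -> : tail_mean (rcons q b) - \sum_c u c * tail_mean (rcons q c) =
  \sum_c u c * (tail_mean (rcons q b) - tail_mean (rcons q c)).
  rewrite -[X in X - _](mean_const _ du) -sumrB.
  by apply: eq_bigr => d _; rewrite mulrBr.
apply: le_trans (mean_norm _ du) _; apply: le_mean => // c.
rewrite /tail_mean !size_rcons -expectB sq.
have -> : (M - (size p).+1 = M.-1 - size p)%N by lia.
apply: le_trans (expect_norm _ _) _ => //.
apply: le_expect => // r _.
(* The symmetry of [f] moves the entry just read to the last place, where [last_influence] measures
   it. *)
by rewrite !cat_rcons !symf // sq.
Qed.

(** The variance bound is applied to each prefix [p] with [c = smooth_mean p]. Averaging over [p]
    removes the noise from [smooth_influence] by stationarity and leaves the mean of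
    [last_influence]. *)
Lemma smooth_variance m (lam tau estar : R) : M = (K0 + m.+1)%N ->
  0 < lam -> 0 < tau -> 0 <= estar ->
  (forall S, mass S <= 3 * lam / tau -> edge_mass S <= estar) ->
  expect (nseq K0 u) (fun p => expect (nseq m.+1 u) (fun z =>
    (smooth_mean (p ++ z) - smooth_mean p) ^+ 2)) <=
  m.+1%:R * (2 / tau * estar) +
  (m.+1%:R * tau + lam^-1) * expect (nseq (K0 + m) u) last_influence.
Proof.
move=> eM lam0 tau0 es0 sse.
have -> : expect (nseq (K0 + m) u) last_influence = expect (nseq K0 u) smooth_influence.
  rewrite expect_nseqD -(noise_stationary stat); apply: expect_eq => p.
  rewrite size_nseq => sp; rewrite /smooth_influence sp.
  rewrite ifT; last by lia.
  by have -> : (M.-1 - K0 = m)%N by lia.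
rewrite -expectZ -[X in X + _](@expect_const _ _ (nseq K0 u)) // -expectD.
apply: le_expect => // p; rewrite size_nseq => sp.
apply: le_trans (martingale_variance (K0 := K0) (M := M) (X := smooth_influence)
  (k0 := 2 / tau * estar) (tau := tau) (lam := lam) _ _ _ _ _ _ _ _ _ _ _) _ => //.
- by rewrite mulr_ge0 ?divr_ge0 // ltW.
- exact: ltW.
- exact: smooth_mean01.
- exact: smooth_influence_ge0.
- by move=> q _; apply: smooth_mean01.
- exact: smooth_mean_martingale.
- exact: smooth_influence_martingale.
- by move=> q qM Xq; apply: (smooth_mean_step (lam := lam)).
- by rewrite sp.
- by rewrite sp eM.
by rewrite subrr expr0n add0r.
Qed.

End Smoothing.

(** * Folded lists *)

Section Picks.
Variable T : Type.

(* The first [2 k] entries of the list form [k] pairs of alternatives. *)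
Fixpoint picks (k : nat) (s : seq T) : seq (seq T) :=
  if k is k'.+1 then
    if s is x :: y :: s' then picks k' (rcons s' x) ++ picks k' (rcons s' y)
    else [::]
  else [:: s].

Definition points k (w : seq (T * T)) : seq (seq T) :=
  picks k (unzip1 w) ++ picks k (unzip2 w).

(** Together with [seconds] this gives two extreme points: on long enough lists they keep
    complementary halves of the alternatives, so that nothing but the tail is common to both. *)
Fixpoint firsts (k : nat) (s : seq T) : seq T :=
  if k is k'.+1 then
    if s is x :: y :: s' then firsts k' (rcons s' x) else s
  else s.

Fixpoint seconds (k : nat) (s : seq T) : seq T :=
  if k is k'.+1 then
    if s is x :: y :: s' then seconds k' (rcons s' y) else s
  else s.

Variable F : pred (seq T).

Definition forced k s : bool := all F (picks k s).

Definition mixed k w : bool := has F (points k w) && ~~ all F (points k w).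

Lemma forcedS k x y s :
  forced k.+1 (x :: y :: s) = forced k (rcons s x) && forced k (rcons s y).
Proof. exact: all_cat. Qed.

(** Choosing [e] in the first round shows that the points of [rcons w e] are among those of the
    longer word. *)
Lemma mixed_rcons k e e' w : mixed k (rcons w e) -> mixed k.+1 (e :: e' :: w).
Proof.
rewrite /mixed /points /unzip1 /unzip2 !map_rcons /= !has_cat !all_cat !negb_and.
by case/andP=> /orP[] -> /orP[] ->; rewrite ?orbT.
Qed.

Lemma has_firsts k s : (k.*2 <= size s)%N -> F (firsts k s) -> has F (picks k s).
Proof.
elim: k s => [|k IH] s /=; first by rewrite orbF.
case: s => [|x [|y s]] //=; rewrite !ltnS => ks Fs.
by rewrite has_cat IH // size_rcons ltnW.
Qed.

Lemma has_seconds k s : (k.*2 <= size s)%N -> F (seconds k s) -> has F (picks k s).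
Proof.
elim: k s => [|k IH] s /=; first by rewrite orbF.
case: s => [|x [|y s]] //=; rewrite !ltnS => ks Fs.
by rewrite has_cat (IH (rcons s y)) ?orbT // size_rcons ltnW.
Qed.

Lemma all_firsts k s : (k.*2 <= size s)%N -> all F (picks k s) -> F (firsts k s).
Proof.
elim: k s => [|k IH] s /=; first by rewrite andbT.
case: s => [|x [|y s]] //=; rewrite !ltnS => ks; rewrite all_cat => /andP[As _].
by apply: IH; rewrite // size_rcons ltnW.
Qed.

Lemma all_seconds k s : (k.*2 <= size s)%N -> all F (picks k s) -> F (seconds k s).
Proof.
elim: k s => [|k IH] s /=; first by rewrite andbT.
case: s => [|x [|y s]] //=; rewrite !ltnS => ks; rewrite all_cat => /andP[_ As].
by apply: IH; rewrite // size_rcons ltnW.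
Qed.

Lemma all_has_picks k s : (k.*2 <= size s)%N -> all F (picks k s) -> has F (picks k s).
Proof. by move=> ks /(all_firsts ks); apply: has_firsts. Qed.

Lemma unmixed_forced k w : (k.*2 <= size w)%N -> ~~ mixed k w ->
  forced k (unzip1 w) = forced k (unzip2 w).
Proof.
move=> kw; rewrite /mixed /points /forced negb_and negbK has_cat all_cat negb_or.
have := @all_has_picks k (unzip1 w); have := @all_has_picks k (unzip2 w).
rewrite !size_map => /(_ kw) h2 /(_ kw) h1.
case/orP => /andP[].
  move=> n1 n2; case: (all F _) h1 n1 => [->|] //.
  by case: (all F _) h2 n2 => [->|].
by move=> -> ->.
Qed.

Lemma unmixed_firsts k w : (k.*2 <= size w)%N -> ~~ mixed k w ->
  F (firsts k (unzip1 w)) = forced k (unzip1 w).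
Proof.
move=> kw; rewrite /mixed /points /forced negb_and negbK has_cat all_cat negb_or.
have := @has_firsts k (unzip1 w); have := @all_firsts k (unzip1 w).
rewrite !size_map => /(_ kw) h2 /(_ kw) h1.
case/orP => /andP[n1 n2]; last by rewrite h2.
case: (F _) h1 => [/(_ isT)|_]; first by rewrite (negPf n1).
by symmetry; apply/negP => /all_has_picks; rewrite size_map (negPf n1) => /(_ kw).
Qed.

Lemma unmixed_seconds k w : (k.*2 <= size w)%N -> ~~ mixed k w ->
  F (seconds k (unzip1 w)) = forced k (unzip1 w).
Proof.
move=> kw; rewrite /mixed /points /forced negb_and negbK has_cat all_cat negb_or.
have := @has_seconds k (unzip1 w); have := @all_seconds k (unzip1 w).
rewrite !size_map => /(_ kw) h2 /(_ kw) h1.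
case/orP => /andP[n1 n2]; last by rewrite h2.
case: (F _) h1 => [/(_ isT)|_]; first by rewrite (negPf n1).
by symmetry; apply/negP => /all_has_picks; rewrite size_map (negPf n1) => /(_ kw).
Qed.

End Picks.

(** Only the first [2 k] entries serve as alternatives; all later ones are kept in every pick, and
    [F] ignores their order. *)
Lemma forced_perm (T : eqType) (F : pred (seq T)) k p z z' :
  (forall s t, perm_eq s t -> F s = F t) -> size p = k.*2 -> perm_eq z z' ->
  forced F k (p ++ z) = forced F k (p ++ z').
Proof.
move=> Fperm; elim: k p z z' => [|k IH] p z z' /=.
  by move/size0nil => -> /= /Fperm zz'; rewrite /forced /= zz'.
case: p => [|x [|y p]] //= [sp] zz'.
rewrite !forcedS !rcons_cat; congr andb; apply: IH => //;
  by rewrite -!cats1 perm_cat2r.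
Qed.

(** The indicator of [a != b], written as a polynomial so that its mean over two independent lists
    is computed by linearity. *)
Definition disagree (R : pzRingType) (a b : bool) : R :=
  a%:R * (1 - b%:R) + (1 - a%:R) * b%:R.

(** The triangle inequality through [c] and [d]. For booleans the distance of [c] and [d] equals its
    square, so a variance bound can be inserted. *)
Lemma disagree_le (R : realFieldType) (a b c d : bool) (A B : R) :
  (c%:R - d%:R) ^+ 2 <= A + B ->
  disagree R a b <= (`|a%:R - c%:R| + A) + (B + `|b%:R - d%:R|).
Proof.
rewrite /disagree; case: a; case: b; case: c; case: d => /=;
  rewrite ?subrr ?normr0 ?subr0 ?sub0r ?normrN ?normr1 => ?; lra.
Qed.

(** * The density dichotomy for sets of points *)

Section Core.
Variables (R : realFieldType) (U : finType).
Variables (u : U -> R) (P : U -> U -> R).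
Hypothesis du : dist u.
Hypothesis dP : forall b, dist (P b).
Hypothesis stat : forall y, \sum_b u b * P b y = u y.
Variable F : pred (seq U).
Hypothesis Fperm : forall s t, perm_eq s t -> F s = F t.
Variables (N : nat).
Hypothesis N0 : (0 < N)%N.

Let we := edge_weight u P.
Let dwe : dist we. Proof. exact: edge_weight_dist. Qed.
Let dun n : dists (nseq n u). Proof. exact: dists_nseq. Qed.
Let dwen n : dists (nseq n we). Proof. exact: dists_nseq. Qed.
Let dPm p : dists (map P p). Proof. exact: dists_map. Qed.
Hint Resolve dun dwen dwe dPm : core.

Definition density : R := expect (nseq N u) (fun s => (F s)%:R).

Definition forced_density k : R := expect (nseq (N + k) u) (fun s => (forced F k s)%:R).

Definition mixed_density k : R := expect (nseq (N + k) we) (fun w => (mixed F k w)%:R).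

(** One round of choosing, in law: keeping one of two fresh entries and appending it gives again
    independent entries. Hence every fixed sequence of choices produces a list with the original
    law. *)
Lemma expect_drop_second (S : finType) (w : S -> R) n (h : seq S -> R) : dist w ->
  \sum_x w x * \sum_y w y * expect (nseq n w) (fun s => h (rcons s x)) =
  expect (nseq n.+1 w) h.
Proof.
move=> dw; rewrite expect_rcons expect_suml.
by apply: eq_bigr => x _; rewrite mean_const.
Qed.

Lemma expect_unzip1 n (h : seq U -> R) :
  expect (nseq n we) (fun w => h (unzip1 w)) = expect (nseq n u) h.
Proof.
rewrite (@expect_edge _ _ u P n (fun b _ => h b)).
by apply: expect_eq => b _; rewrite expect_const.
Qed.

Lemma mixed_density_mono k : mixed_density k <= mixed_density k.+1.
Proof.
rewrite /mixed_density addnS -(prednK N0) addSn -(expect_drop_second _ _ dwe) /=.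
apply: le_mean => // x; apply: le_mean => // y; apply: le_expect => // w _.
rewrite ler_nat; case m: (mixed F k _) => //.
by rewrite (mixed_rcons _ m).
Qed.

Lemma mixed_density_le k L : (k <= L)%N -> mixed_density k <= mixed_density L.
Proof.
move/subnK <-; elim: (L - k)%N => [|n IH] //.
by rewrite addSn; apply: le_trans IH _; apply: mixed_density_mono.
Qed.

Lemma density_firsts k :
  expect (nseq (N + k) u) (fun s => (F (firsts k s))%:R) = density :> R.
Proof.
elim: k => [|k IH]; first by rewrite addn0.
rewrite -IH addnS -(prednK N0) addSn -[RHS](expect_drop_second _ _ du) /=.
by [].
Qed.

(** Level 0 has the density of [F], which is also that of [F (firsts L s)]. On an unmixed word the
    latter agrees with [forced F L], so only mixed words contribute. *)
Lemma forced_density_drop L : (L <= N)%N ->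
  forced_density 0 - forced_density L <= mixed_density L.
Proof.
move=> LN; have -> : forced_density 0 = density.
  rewrite /forced_density addn0; apply: expect_eq => s _.
  by rewrite /forced /= andbT.
rewrite -(density_firsts L) -expectB.
rewrite -(expect_unzip1 _ (fun s => (F (firsts L s))%:R - (forced F L s)%:R)).
apply: le_expect => // w; rewrite size_nseq => sw.
case m: (mixed F L w); last by rewrite (unmixed_firsts _ (negbT m)) ?subrr // sw; lia.
by case: (F _); case: (forced _ _ _) => /=; lra.
Qed.

(** For booleans [|a - b| = a + b - 2 a b]. If [a] and [b] come from two independent last entries,
    their product is the indicator of level [k.+1] by [forcedS]. *)
Lemma forced_influence k :
  expect (nseq (N + k).-1 u) (last_influence u (fun s => (forced F k s)%:R)) =
  2 * (forced_density k - forced_density k.+1).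
Proof.
have eNk : (N + k = (N + k).-1.+1)%N by lia.
rewrite /forced_density addnS {2 3}eNk expect_rcons.
set n := (N + k).-1.
have -> : expect (nseq n.+2 u) (fun s => (forced F k.+1 s)%:R) =
  expect (nseq n u) (fun s => \sum_x u x * \sum_y u y *
    ((forced F k (rcons s x))%:R * (forced F k (rcons s y))%:R)) :> R.
  rewrite expect_suml /=; apply: eq_bigr => x _; congr (_ * _).
  rewrite expect_suml; apply: eq_bigr => y _; congr (_ * _).
  by apply: expect_eq => s _; rewrite forcedS -natrM mulnb.
rewrite -expectB -expectZ; apply: expect_eq => s _.
pose a x : R := (forced F k (rcons s x))%:R.
rewrite /last_influence -/n.
have -> : \sum_b u b * (\sum_c u c * `|a b - a c|) =
  \sum_b u b * (\sum_c u c * (a b + a c + (- 2) * (a b * a c))).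
  apply: eq_bigr => b _; congr (_ * _); apply: eq_bigr => c _; congr (_ * _).
  rewrite /a; case: (forced _ _ _); case: (forced _ _ _) => /=;
    rewrite ?subrr ?normr0 ?subr0 ?sub0r ?normrN ?normr1; lra.
under eq_bigr => b _ do rewrite meanD meanD meanZ mean_const //.
rewrite meanD meanD meanZ mean_const //; rewrite -/(a _); ring.
Qed.

(** The [L] drops of the density sum to at most [nu], so one of them is at most [nu / L]. *)
Lemma exists_insensitive_level L nu : (0 < L <= N)%N -> mixed_density L <= nu ->
  exists2 k, (k < L)%N & expect (nseq (N + k).-1 u)
    (last_influence u (fun s => (forced F k s)%:R)) <= 2 * nu / L%:R.
Proof.
move=> /andP[L0 LN] mnu; have L0R : 0 < L%:R :> R by rewrite ltr0n.
pose d (i : nat) : R := forced_density i - forced_density i.+1.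
case: (boolP [exists k : 'I_L, d k <= nu / L%:R]).
  case/existsP=> k dk; exists k => //; rewrite forced_influence -mulrA.
  by rewrite ler_pM2l.
rewrite negb_exists => /forallP nd; exfalso.
have : forced_density 0 - forced_density L = \sum_(0 <= i < L) d i.
  rewrite -[LHS]opprB -(telescope_sumr forced_density (leq0n L)) -sumrN.
  by apply: eq_big_nat => i _; rewrite opprB.
have : \sum_(0 <= i < L) nu / L%:R < \sum_(0 <= i < L) d i.
  rewrite !big_mkord; apply: ltr_sum => [|k _]; last by rewrite ltNge.
  by apply/hasP; exists (Ordinal L0); rewrite ?mem_index_enum.
rewrite sumr_const_nat subn0 -(mulr_natr (nu / _)) mulfVK ?gt_eqF // => lt1 e1.
by have := forced_density_drop LN; rewrite e1; lra.
Qed.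

Lemma expect_rcons2 n (Psi : seq U -> seq U -> R) :
  \sum_x u x * (\sum_y u y * expect (nseq n u) (fun z =>
     expect (nseq n u) (fun z' => Psi (rcons z x) (rcons z' y)))) =
  expect (nseq n.+1 u) (fun z => expect (nseq n.+1 u) (Psi z)).
Proof.
rewrite expect_rcons expect_suml; apply: eq_bigr => x _; congr (_ * _).
rewrite -expect_suml; apply: expect_eq => z _.
by rewrite expect_rcons expect_suml.
Qed.

(** With the alternatives [p] shared but independent tails, the two choices use disjoint sets of
    independent entries, hence are themselves independent and uniform. *)
Lemma expect_firsts_seconds k n (Phi : seq U -> seq U -> R) :
  expect (nseq k.*2 u) (fun p => expect (nseq n u) (fun z => expect (nseq n u)
    (fun z' => Phi (firsts k (p ++ z)) (seconds k (p ++ z'))))) =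
  expect (nseq (n + k) u) (fun s => expect (nseq (n + k) u) (Phi s)).
Proof.
elim: k n => [|k IH] n; first by rewrite addn0.
rewrite addnS -addSn -IH.
under [RHS]expect_eq => p _ do rewrite -(expect_rcons2 n (fun z z' =>
  Phi (firsts k (p ++ z)) (seconds k (p ++ z')))).
rewrite expect_suml /=; apply: eq_bigr => x _; congr (_ * _).
rewrite expect_suml /=; apply: eq_bigr => y _; congr (_ * _).
apply: expect_eq => p _; apply: expect_eq => z _; apply: expect_eq => z' _.
by rewrite !rcons_cat.
Qed.

(** The values [F (firsts)], [f (p ++ z)], [G p], [f (p ++ z')], [F (seconds)] are compared in this
    order. The outer comparisons cost [nu] each and the inner ones [2 * 4 nu] each, so two
    independent lists disagree about [F] with probability at most [18 nu]; this probability is twice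
    the left side. *)
Lemma density_variance k nu (W L : nat) (estar : R) : (0 < L)%N -> (0 < W)%N ->
  N = (W * L)%N -> (k < L)%N -> 0 <= estar ->
  mixed_density k <= nu ->
  expect (nseq (N + k).-1 u)
    (last_influence u (fun s => (forced F k s)%:R)) <= 2 * nu / L%:R ->
  (forall S, mass u S <= 192%:R * W%:R / L%:R -> edge_mass u P S <= estar) ->
  16%:R * W%:R * N%:R * estar <= nu / 2 ->
  density * (1 - density) <= 9%:R * nu.
Proof.
move=> L0 W0 eN kL es0 mnu infl sse small.
have L0R : 0 < L%:R :> R by rewrite ltr0n.
have W0R : 0 < W%:R :> R by rewrite ltr0n.
have kN : (k < N)%N by rewrite eN; nia.
pose f s : R := (forced F k s)%:R.
pose M := (N + k)%N.
pose n := (N - k).-1.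
have en : n.+1 = (N - k)%N by rewrite /n; lia.
have eNn : (n.+1 + k = N)%N by rewrite en subnK // ltnW.
have eM : M = (k.*2 + n.+1)%N by rewrite /M en; lia.
have f01 s : 0 <= f s <= 1 by rewrite /f; case: (forced _ _ _) => /=; lra.
have symf q x r : (k.*2 <= size q)%N -> f (q ++ x :: r) = f (rcons (q ++ r) x).
  move=> kq; rewrite /f -(cat_take_drop k.*2 q) -!catA rcons_cat.
  congr (_%:R); congr nat_of_bool; apply: forced_perm => //.
    by rewrite size_takel.
  by rewrite -cats1 -catA perm_cat2l cats1 perm_sym perm_rcons.
(* [3 * lam / tau] is the bound [192 * W / L] on the mass of [S]. *)
pose tau : R := (8%:R * W%:R)^-1.
pose lam : R := 8%:R / L%:R.
have tau0 : 0 < tau by rewrite invr_gt0 mulr_gt0 ?ltr0n.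
have lam0 : 0 < lam by rewrite divr_gt0 ?ltr0n.
pose G := smooth_mean u P f M.
have nu0 : 0 <= nu.
  by apply: le_trans mnu; apply: expect_ge0 => // s _; rewrite ler0n.
have varG : expect (nseq k.*2 u) (fun p => expect (nseq n.+1 u) (fun z =>
    (G (p ++ z) - G p) ^+ 2)) <= nu.
  apply: le_trans (smooth_variance du dP stat f01 symf eM lam0 tau0 es0 _) _.
    move=> S hS; apply: sse; apply: le_trans hS _.
    rewrite le_eqVlt; apply/orP; left; apply/eqP; rewrite /lam /tau; field.
    by rewrite !gt_eqF.
  have -> : (k.*2 + n = (N + k).-1)%N by rewrite -/M eM addnS.
  set I := expect _ _ in infl *.
  have I0 : 0 <= I by apply: expect_ge0 => // s _; apply: last_influence_ge0.
  have nN : n.+1%:R <= N%:R :> R by rewrite ler_nat en leq_subr.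
  have t1 : n.+1%:R * (2 / tau * estar) <= nu / 2.
    apply: le_trans small; rewrite /tau invrK.
    have : n.+1%:R * (W%:R * estar) <= N%:R * (W%:R * estar).
      by rewrite ler_wpM2r // mulr_ge0 // ltW.
    move=> ?; lra.
  (* Both [N * tau] and [lam^-1] equal [L / 8], so an influence of [2 nu / L] costs [nu / 2]. The
     other half of [nu] is the term with [estar]. *)
  have c1 : n.+1%:R * tau + lam^-1 <= L%:R / 4%:R.
    have : n.+1%:R * tau <= L%:R / 8%:R.
      apply: le_trans (_ : N%:R * tau <= _); first by rewrite ler_pM2r.
      rewrite eN natrM /tau le_eqVlt; apply/orP; left; apply/eqP; field.
      by rewrite gt_eqF.
    rewrite /lam invf_div; lra.
  have : (n.+1%:R * tau + lam^-1) * I <= L%:R / 4%:R * (2 * nu / L%:R).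
    apply: ler_pM => //; apply: addr_ge0; last by rewrite invr_ge0 ltW.
    by apply: mulr_ge0 => //; exact: ltW.
  have -> : L%:R / 4%:R * (2 * nu / L%:R) = nu / 2 by field; rewrite gt_eqF.
  lra.
have splitM h : expect (nseq M u) h =
    expect (nseq k.*2 u) (fun p => expect (nseq n.+1 u) (fun z => h (p ++ z))) :> R.
  by rewrite eM expect_nseqD.
have kM : (k.*2 <= M)%N by rewrite eM leq_addr.
(* At full length [G s] is the mean of [f] after one step from [s]. The difference lies in
   [[-1, 1]], so its square is at most its absolute value, and [f] changes along the step only if
   the word of edges is mixed. *)
have fG : expect (nseq M u) (fun s => (f s - G s) ^+ 2) <= nu.
  apply: le_trans mnu.
  apply: le_trans (_ : expect (nseq M u) (fun s =>
     expect (map P s) (fun d => `|f s - f d|)) <= _).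
    apply: le_expect => // s; rewrite size_nseq => ss.
    have : `|f s - G s| <= expect (map P s) (fun d => `|f s - f d|).
      apply: le_trans (expect_norm _ _) => //.
      rewrite expectB expect_const // le_eqVlt; apply/orP; left; apply/eqP.
      congr (`|_ - _|); apply: expect_eq => d; rewrite size_map => sd.
      by rewrite /tail_mean sd ss subnn /= cats0.
    apply: le_trans; rewrite -real_normK ?num_real // expr2 ler_piMr //.
    have := f01 s; have /andP[] : 0 <= G s <= 1 by apply: smooth_mean01.
    by move=> *; rewrite ler_norml; lra.
  rewrite -(expect_edge u P M (fun s d => `|f s - f d|)).
  apply: le_expect => // w; rewrite size_nseq => sw.
  case m: (mixed F k w).
    by rewrite /f; case: (forced _ _ _); case: (forced _ _ _) => /=;
      rewrite ?subrr ?normr0 ?subr0 ?sub0r ?normrN ?normr1 ?ler01 ?lexx.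
  by rewrite /f (unmixed_forced _ (negbT m)) ?subrr ?normr0 ?sw.
(* From [(x + y)^2 <= 2 x^2 + 2 y^2], with [fG] and [varG] contributing [2 nu] each. *)
have f_Gp : expect (nseq k.*2 u) (fun p => expect (nseq n.+1 u) (fun z =>
    (f (p ++ z) - G p) ^+ 2)) <= 4%:R * nu.
  apply: le_trans (_ : expect (nseq k.*2 u) (fun p => expect (nseq n.+1 u) (fun z =>
    2 * (f (p ++ z) - G (p ++ z)) ^+ 2 + 2 * (G (p ++ z) - G p) ^+ 2)) <= _).
    apply: le_expect => // p _; apply: le_expect => // z _.
    by have := sqr_ge0 ((f (p ++ z) - G (p ++ z)) - (G (p ++ z) - G p)); nra.
  under expect_eq => p _ do rewrite expectD !expectZ.
  rewrite expectD !expectZ -(splitM (fun s => (f s - G s) ^+ 2)); lra.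
have firsts_bad : expect (nseq M u) (fun s => `|(F (firsts k s))%:R - f s|) <= nu.
  apply: le_trans mnu; rewrite -(expect_unzip1 _ (fun s => `|(F (firsts k s))%:R - f s|)).
  apply: le_expect => // w; rewrite size_nseq => sw; rewrite /f.
  case m: (mixed F k w); last by rewrite (unmixed_firsts _ (negbT m)) ?subrr ?normr0 // sw.
  by case: (F _); case: (forced _ _ _) => /=;
      rewrite ?subrr ?normr0 ?subr0 ?sub0r ?normrN ?normr1 ?ler01 ?lexx.
have seconds_bad : expect (nseq M u) (fun s => `|(F (seconds k s))%:R - f s|) <= nu.
  apply: le_trans mnu; rewrite -(expect_unzip1 _ (fun s => `|(F (seconds k s))%:R - f s|)).
  apply: le_expect => // w; rewrite size_nseq => sw; rewrite /f.
  case m: (mixed F k w); last by rewrite (unmixed_seconds _ (negbT m)) ?subrr ?normr0 // sw.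
  by case: (F _); case: (forced _ _ _) => /=;
      rewrite ?subrr ?normr0 ?subr0 ?sub0r ?normrN ?normr1 ?ler01 ?lexx.
have two_mu : 2 * (density * (1 - density)) =
    expect (nseq N u) (fun s => expect (nseq N u) (fun s' => disagree R (F s) (F s'))).
  under [RHS]expect_eq => s _ do
    rewrite /disagree expectD !expectZ expectB expect_const // -/density.
  under [RHS]expect_eq => s _ do rewrite mulrC [X in _ + X]mulrC.
  rewrite expectD !expectZ expectB expect_const // -/density; ring.
have joint := expect_firsts_seconds k n.+1 (fun s s' => disagree R (F s) (F s')).
rewrite eNn -two_mu in joint.
have : 2 * (density * (1 - density)) <= 18%:R * nu; last by lra.
rewrite -joint.
apply: le_trans (_ : expect (nseq k.*2 u) (fun p => expect (nseq n.+1 u) (fun z =>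
   expect (nseq n.+1 u) (fun z' => (`|(F (firsts k (p ++ z)))%:R - f (p ++ z)| +
     2 * (f (p ++ z) - G p) ^+ 2) + (2 * (f (p ++ z') - G p) ^+ 2 +
    `|(F (seconds k (p ++ z')))%:R - f (p ++ z')|)))) <= _).
  apply: le_expect => // p _; apply: le_expect => // z _; apply: le_expect => // z' _.
  have : (f (p ++ z) - f (p ++ z')) ^+ 2 <=
     2 * (f (p ++ z) - G p) ^+ 2 + 2 * (f (p ++ z') - G p) ^+ 2.
    by have := sqr_ge0 ((f (p ++ z) - G p) + (f (p ++ z') - G p)); nra.
  exact: disagree_le.
under expect_eq => p _.
  under expect_eq => z _ do rewrite expectD expect_const //.
  rewrite expectD expect_const //.
  rewrite !expectD !expectZ.
  over.
rewrite !expectD !expectZ.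
rewrite -(splitM (fun s => `|(F (firsts k s))%:R - f s|)).
rewrite -(splitM (fun s => `|(F (seconds k s))%:R - f s|)).
lra.
Qed.

Theorem density_dichotomy nu (W L : nat) (estar : R) : (0 < L)%N -> (0 < W)%N ->
  N = (W * L)%N -> 0 <= estar -> mixed_density L <= nu ->
  (forall S, mass u S <= 192%:R * W%:R / L%:R -> edge_mass u P S <= estar) ->
  16%:R * W%:R * N%:R * estar <= nu / 2 ->
  density * (1 - density) <= 9%:R * nu.
Proof.
move=> L0 W0 eN es0 mnu sse small.
have LN : (0 < L <= N)%N by rewrite L0 eN; nia.
have [k kL infl] := exists_insensitive_level LN mnu.
apply: (density_variance L0 W0 eN kL es0 _ infl sse small).
apply: le_trans mnu; exact: mixed_density_le (ltnW kL).
Qed.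

End Core.

(** * The gadget *)

Section ListGraph.
Variables (T : eqType) (s : seq T) (r : rel T).
Hypotheses (rsym : symmetric r) (rirr : irreflexive r).

Let at_ (i : 'I_(size s)) : T := tnth (in_tuple s) i.

(** The vertices are positions in the list, so the adjacency matrix is written in the order in which
    two nested loops over the list visit pairs. *)
Definition list_graph : graph :=
  @Graph (size s) (fun i j => r (at_ i) (at_ j))
    (fun i j => rsym (at_ i) (at_ j)) (fun i => rirr (at_ i)).

Lemma encode_list_graph :
  encode list_graph = nseq (size s) true ++ false :: [seq r x y | x <- s, y <- s].
Proof.
have es : s = map at_ (enum 'I_(size s)) by rewrite (map_tnth_enum (in_tuple s)).
rewrite /encode /=; congr (_ ++ _ :: _).
by rewrite [in RHS]es allpairs_mapl allpairs_mapr.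
Qed.

Lemma card_list_graph (a : pred T) : #|[set i | a (at_ i)]| = count a s.
Proof.
have es : s = map at_ (enum 'I_(size s)) by rewrite (map_tnth_enum (in_tuple s)).
rewrite [in RHS]es count_map -sum1_count big_enum_cond /= -sum1_card.
by apply: eq_bigl => i; rewrite !inE.
Qed.

Hypothesis us : uniq s.

Lemma list_graph_set (S : {set 'I_(size s)}) : exists a : pred T,
  S = [set i | a (at_ i)].
Proof.
exists (fun x => [exists i in S, at_ i == x]); apply/setP => i; rewrite inE.
apply/idP/existsP => [iS|[j /andP[jS /eqP eji]]]; first by exists i; rewrite iS eqxx.
have : uniq (in_tuple s) by [].
by move/tuple_uniqP => inj; rewrite -(inj _ _ eji).
Qed.

Definition list_nbr (a : pred T) : pred T :=
  fun x => ~~ a x && has (fun y => a y && r y x) s.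

Lemma list_graph_neighborhood (a : pred T) :
  neighborhood (G := list_graph) [set i | a (at_ i)] = [set i | list_nbr a (at_ i)].
Proof.
apply/setP => i; rewrite !inE; congr (_ && _).
apply/existsP/hasP => [[j]|[y ys ary]].
  rewrite inE /= => /andP[aj rji]; exists (at_ j); first exact: mem_tnth.
  by rewrite aj.
have /tnthP[j ej] : y \in in_tuple s by [].
by exists j; move: ary; rewrite inE ej.
Qed.

Variable R : realType.

Definition portion (a : pred T) : R := (count a s)%:R / (size s)%:R.

Hypothesis s0 : s != [::].

Let n0 : (0 : R) < (size s)%:R.
Proof. by rewrite ltr0n; case: s s0. Qed.

Lemma list_vertex_expansion (a : pred T) :
  vertex_expansion (G := list_graph) R [set i | a (at_ i)] =
  portion (list_nbr a) / (portion a * (1 - portion a)).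
Proof.
rewrite /vertex_expansion list_graph_neighborhood.
have -> : ~: [set i | a (at_ i)] = [set i | predC a (at_ i)].
  by apply/setP => i; rewrite !inE.
rewrite !card_list_graph /portion /=.
have -> : (count (predC a) s)%:R = (size s)%:R - (count a s)%:R :> R.
  by rewrite -(count_predC a s) natrD addrC addKr.
have -> : 1 - (count a s)%:R / (size s)%:R =
    ((size s)%:R - (count a s)%:R) / (size s)%:R :> R.
  by rewrite mulrBl divff ?gt_eqF.
rewrite !invfM !invrK.
set x := (_ - _)^-1; set y := (count a s)%:R^-1; move: n0.
set n : R := (size s)%:R => n_gt0; set z : R := (count _ s)%:R.
move: x y z => x y z; field; exact: lt0r_neq0.
Qed.

Lemma portion_ge0 a : 0 <= portion a.
Proof. by rewrite divr_ge0. Qed.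

Lemma portion_le a b : {in s, subpred a b} -> portion a <= portion b.
Proof.
move=> ab; rewrite ler_pM2r ?invr_gt0 // ler_nat -!size_filter.
apply: uniq_leq_size; first exact: filter_uniq.
by move=> x; rewrite !mem_filter => /andP[ax xs]; rewrite xs ab.
Qed.

Lemma portionU a b : portion (predU a b) <= portion a + portion b.
Proof.
rewrite -mulrDl ler_pM2r ?invr_gt0 // -natrD ler_nat.
by rewrite -(count_predUI a b) leq_addr.
Qed.

Lemma portionC a : portion (predC a) = 1 - portion a.
Proof.
have -> : 1 = (size s)%:R / (size s)%:R :> R by rewrite divff ?gt_eqF.
rewrite -mulrBl; congr (_ / _).
by rewrite -[in RHS](count_predC a s) natrD addrC addKr.
Qed.

Lemma portion_le1 a : portion a <= 1.
Proof. by rewrite ler_pdivrMr // mul1r ler_nat count_size. Qed.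

End ListGraph.

Fixpoint words (T : Type) (E : seq T) (K : nat) : seq (seq T) :=
  if K is K'.+1 then [seq e :: w | e <- E, w <- words E K'] else [:: [::]].

Lemma size_words (T : Type) (E : seq T) K : size (words E K) = (size E ^ K)%N.
Proof. by elim: K => //= K IH; rewrite size_allpairs IH expnS. Qed.

Lemma uniq_words (T : eqType) (E : seq T) K : uniq E -> uniq (words E K).
Proof.
move=> uE; elim: K => //= K IH; apply: allpairs_uniq => //.
by move=> [e w] [e' w'] _ _ /= [-> ->].
Qed.

Lemma size_mem_words (T : eqType) (E : seq T) K w : w \in words E K -> size w = K.
Proof.
elim: K w => [|K IH] w /=; first by rewrite inE => /eqP ->.
by case/allpairsP => [[e v] /= [_ /IH sv ->]] /=; rewrite sv.
Qed.

Section WordsExpectation.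
Variables (R : realType) (T : finType) (E : seq T) (w : T -> R).
Hypothesis Ew : forall h : T -> R, \sum_(e <- E) h e = (size E)%:R * \sum_e w e * h e.

Lemma sum_words K (h : seq T -> R) :
  \sum_(v <- words E K) h v = (size (words E K))%:R * expect (nseq K w) h.
Proof.
rewrite size_words; elim: K h => [|K IH] h /=; first by rewrite big_seq1 mul1r.
rewrite big_allpairs_dep /=.
under eq_bigr => e _ do rewrite IH.
by rewrite -mulr_sumr Ew mulrA -natrM mulnC -expnS.
Qed.

Lemma expect_portion K (a : pred (seq T)) : words E K != [::] ->
  expect (nseq K w) (fun v => (a v)%:R) = portion (words E K) R a.
Proof.
move=> ne; have n0 : (size (words E K))%:R != 0 :> R.
  by rewrite pnatr_eq0; case: (words E K) ne.
apply: (mulfI n0); rewrite -sum_words /portion mulrC divfK //.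
by rewrite -sum1_count natr_sum [RHS]big_mkcond /=; apply: eq_bigr => v _; case: (a v).
Qed.

End WordsExpectation.

Section WordRelation.
Variables (T : eqType) (C : pred T) (L : nat).
Implicit Types w : seq (T * T).

Definition universal w : bool := if w is e :: _ then C e.1 else false.

(** Points are compared as multisets. This makes the set of points of a set of words invariant under
    permutations, as the smoothing argument requires. *)
Definition share w w' : bool :=
  has (fun p => has (perm_eq p) (points L w')) (points L w).

Definition word_rel w w' : bool :=
  (w != w') && [|| universal w, universal w' | share w w'].

Lemma share_sym : symmetric share.
Proof.
have imp w w' : share w w' -> share w' w.
  case/hasP => p pw /hasP[q qw pq]; apply/hasP; exists q => //.
  by apply/hasP; exists p => //; rewrite perm_sym.
by move=> w w'; apply/idP/idP; apply: imp.
Qed.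

Lemma word_rel_sym : symmetric word_rel.
Proof. by move=> w w'; rewrite /word_rel eq_sym share_sym orbCA. Qed.

Lemma word_rel_irr : irreflexive word_rel.
Proof. by move=> w; rewrite /word_rel eqxx. Qed.

End WordRelation.

(** If no alternative satisfies [a], the common tail alone decides, and it belongs to every pick. *)
Lemma picks_has (T : eqType) (a : pred T) L s p : (L.*2 <= size s)%N ->
  ~~ has a (take L.*2 s) -> p \in picks L s -> has a p = has a (drop L.*2 s).
Proof.
elim: L s p => [|L IH] s p /=; first by rewrite drop0 inE => _ _ /eqP ->.
case: s => [|x [|y s]] //=; rewrite !ltnS => Ls.
rewrite !negb_or => /and3P[nx ny ns]; rewrite mem_cat.
have step z : ~~ a z -> p \in picks L (rcons s z) -> has a p = has a (drop L.*2 s).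
  move=> nz /IH ->; rewrite ?size_rcons ?leqW //.
    by rewrite drop_rcons // has_rcons (negPf nz).
  by rewrite -cats1 takel_cat.
by case/orP; apply: step.
Qed.

(** If no edge of the word crosses the boundary of [a], both vertex lists meet [a] at the same
    places; if moreover the first [2 L] places avoid [a], all points meet [a] or none does. *)
Lemma mixed_has (T : eqType) (a : pred T) L (w : seq (T * T)) : (L.*2 <= size w)%N ->
  mixed (has a) L w ->
  has a (take L.*2 (unzip1 w)) || has (fun e => a e.1 != a e.2) w.
Proof.
move=> Lw mw; apply/norP => -[ns nf].
have e12 : map a (unzip1 w) = map a (unzip2 w).
  rewrite -!map_comp; apply/eq_in_map => e ew /=; apply/eqP/negPn/negP => ne.
  by move/hasP: nf; apply; exists e.
have has_id (l : seq T) : has a l = has id (map a l) by rewrite has_map.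
have key p : p \in points L w -> has a p = has a (drop L.*2 (unzip1 w)).
  rewrite mem_cat => /orP[] /picks_has -> //; rewrite ?size_map //.
    by rewrite !has_id !map_drop e12.
  by rewrite has_id map_take -e12 -map_take -has_id.
case/andP: mw => /hasP[p pw hp] /allPn[q qw nq].
by move: nq; rewrite (key q qw) -(key p pw) hp.
Qed.

(** * Soundness and completeness of the gadget *)

Section Gadget.
Variables (R : realType) (U : finType) (e : rel U) (k : nat) (E : seq (U * U)).
Hypothesis esym : symmetric e.
Hypothesis k0 : (0 < k)%N.
Hypothesis ereg : forall b, #|[set d | e b d]| = k.
Hypothesis U0 : (0 < #|U|)%N.
Hypothesis uE : uniq E.
Hypothesis memE : forall p, (p \in E) = e p.1 p.2.
Variables (C : {set U}) (W L : nat).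
Hypotheses (L0 : (0 < L)%N) (W0 : (0 < W)%N).

Definition unif (b : U) : R := #|U|%:R^-1.
Definition walk (b d : U) : R := (e b d)%:R / k%:R.

Let N := (W * L)%N.
Let s := words E (N + L).
Let r := word_rel (mem C) L.

Let k0R : k%:R != 0 :> R. Proof. by rewrite pnatr_eq0 -lt0n. Qed.
Let U0R : #|U|%:R != 0 :> R. Proof. by rewrite pnatr_eq0 -lt0n. Qed.

Lemma unif_dist : dist unif.
Proof.
split=> [x|]; first by rewrite invr_ge0.
by rewrite /unif sumr_const -[LHS]mulr_natr mulVf.
Qed.

Lemma sum_adj b : \sum_d (e b d)%:R = k%:R :> R.
Proof.
rewrite -(ereg b) -sum1_card natr_sum [RHS]big_mkcond /=.
by apply: eq_bigr => d _; rewrite inE; case: (e b d).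
Qed.

Lemma walk_dist b : dist (walk b).
Proof.
split=> [x|]; first by rewrite divr_ge0.
by rewrite -mulr_suml sum_adj divff.
Qed.

Lemma walk_stationary y : \sum_b unif b * walk b y = unif y.
Proof.
rewrite -mulr_sumr -mulr_suml.
by under eq_bigr => b _ do rewrite esym; rewrite sum_adj divff ?mulr1.
Qed.

Lemma sum_edges (h : U * U -> R) : \sum_(p <- E) h p = \sum_p (e p.1 p.2)%:R * h p.
Proof.
rewrite (big_uniq _ uE) /= big_mkcond /=; apply: eq_bigr => p _.
by rewrite memE; case: (e _ _); rewrite ?mul1r ?mul0r.
Qed.

Lemma size_edges : (size E)%:R = #|U|%:R * k%:R :> R.
Proof.
rewrite -sum1_size natr_sum sum_edges.
rewrite -(pair_big xpredT xpredT (fun b d => (e b d)%:R * 1)) /=.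
under eq_bigr => b _ do (under eq_bigr => d _ do rewrite mulr1; rewrite sum_adj).
by rewrite sumr_const -[LHS]mulr_natl.
Qed.

Let we := edge_weight unif walk.

Lemma edges_weight (h : U * U -> R) :
  \sum_(p <- E) h p = (size E)%:R * \sum_p we p * h p.
Proof.
rewrite size_edges sum_edges mulr_sumr; apply: eq_bigr => p _.
by rewrite /we /edge_weight /unif /walk; field; rewrite k0R U0R.
Qed.

Lemma words_nonnil : s != [::].
Proof.
rewrite -size_eq0 size_words -lt0n expn_gt0 lt0n -(eqr_nat R) size_edges.
by rewrite mulf_neq0.
Qed.

Let us : uniq s. Proof. exact: uniq_words. Qed.
Hint Resolve words_nonnil us : core.

Local Notation portion := (portion s R).

Lemma portion_expect (a : pred (seq (U * U))) :
  portion a = expect (nseq (N + L) we) (fun v => (a v)%:R).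
Proof. by rewrite (expect_portion (E := E)) //; exact: edges_weight. Qed.

Lemma portion_unzip1 (a : pred (seq U)) :
  portion (fun v => a (unzip1 v)) = expect (nseq (N + L) unif) (fun b => (a b)%:R).
Proof. by rewrite portion_expect (expect_unzip1 _ walk_dist _ (fun b => (a b)%:R)). Qed.

Let N0 : (0 < N)%N. Proof. by rewrite muln_gt0 W0. Qed.

Lemma portion_universal : portion (universal (mem C)) = mass unif C.
Proof.
pose h (b : seq U) := if b is x :: _ then x \in C else false.
have -> : portion (universal (mem C)) = portion (fun v => h (unzip1 v)).
  by congr (_%:R / _); apply: eq_count => -[|[x y] v].
rewrite portion_unzip1; have -> : (N + L = (N + L).-1.+1)%N by lia.
rewrite /mass /=; apply: eq_bigr => x _; rewrite expect_const //.
exact: dists_nseq unif_dist.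
Qed.

Definition hit_points (a : pred (seq (U * U))) : pred (seq U) :=
  fun p => has (fun w => a w && has (perm_eq p) (points L w)) s.

Lemma hit_points_perm a p q : perm_eq p q -> hit_points a p = hit_points a q.
Proof.
move=> /permPl pq; apply: eq_has => w; congr (_ && _); apply: eq_has => x.
exact: pq.
Qed.

Lemma hit_pointsP (a : pred (seq (U * U))) w p : w \in s -> a w -> p \in points L w -> hit_points a p.
Proof.
by move=> ws aw pw; apply/hasP; exists w => //; rewrite aw; apply/hasP; exists p.
Qed.

Lemma hit_points_nbr (a : pred (seq (U * U))) w p : w \in s -> ~~ a w -> p \in points L w ->
  hit_points a p -> list_nbr s r a w.
Proof.
move=> ws naw pw /hasP[w' w's /andP[aw' /hasP[q qw' pq]]].
rewrite /list_nbr naw; apply/hasP; exists w' => //; rewrite aw' /=.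
apply/andP; split; first by apply: contraNneq naw => <-.
apply/orP; right; apply/orP; right; rewrite share_sym.
by apply/hasP; exists p => //; apply/hasP; exists q.
Qed.

Lemma firsts_in_points (w : seq (U * U)) : (L.*2 <= size w)%N -> firsts L (unzip1 w) \in points L w.
Proof.
move=> sw; rewrite mem_cat; apply/orP; left.
have /hasP[p pw /eqP <-] // : has (pred1 (firsts L (unzip1 w))) (picks L (unzip1 w)).
by apply: has_firsts => /=; rewrite ?size_map.
Qed.

Lemma size_word (w : seq (U * U)) : w \in s -> (L.*2 <= size w)%N.
Proof. by move/size_mem_words ->; rewrite /N; nia. Qed.

(** With [F] the set of points of words of [A], a word of [A] has all points in [F], and a word
    outside [A] with a point in [F] is a neighbour. So [mu] lies between [t] and [t + nu], and the
    dichotomy for [mu] carries over to [t]. *)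
Lemma gadget_sound (estar : R) : 0 <= estar ->
  (forall S, mass unif S <= 192%:R * W%:R / L%:R -> edge_mass unif walk S <= estar) ->
  16%:R * W%:R * N%:R * estar <= mass unif C / 2 ->
  forall S : {set 'I_(size s)}, S != set0 -> S != setT ->
  10%:R^-1 <= vertex_expansion (G := list_graph s
    (word_rel_sym (mem C) L) (word_rel_irr (mem C) L)) R S.
Proof.
move=> es0 sse small S S0 S1; have [a eS] := list_graph_set us S.
move: S0 S1; rewrite {}eS => S0 S1; rewrite list_vertex_expansion; last exact: words_nonnil.
set t := portion a; set nu := portion _.
have npos : (0 : R) < (size s)%:R by rewrite ltr0n lt0n size_eq0 words_nonnil.
have [w0 w0s aw0] : exists2 w, w \in s & a w.
  have /set0Pn[i] := S0; rewrite inE => ai; exists (tnth (in_tuple s) i) => //.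
  exact: mem_tnth.
have [w1 w1s aw1] : exists2 w, w \in s & ~~ a w.
  have /set0Pn[i] : ~: [set i | a (tnth (in_tuple s) i)] != set0.
    by apply: contraNneq S1 => h; rewrite -(setCK [set i | _]) h setC0.
  rewrite !inE => ai; exists (tnth (in_tuple s) i) => //; exact: mem_tnth.
have t0 : 0 < t by rewrite divr_gt0 // ltr0n -has_count; apply/hasP; exists w0.
have t1 : t < 1.
  rewrite -subr_gt0 -(portionC R words_nonnil) divr_gt0 // ltr0n -has_count.
  by apply/hasP; exists w1.
have tt0 : 0 < t * (1 - t) by rewrite mulr_gt0 // subr_gt0.
rewrite ler_pdivlMr //.
(* If [A] contains a universal word, its neighbourhood is the whole complement. Otherwise all
   universal words are neighbours of [A], which yields [mass unif C <= nu]. *)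
case: (boolP (has (fun w => a w && universal (mem C) w) s)) => [/hasP[w ws /andP[aw Cw]]|nu_a].
  have : 1 - t <= nu.
    rewrite -(portionC R words_nonnil); apply: portion_le => // v vs /= av.
    rewrite /list_nbr av; apply/hasP; exists w => //; rewrite aw /= /r /word_rel Cw /= andbT.
    by apply: contraNneq av => <-.
  by move=> ?; nra.
have univ_nbr : {in s, subpred (universal (mem C)) (list_nbr s r a)}.
  move=> w ws Cw; have naw : ~~ a w.
    by apply: contraNN nu_a => aw; apply/hasP; exists w; rewrite ?aw.
  rewrite /list_nbr naw; apply/hasP; exists w0 => //; rewrite aw0 /r /word_rel Cw orbT andbT.
  by apply: contraNneq naw => <-.
have nuC : mass unif C <= nu by rewrite -portion_universal; apply: portion_le => //; exact: univ_nbr.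
pose F := hit_points a.
have Fperm : forall p q, perm_eq p q -> F p = F q by exact: hit_points_perm.
have mix : mixed_density unif walk F N L <= nu.
  rewrite /mixed_density -portion_expect; apply: portion_le => // w ws /andP[/hasP[p pw Fp] nF].
  apply: (hit_points_nbr ws _ pw Fp); apply: contraNN nF => aw.
  by apply/allP => q qw; apply: (hit_pointsP ws aw qw).
have small' : 16%:R * W%:R * N%:R * estar <= nu / 2.
  by apply: le_trans small _; rewrite ler_pM2r ?invr_gt0.
have dich := density_dichotomy unif_dist walk_dist walk_stationary Fperm N0 L0 W0
  erefl es0 mix sse small'.
have mu_eq : density unif F N = portion (fun w => F (firsts L (unzip1 w))).
  by rewrite (portion_unzip1 (fun b => F (firsts L b))) (density_firsts unif_dist).
have mu_ge : t <= density unif F N.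
  rewrite mu_eq; apply: portion_le => // w ws aw.
  by apply: (hit_pointsP ws aw); apply: firsts_in_points (size_word ws).
have mu_le : density unif F N <= t + nu.
  rewrite mu_eq; apply: le_trans (portionU R words_nonnil a (list_nbr s r a)).
  apply: portion_le => // w ws Fw /=; case aw: (a w) => //=.
  by apply: (hit_points_nbr ws (negbT aw) _ Fw); apply: firsts_in_points (size_word ws).
have mu1 : density unif F N <= 1 by rewrite mu_eq portion_le1.
move: dich mu_ge mu_le mu1; set mu := density _ _ _ => dich mu_ge mu_le mu1.
(* The difference [t (1 - t) - mu (1 - mu)] is [(mu - t) (mu + t - 1)]; this inequality bounds it by
   [mu - t <= nu], whence [t (1 - t) <= 10 nu]. *)
have : 0 <= (mu - t) * (2 - t - mu) by rewrite mulr_ge0 ?subr_ge0 //; lra.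
nra.
Qed.

Lemma expect_has_le (T : finType) (w : T -> R) n (a : pred T) : dist w ->
  expect (nseq n w) (fun v => (has a v)%:R) <= n%:R * \sum_x w x * (a x)%:R.
Proof.
move=> dw; elim: n => [|n IH]; first by rewrite /= mul0r.
apply: le_trans (_ : \sum_x w x * ((a x)%:R + expect (nseq n w) (fun v => (has a v)%:R)) <= _).
  apply: le_mean => // x; rewrite -[X in X + _](expect_const _ (dists_nseq n dw)) -expectD.
  apply: le_expect => [|v _]; first exact: dists_nseq.
  rewrite /=; case: (a x); case: (has a v) => /=; lra.
by rewrite meanD mean_const // -[n.+1]addn1 natrD mulrDl mul1r addrC lerD2r.
Qed.

Lemma expect_has_ge n (S : {set U}) :
  expect (nseq n unif) (fun v => (has (mem S) v)%:R) = 1 - (1 - mass unif S) ^+ n.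
Proof.
have dn m := dists_nseq m unif_dist.
elim: n => [|n IH]; first by rewrite /= expr0 subrr.
have -> : expect (nseq n.+1 unif) (fun v => (has (mem S) v)%:R) =
   \sum_x unif x * ((x \in S)%:R * (1 - mass unif S) ^+ n + (1 - (1 - mass unif S) ^+ n)).
  apply: eq_bigr => x _; congr (_ * _); rewrite -IH.
  case xS: (x \in S); last first.
    by rewrite mul0r add0r; apply: expect_eq => v _ /=; rewrite xS.
  rewrite mul1r IH addrC subrK -[RHS](expect_const _ (dn n)).
  by apply: expect_eq => v _ /=; rewrite xS.
rewrite meanD mean_const //; last exact: unif_dist.
under eq_bigr => x _ do rewrite mulrA.
by rewrite -mulr_suml -/(mass unif S) exprS; ring.
Qed.

(** Bernoulli in the form [(1 - d)^n <= 1 / (1 + n d)]. With [n d >= 1/4] a list meets [S] with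
    probability at least 1/5. *)
Lemma expr_bernoulli (d : R) n : 0 <= d <= 1 -> (1 - d) ^+ n * (1 + n%:R * d) <= 1.
Proof.
move=> /andP[d0 d1]; elim: n => [|n IH]; first by rewrite mul0r expr0 addr0 mul1r.
apply: le_trans IH; rewrite exprSr -mulrA; apply: ler_wpM2l.
  by rewrite exprn_ge0 // subr_ge0.
have n0 : (0 : R) <= n%:R by rewrite ler0n.
by rewrite -[n.+1]addn1 natrD; nra.
Qed.

(** The three terms of [bad] account for the alternatives meeting [S], the edges leaving [S] and the
    universal words. The first two bound the mixed words, and every neighbour of [A] is mixed or
    universal. *)
Lemma gadget_complete (S : {set U}) (flip bad : R) :
  \sum_p we p * (((p.1 \in S) != (p.2 \in S))%:R) <= flip ->
  4%:R^-1 <= N%:R * mass unif S <= 2^-1 ->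
  L.*2%:R * mass unif S + (N + L)%:R * flip + mass unif C <= bad -> bad <= 10%:R^-1 ->
  exists A : {set 'I_(size s)},
  [/\ A != set0, A != setT, #|A|%:R <= (size s)%:R / 2 :> R &
  vertex_expansion (G := list_graph s
    (word_rel_sym (mem C) L) (word_rel_irr (mem C) L)) R A <= 20%:R * bad].
Proof.
move=> hflip /andP[Nd1 Nd2] hbad bad10; set d := mass unif S in Nd1 Nd2 hbad.
pose F : pred (seq U) := has (mem S).
pose a : pred (seq (U * U)) := fun w => ~~ universal (mem C) w && all F (points L w).
have du := unif_dist; have dwe : dist we by apply: edge_weight_dist => //; exact: walk_dist.
have d01 : 0 <= d <= 1.
  rewrite /d /mass; apply/andP; split.
    by apply: sumr_ge0 => x _; rewrite mulr_ge0 ?ler0n ?(proj1 du).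
  rewrite -[leRHS](mean_const 1 du).
  by apply: le_mean => // x; case: (x \in S); rewrite ?ler01 ?lexx.
have mix : portion (mixed F L) <= L.*2%:R * d + (N + L)%:R * flip.
  apply: le_trans (_ : portion (predU (fun w => has (mem S) (take L.*2 (unzip1 w)))
      (has (fun e => (e.1 \in S) != (e.2 \in S)))) <= _).
    apply: portion_le => // w ws mw.
    exact: (mixed_has (size_word ws) mw).
  apply: le_trans (portionU R words_nonnil _ _) _; apply: lerD.
    rewrite (portion_unzip1 (fun b => has (mem S) (take L.*2 b))).
    have -> : (N + L = L.*2 + (N - L))%N by rewrite -addnn -addnA subnKC 1?addnC // leq_pmull.
    rewrite expect_nseqD; apply: le_trans (expect_has_le _ _ du).
    apply: le_expect; first exact: dists_nseq.
    move=> p; rewrite size_nseq => sp.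
    rewrite le_eqVlt -[X in _ == X](expect_const _ (dists_nseq (N - L) du)).
    by rewrite (@expect_eq _ _ _ _ (fun=> (has (mem S) p)%:R)) ?eqxx // => v _;
       rewrite take_size_cat.
  rewrite portion_expect; apply: le_trans (expect_has_le _ _ dwe) _.
  by rewrite ler_wpM2l.
have dens : density unif F N = portion (fun w => F (firsts L (unzip1 w))).
  by rewrite (portion_unzip1 (fun b => F (firsts L b))) (density_firsts unif_dist).
have dens_hi : density unif F N <= 2^-1.
  by apply: le_trans Nd2; apply: expect_has_le.
have dens_lo : 5%:R^-1 <= density unif F N.
  rewrite /density expect_has_ge -/d.
  have := expr_bernoulli N d01; set x := (1 - d) ^+ N => hx.
  have x0 : 0 <= x by rewrite exprn_ge0 // subr_ge0; case/andP: d01.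
  have : x * (1 + 4%:R^-1) <= 1 by apply: le_trans hx; rewrite ler_wpM2l // lerD2l.
  move=> ?; lra.
have t_hi : portion a <= 2^-1.
  apply: le_trans dens_hi; rewrite dens; apply: portion_le => // w ws /andP[_ /allP Fw].
  exact: Fw (firsts_in_points (size_word ws)).
have t_lo : 10%:R^-1 <= portion a.
  (* A word whose first choice meets [S] is in [A], mixed or universal. Hence [A] keeps at least
     [1/5 - 1/10]. *)
  have : density unif F N <= portion a + portion (mixed F L) + portion (universal (mem C)).
    rewrite dens -addrA; apply: le_trans (_ : portion (predU a (predU (mixed F L) (universal (mem C)))) <= _).
      apply: portion_le => // w ws Fw /=; rewrite /a.
      case: (universal _ _) => /=; first by rewrite !orbT.
      rewrite /mixed orbF; case: (all F _) => //=; rewrite andbT.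
      by apply/hasP; exists (firsts L (unzip1 w)) => //; apply: firsts_in_points (size_word ws).
    apply: le_trans (portionU R words_nonnil _ _) _; rewrite lerD2l.
    exact: (portionU R words_nonnil).
  rewrite portion_universal => ?; lra.
have nbr : portion (list_nbr s r a) <= bad.
  apply: le_trans hbad; rewrite -portion_universal -/d.
  apply: le_trans (_ : portion (predU (mixed F L) (universal (mem C))) <= _).
    apply: portion_le => // w ws /andP[naw /hasP[w' w's /andP[aw']]].
    rewrite /r /word_rel => /andP[_]; case/andP: aw' => nuw' Fw'.
    rewrite (negPf nuw') /=; case nuw: (universal _ w); first by rewrite orbT.
    move=> /= /hasP[p pw' /hasP[q qw pq]]; rewrite orbF /mixed.
    move: naw; rewrite /a nuw /= => ->; rewrite andbT; apply/hasP; exists q => //.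
    by rewrite /F -(perm_has _ pq); apply: (allP Fw').
  by apply: le_trans (portionU R words_nonnil _ _) _; rewrite lerD2r.
have npos : (0 : R) < (size s)%:R by rewrite ltr0n lt0n size_eq0 words_nonnil.
pose A := [set i | a (tnth (in_tuple s) i)].
have cA : #|A|%:R = portion a * (size s)%:R.
  by rewrite card_list_graph divfK // gt_eqF.
have nbr0 : 0 <= portion (list_nbr s r a) by apply: portion_ge0.
exists A; split.
- apply/eqP => A0; move: cA; rewrite A0 cards0 => /eqP.
  by rewrite eq_sym mulf_eq0 !gt_eqF //; lra.
- apply/eqP => AT; move: cA; rewrite AT cardsT card_ord => /eqP.
  rewrite -[X in X == _]mul1r (inj_eq (mulIf (lt0r_neq0 npos))) => /eqP; lra.
- by rewrite cA mulrC ler_pM2l.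
rewrite list_vertex_expansion //.
(* The density of [A] lies between 1/10 and 1/2; this is the origin of the factor 20. *)
have tt : 20%:R^-1 <= portion a * (1 - portion a) by nra.
rewrite ler_pdivrMr; last by lra.
nra.
Qed.

End Gadget.

Lemma sum_pair (R : realType) (I J : finType) (f : I * J -> R) :
  \sum_p f p = \sum_i \sum_j f (i, j).
Proof. by rewrite pair_bigA; apply: eq_bigr => -[i j]. Qed.

(** * Copies of a small-set expander *)

Section InternalEdges.
Variables (R : realType) (G : graph) (k : nat).
Hypothesis greg : regular G k.
Local Notation V := 'I_(nv G).

Definition edges_between (A B : {set V}) : R :=
  \sum_x \sum_y (x \in A)%:R * (y \in B)%:R * (adj x y)%:R.

Lemma edges_between_mono (A A' B B' : {set V}) : A \subset A' -> B \subset B' ->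
  edges_between A B <= edges_between A' B'.
Proof.
move=> sA sB; apply: ler_sum => x _; apply: ler_sum => y _.
apply: ler_wpM2r; first exact: ler0n.
rewrite -!natrM ler_nat !mulnb.
case xA: (x \in A) => //=; case yB: (y \in B) => //=.
by rewrite (subsetP sA _ xA) (subsetP sB _ yB).
Qed.

Lemma cut_edges_card (B : {set V}) :
  #|cut_edges B|%:R = k%:R * #|B|%:R - edges_between B B :> R.
Proof.
have -> : #|cut_edges B|%:R =
    \sum_x \sum_y (x \in B)%:R * (1 - (y \in B)%:R) * (adj x y)%:R :> R.
  rewrite -sum1_card natr_sum big_mkcond /=.
  rewrite [RHS]pair_bigA /=.
  apply: eq_bigr => -[x y] _; rewrite inE /=.
  by case: (x \in B); case: (y \in B); case: (adj x y) => /=;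
    rewrite ?subrr ?subr0 ?mulr1 ?mulr0 ?mul0r.
have -> : k%:R * #|B|%:R = \sum_x \sum_y (x \in B)%:R * (adj x y)%:R :> R.
  rewrite -[#|B|]sum1_card natr_sum mulr_sumr [LHS]big_mkcond /=.
  apply: eq_bigr => x _; rewrite -mulr_sumr.
  have -> : \sum_y (adj x y)%:R = k%:R :> R.
    rewrite -(greg x) -sum1_card natr_sum [RHS]big_mkcond /=.
    by apply: eq_bigr => y _; rewrite inE; case: (adj x y).
  by case: (x \in B); rewrite ?mul1r ?mul0r ?mulr1.
rewrite -sumrB; apply: eq_bigr => x _; rewrite -sumrB; apply: eq_bigr => y _; ring.
Qed.

Variables (s : nat) (gam : R).
Hypotheses (s1 : (1 < s)%N) (k0 : (0 < k)%N) (sn : (s <= nv G)%N) (gam0 : 0 <= gam).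
Hypothesis expanding : forall B : {set V}, #|B| = s -> 1 - gam <= edge_expansion R k B.

Lemma extend_set (A : {set V}) : (#|A| <= s)%N -> exists2 B : {set V}, A \subset B & #|B| = s.
Proof.
move=> As; have : (s - #|A| <= #|~: A|)%N by have := cardsC A; rewrite card_ord; lia.
case/card_geqP => l [ul sl lA].
exists (A :|: [set x in l]); first exact: subsetUl.
rewrite cardsU (_ : A :&: _ = set0); last first.
  apply/setP => x; rewrite !inE; apply/negP => /andP[xA /lA].
  by rewrite inE xA.
by rewrite cards0 subn0 cardsE (card_uniqP ul) sl subnKC.
Qed.

(** The expansion hypothesis concerns sets of size exactly [s], so [A] is enlarged to such a set,
    which only adds edges. *)
Lemma internal_small (A : {set V}) : (#|A| <= s)%N ->
  edges_between A A <= gam * k%:R * s%:R.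
Proof.
move=> /extend_set[B AB Bs]; apply: le_trans (edges_between_mono AB AB) _.
have := expanding Bs; rewrite /edge_expansion cut_edges_card Bs ler_pdivlMr.
  by move=> ?; lra.
by rewrite mulr_gt0 ?ltr0n //; lia.
Qed.

(* Cut [A] into pieces of size at most [s / 2]: any two of them lie in a set of
   size [s], to which the expansion hypothesis applies. *)
Lemma internal_edges (A : {set V}) (c : nat) : (#|A| <= c * s)%N ->
  edges_between A A <= (3 * c).+1%:R ^+ 2 * (gam * k%:R * s%:R).
Proof.
move=> Ac; pose h := s./2; have h0 : (0 < h)%N by rewrite /h; lia.
have sh : (s <= 3 * h)%N by rewrite /h; lia.
(* Because [s <= 3 * h], blocks of [h] elements number at most [3 * c]; one more colour makes ['I_q]
   inhabited for [inord]. *)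
pose q := (3 * c).+1.
pose color x : 'I_q := inord (index x (enum A) %/ h).
have idx x : x \in A -> (index x (enum A) < #|A|)%N.
  by move=> xA; rewrite cardE index_mem mem_enum.
have colorE x : x \in A -> color x = (index x (enum A) %/ h)%N :> nat.
  move=> xA; rewrite inordK // ltn_divLR //.
  by apply: leq_trans (idx x xA) _; rewrite /q; nia.
pose cls i := [set x in A | color x == i].
have cls_small i : (#|cls i| <= h)%N.
  pose m (x : V) : 'I_h.-1.+1 := inord (index x (enum A) %% h).
  have hE : h.-1.+1 = h by rewrite prednK.
  suff : (#|cls i| <= #|'I_h.-1.+1|)%N by rewrite card_ord hE.
  apply: (@leq_card_in _ _ m) => x y; rewrite !inE.
  move=> /andP[xA /eqP cx] /andP[yA /eqP cy] /(congr1 val) /=.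
  have lt z : (index z (enum A) %% h < h.-1.+1)%N by rewrite hE ltn_mod.
  rewrite !inordK // => mxy.
  have dxy : (index x (enum A) %/ h = index y (enum A) %/ h)%N.
    by rewrite -!colorE // cx cy.
  have : index x (enum A) = index y (enum A).
    by rewrite (divn_eq (index x _) h) dxy mxy -divn_eq.
  move=> e; rewrite -(nth_index x (_ : x \in enum A)) ?mem_enum // e nth_index ?mem_enum //.
have split_sum x : (x \in A)%:R = \sum_i (x \in cls i)%:R :> R.
  rewrite (bigD1 (color x)) //= big1 ?addr0; first by rewrite inE eqxx andbT.
  by move=> i ni; rewrite inE eq_sym (negPf ni) andbF.
have -> : edges_between A A = \sum_i \sum_j edges_between (cls i) (cls j).
  rewrite [in LHS]/edges_between [LHS]pair_bigA [RHS]pair_bigA /=.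
  under [RHS]eq_bigr => i _ do rewrite /edges_between pair_bigA /=.
  rewrite exchange_big /=; apply: eq_bigr => p _.
  by rewrite (split_sum p.1) (split_sum p.2) big_distrlr pair_bigA /= mulr_suml.
have pair_le i j : edges_between (cls i) (cls j) <= gam * k%:R * s%:R.
  apply: le_trans (edges_between_mono (subsetUl _ (cls j)) (subsetUr (cls i) _)) _.
  apply: internal_small; apply: leq_trans (leq_card_setU _ _) _.
  by have := cls_small i; have := cls_small j; rewrite /h; lia.
apply: le_trans (ler_sum _ (fun i _ => ler_sum _ (fun j _ => pair_le i j))) _.
by rewrite !sumr_const !card_ord -mulrnA -[leLHS]mulr_natl natrM -expr2.
Qed.

End InternalEdges.

Section Copies.
Variables (R : realType) (G : graph) (k : nat) (M' : nat).
Hypothesis greg : regular G k.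
Hypotheses (k0 : (0 < k)%N) (n0 : (0 < nv G)%N).
Local Notation V := 'I_(nv G).
Let M := M'.+1.
Local Notation U := ('I_M * V)%type.

Definition copy_adj : rel U := fun a b => (a.1 == b.1) && adj a.2 b.2.

Lemma copy_adj_sym : symmetric copy_adj.
Proof. by move=> a b; rewrite /copy_adj eq_sym adj_sym. Qed.

Lemma copy_adj_reg b : #|[set d | copy_adj b d]| = k.
Proof.
rewrite -(greg b.2) -[RHS](card_imset _ (_ : injective (pair b.1))); last by move=> x y [].
apply: eq_card => -[r x]; rewrite !inE /copy_adj /=.
apply/andP/imsetP => [[/eqP <- bx]|[y]]; first by exists x; rewrite ?inE.
by rewrite inE => by_ [-> ->].
Qed.

Lemma copies_gt0 : (0 < #|{: U}|)%N.
Proof. by rewrite card_prod !card_ord muln_gt0. Qed.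

Definition first_copy : {set U} := [set b | b.1 == ord0].

Lemma mass_unif (S : {set U}) : mass (unif R (U := U)) S = #|S|%:R / (M%:R * (nv G)%:R).
Proof.
rewrite /mass /unif -mulr_sumr mulrC card_prod !card_ord natrM; congr (_ / _).
rewrite -sum1_card natr_sum [RHS]big_mkcond /=.
by apply: eq_bigr => b _; case: (b \in S).
Qed.

Let M0 : M%:R != 0 :> R. Proof. by rewrite pnatr_eq0. Qed.
Let nR0 : (nv G)%:R != 0 :> R. Proof. by rewrite pnatr_eq0 -lt0n. Qed.
Let kR0 : k%:R != 0 :> R. Proof. by rewrite pnatr_eq0 -lt0n. Qed.

Lemma card_copy (S : {set V}) r0 : #|[set b : U | (b.1 == r0) && (b.2 \in S)]| = #|S|.
Proof.
rewrite -(card_imset S (_ : injective (pair r0))); last by move=> x y [].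
apply: eq_card => -[r x]; rewrite !inE /=.
apply/andP/imsetP => [[/eqP -> bx]|[y yS [-> ->]]]; last by rewrite eqxx.
by exists x.
Qed.

Lemma mass_first_copy : mass (unif R (U := U)) first_copy = M%:R^-1.
Proof.
rewrite mass_unif; have -> : #|first_copy| = nv G.
  rewrite -[RHS]card_ord -cardsT -(card_copy setT ord0); apply: eq_card => b.
  by rewrite !inE andbT.
by field; rewrite M0 nR0.
Qed.

Let slice (S : {set U}) (r : 'I_M) : {set V} := [set x | (r, x) \in S].

Lemma edge_mass_copies (S : {set U}) :
  edge_mass (unif R (U := U)) (walk R copy_adj k) S =
  (\sum_r edges_between R (slice S r) (slice S r)) / (M%:R * (nv G)%:R * k%:R).
Proof.
rewrite /edge_mass /unif card_prod !card_ord -mulr_sumr mulrC natrM [in RHS]invfM mulrA.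
rewrite -[RHS]mulrA [_^-1 * _^-1]mulrC mulrA; congr (_ / _).
rewrite sum_pair mulr_suml.
apply: eq_bigr => r _; rewrite /edges_between mulr_suml; apply: eq_bigr => x _.
rewrite sum_pair.
rewrite (bigD1 r) //= [X in _ + X]big1 => [|t nt]; last first.
  by apply: big1 => y _; rewrite /walk /copy_adj /= eq_sym (negPf nt) !mul0r.
rewrite addr0 mulr_sumr mulr_suml; apply: eq_bigr => y _.
by rewrite /walk /copy_adj /= eqxx !inE /=; ring.
Qed.

(** Each copy contains at most [#|S|] elements of [S], so the bound for one copy is used [M] times.
    The factor [M] cancels against the normalisation of the measure. *)
Lemma copies_sparse (gam : R) (s c : nat) (S : {set U}) :
  (1 < s)%N -> (s <= nv G)%N -> 0 <= gam ->
  (forall B : {set V}, #|B| = s -> 1 - gam <= edge_expansion R k B) ->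
  (#|S| <= c * s)%N ->
  edge_mass (unif R (U := U)) (walk R copy_adj k) S <=
  (3 * c).+1%:R ^+ 2 * gam * (s%:R / (nv G)%:R).
Proof.
move=> s1 sn g0 hexp Sc; rewrite edge_mass_copies.
have sl r : edges_between R (slice S r) (slice S r) <=
    (3 * c).+1%:R ^+ 2 * (gam * k%:R * s%:R).
  apply: (internal_edges greg s1 k0 sn g0 hexp); apply: leq_trans Sc.
  rewrite -(card_imset _ (_ : injective (pair r))); last by move=> x y [].
  by apply: subset_leq_card; apply/subsetP => _ /imsetP[x + ->]; rewrite inE.
have : \sum_r edges_between R (slice S r) (slice S r) <=
   M%:R * ((3 * c).+1%:R ^+ 2 * (gam * k%:R * s%:R)).
  apply: le_trans (ler_sum _ (fun r _ => sl r)) _.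
  by rewrite sumr_const card_ord -[leLHS]mulr_natl.
move=> le1; rewrite ler_pdivrMr; last by rewrite !mulr_gt0 ?ltr0n.
apply: le_trans le1 _; rewrite le_eqVlt; apply/orP; left; apply/eqP; field.
exact: nR0.
Qed.

(** The factor 2 appears because a boundary edge can be traversed in either direction, whereas
    [cut_edges] counts it once. *)
Lemma flips_first_copy (S : {set V}) :
  \sum_p edge_weight (unif R (U := U)) (walk R copy_adj k) p *
    ((p.1 \in [set b : U | (b.1 == ord0) && (b.2 \in S)]) !=
     (p.2 \in [set b : U | (b.1 == ord0) && (b.2 \in S)]))%:R =
  2 * #|cut_edges S|%:R / (M%:R * (nv G)%:R * k%:R).
Proof.
set S' := [set b : U | _].
pose flip (x y : V) : R := ((x \in S) != (y \in S))%:R * (adj x y)%:R.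
rewrite sum_pair sum_pair.
have inner r x : \sum_d edge_weight (unif R (U := U)) (walk R copy_adj k) ((r, x), d) *
    (((r, x) \in S') != (d \in S'))%:R =
    (r == ord0)%:R * (\sum_y flip x y) / (M%:R * (nv G)%:R * k%:R).
  rewrite sum_pair.
  rewrite (bigD1 r) //= [X in _ + X]big1 => [|t nt]; last first.
    apply: big1 => y _; rewrite /edge_weight /walk /copy_adj /= eq_sym (negPf nt).
    by rewrite mul0r mulr0 mul0r.
  rewrite addr0 mulr_sumr mulr_suml; apply: eq_bigr => y _.
  rewrite /edge_weight /walk /copy_adj /unif /flip /= !inE /= eqxx /=.
  rewrite card_prod !card_ord natrM; case: (r == ord0) => /=.
    by field; rewrite kR0 nR0.
  by rewrite mulr0 !mul0r.
under eq_bigr => r _ do under eq_bigr => x _ do rewrite inner.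
rewrite (bigD1 ord0) //= [X in _ + X]big1 => [|r nr]; last first.
  by apply: big1 => x _; rewrite (negPf nr) !mul0r.
rewrite addr0 -mulr_suml; congr (_ / _).
under eq_bigr => x _ do rewrite ?eqxx mul1r.
pose cut (x y : V) : R := (x \in S)%:R * (y \notin S)%:R * (adj x y)%:R.
have cutE : #|cut_edges S|%:R = \sum_x \sum_y cut x y.
  rewrite -sum1_card natr_sum big_mkcond /= [RHS]pair_bigA /=.
  by apply: eq_bigr => -[x y] _; rewrite inE /cut /=;
     case: (x \in S); case: (y \in S); case: (adj x y); rewrite /= ?mulr1 ?mulr0 ?mul0r.
have -> : \sum_x \sum_y flip x y = \sum_x \sum_y cut x y + \sum_x \sum_y cut y x.
  rewrite -big_split; apply: eq_bigr => x _; rewrite -big_split; apply: eq_bigr => y _.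
  rewrite /flip /cut [adj y x]adj_sym.
  by case: (x \in S); case: (y \in S); rewrite /=; ring.
by rewrite [X in _ + X]exchange_big /= -cutE mulr_natl mulr2n.
Qed.

End Copies.

(** * The gadget over natural numbers and its encoding *)

Section MapWords.
Variables (T T' : eqType) (f : T -> T').
Hypothesis finj : injective f.

Definition map_pair (p : T * T) : T' * T' := (f p.1, f p.2).

Lemma map_pair_inj : injective map_pair.
Proof. by move=> [a b] [c d] [/finj -> /finj ->]. Qed.

Lemma picks_map k s : picks k (map f s) = map (map f) (picks k s).
Proof.
elim: k s => [|k IH] [|x [|y s]] //=.
by rewrite -!map_rcons !IH map_cat.
Qed.

Lemma points_map k w : points k (map map_pair w) = map (map f) (points k w).
Proof.
rewrite /points map_cat -!picks_map.
by congr (picks _ _ ++ picks _ _); rewrite /unzip1 /unzip2 -map_comp -[RHS]map_comp.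
Qed.

Lemma perm_eq_map_inj (p q : seq T) : perm_eq (map f p) (map f q) = perm_eq p q.
Proof. by apply/idP/idP; [exact: perm_map_inj | exact: perm_map]. Qed.

Lemma share_map k w w' : share k (map map_pair w) (map map_pair w') = share k w w'.
Proof.
rewrite /share !points_map has_map; apply: eq_has => p /=.
by rewrite has_map; apply: eq_has => q /=; rewrite perm_eq_map_inj.
Qed.

Lemma word_rel_map (C : pred T) (C' : pred T') k w w' :
  (forall x, C' (f x) = C x) ->
  word_rel C' k (map map_pair w) (map map_pair w') = word_rel C k w w'.
Proof.
move=> CC; rewrite /word_rel (inj_eq (inj_map map_pair_inj)) share_map.
congr (_ && [|| _, _ | _]).
- by case: w => //= e w; apply: CC.
- by case: w' => //= e w'; apply: CC.
Qed.

End MapWords.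

Lemma words_map (T T' : Type) (f : T -> T') E K :
  words (map f E) K = map (map f) (words E K).
Proof.
elim: K => //= K ->; rewrite map_allpairs allpairs_mapl allpairs_mapr //.
Qed.

Definition arcs (n : nat) (bit : nat -> nat -> bool) : seq (nat * nat) :=
  [seq (x, y) | x <- iota 0 n, y <- [seq y <- iota 0 n | bit x y]].

Definition copy_edges (M n : nat) (bit : nat -> nat -> bool) :
    seq ((nat * nat) * (nat * nat)) :=
  [seq ((r, p.1), (r, p.2)) | r <- iota 0 M, p <- arcs n bit].

Definition first_copy_nat : pred (nat * nat) := fun b => b.1 == 0%N.

(** What the program writes, defined for any size and any oracle of bits, hence for input words that
    encode no graph as well. *)
Definition gadget_word (M L K n : nat) (bit : nat -> nat -> bool) : word :=
  let ws := words (copy_edges M n bit) K in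
  nseq (size ws) true ++
  false :: [seq word_rel first_copy_nat L w w' | w <- ws, w' <- ws].

Lemma nth_allpairs_grid (S T : Type) (Z : Type) (f : S -> T -> Z) z0 x0 y0
    (s : seq S) (t : seq T) i j : (i < size s)%N -> (j < size t)%N ->
  nth z0 [seq f x y | x <- s, y <- t] (i * size t + j) = f (nth x0 s i) (nth y0 t j).
Proof.
elim: s i => [|x s IH] [|i] //= si tj; rewrite nth_cat size_map.
  by rewrite mul0n add0n tj (nth_map y0).
by rewrite mulSn -addnA ltnNge leq_addr /= addKn IH.
Qed.

Section EncodeGadget.
Variables (G : graph) (M' : nat).
Local Notation V := 'I_(nv G).
Let M := M'.+1.
Local Notation U := ('I_M * V)%type.

Definition matrix_bits : word := [seq adj u v | u <- enum V, v <- enum V].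

Definition adj_bit (x y : nat) : bool := nth false matrix_bits (x * nv G + y).

Lemma adj_bitE (x y : V) : adj_bit x y = adj x y.
Proof.
rewrite /adj_bit; have -> : (x * nv G + y = x * size (enum V) + y)%N.
  by rewrite size_enum_ord.
by rewrite (nth_allpairs_grid _ _ x y) ?size_enum_ord // !nth_ord_enum.
Qed.

Definition ord_edges : seq (U * U) :=
  [seq ((r, p.1), (r, p.2)) | r <- enum 'I_M,
     p <- [seq (x, y) | x <- enum V, y <- [seq y <- enum V | adj x y]]].

Let emb (b : U) : nat * nat := (val b.1, val b.2).

Let emb_inj : injective emb.
Proof. by move=> [a b] [c d] [/val_inj -> /val_inj ->]. Qed.

Lemma copy_edges_ord : copy_edges M (nv G) adj_bit = map (map_pair emb) ord_edges.
Proof.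
rewrite /copy_edges /ord_edges map_allpairs -val_enum_ord allpairs_mapl.
have -> : arcs (nv G) adj_bit =
    map (fun p : V * V => (val p.1, val p.2))
      [seq (x, y) | x <- enum V, y <- [seq y <- enum V | adj x y]].
  rewrite /arcs map_allpairs -val_enum_ord allpairs_mapl.
  congr flatten; apply: eq_map => x.
  rewrite filter_map -map_comp; congr map; apply: eq_filter => y /=.
  exact: adj_bitE.
by rewrite allpairs_mapr.
Qed.

Lemma ord_edges_uniq : uniq ord_edges.
Proof.
apply: allpairs_uniq; first exact: enum_uniq.
  apply: allpairs_uniq_dep; first exact: enum_uniq.
    by move=> x _; apply: filter_uniq; apply: enum_uniq.
  by move=> [x y] [x' y'] _ _ /= [-> ->].
by move=> [r [x y]] [r' [x' y']] _ _ /= [-> -> _ ->].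
Qed.

Lemma mem_ord_edges p : (p \in ord_edges) = @copy_adj G M' p.1 p.2.
Proof.
case: p => [[r x] [r' y]]; rewrite /copy_adj /=; apply/allpairsP/andP.
  case=> [[r0 q] /= [_ /allpairsPdep[x0 [y0 [_ yx ->]]] [-> -> -> ->]]] /=.
  by move: yx; rewrite mem_filter => /andP[].
case=> /eqP <- axy; exists (r, (x, y)); split=> //=; first by rewrite mem_enum.
by apply/allpairsPdep; exists x, y; split=> //; rewrite ?mem_enum // mem_filter axy; apply: mem_enum.
Qed.

Definition gadget_graph (L K : nat) : graph :=
  list_graph (words ord_edges K)
    (word_rel_sym (mem (first_copy G M')) L) (word_rel_irr (mem (first_copy G M')) L).

Lemma encode_gadget_graph L K :
  encode (gadget_graph L K) = gadget_word M L K (nv G) adj_bit.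
Proof.
rewrite /gadget_graph encode_list_graph /gadget_word copy_edges_ord words_map size_map.
congr (_ ++ _ :: _); rewrite allpairs_mapl allpairs_mapr.
congr flatten; apply: eq_map => w; apply: eq_map => w' /=.
symmetry; apply: (word_rel_map emb_inj) => b.
by rewrite /first_copy_nat /= inE.
Qed.

End EncodeGadget.

(** * Correctness of the reduction *)

Section Correctness.
Variables (R : realType) (G : graph) (k W M' : nat) (delta gam : R).
Hypotheses (greg : regular G k) (k0 : (0 < k)%N) (n0 : (0 < nv G)%N).
Hypotheses (W0 : (0 < W)%N) (EM : M'.+1 = (2 * W)%N).
Hypotheses (delta0 : 0 < delta) (delta1 : delta <= 1) (gam0 : 0 < gam).

Let L := Num.truncn delta^-1.
Let N := (W * L)%N.
Let n : R := (nv G)%:R.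

Let n0R : 0 < n. Proof. by rewrite ltr0n. Qed.
Let k0R : (0 : R) < k%:R. Proof. by rewrite ltr0n. Qed.
Let W0R : (0 : R) < W%:R. Proof. by rewrite ltr0n. Qed.
Let MR : M'.+1%:R = 2 * W%:R :> R. Proof. by rewrite EM natrM. Qed.

Lemma level_gt0 : (0 < L)%N.
Proof. by rewrite truncn_gt0 invf_ge1. Qed.

(** Rounding [delta^-1] down costs a factor of at most 2, since [delta <= 1] gives [L >= 1] and so
    [L.+1 <= 2 L]. *)
Lemma level_bounds : 2^-1 <= L%:R * delta <= 1.
Proof.
have /andP[h1 h2] : L%:R <= delta^-1 < L.+1%:R by apply: truncn_itv; rewrite invr_ge0 ltW.
have L1 : (1 : R) <= L%:R by rewrite ler1n level_gt0.
have : L%:R * delta <= 1 by rewrite -ler_pdivlMr // div1r.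
have : 1 < L.+1%:R * delta by rewrite -ltr_pdivrMr // div1r.
rewrite -[L.+1]addn1 natrD mulrDl => *; apply/andP; split; last by [].
nra.
Qed.

Let G' := gadget_graph G M' L (N + L).

(** The bad events have total probability [2 / W]: at most [1 / W] for the alternatives, [1 / (2 W)]
    for the edges leaving [S] and [1 / (2 W)] for the first copy. Then [W >= 40 / eps] gives
    [20 * bad <= eps], and [W >= 20] gives [bad <= 1/10]. *)
Lemma reduction_complete (eps : R) (S : {set 'I_(nv G)}) :
  40%:R / eps <= W%:R -> 20%:R <= W%:R :> R -> gam <= (4%:R * W%:R)^-1 -> 0 < eps ->
  measure R S = delta -> edge_expansion R k S <= gam ->
  exists A : {set 'I_(nv G')}, [/\ A != set0, A != setT,
    #|A|%:R <= (nv G')%:R / 2 :> R & vertex_expansion R A <= eps].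
Proof.
move=> Weps W20 gamW eps0 mS eS.
have Sn : #|S|%:R = delta * n by rewrite -mS divfK // gt_eqF.
have S0 : (0 : R) < #|S|%:R by rewrite Sn mulr_gt0.
have cut : #|cut_edges S|%:R <= gam * (k%:R * #|S|%:R).
  by rewrite -ler_pdivrMr // mulr_gt0.
have /andP[Ld1 Ld2] := level_bounds.
pose S' := [set b : 'I_M'.+1 * 'I_(nv G) | (b.1 == ord0) && (b.2 \in S)].
have mS' : mass (unif R (U := ('I_M'.+1 * 'I_(nv G))%type)) S' = delta / (2 * W%:R).
  rewrite mass_unif card_copy Sn MR; field; by rewrite !gt_eqF.
have flip := flips_first_copy R M' k0 n0 S.
pose flipb : R := 2 * (gam * delta) / (2 * W%:R).
have flip_le : 2 * #|cut_edges S|%:R / (M'.+1%:R * (nv G)%:R * k%:R) <= flipb.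
  rewrite ler_pdivrMr; last by rewrite !mulr_gt0 // ltr0n.
  apply: le_trans (_ : 2 * (gam * (k%:R * #|S|%:R)) <= _); first by rewrite ler_pM2l.
  rewrite Sn MR /flipb le_eqVlt; apply/orP; left; apply/eqP; field; by rewrite gt_eqF.
have W1 : W%:R + 1 <= 2 * W%:R :> R by lra.
pose bad : R := 2 / W%:R.
have badeps : 20%:R * bad <= eps.
  rewrite /bad mulrA ler_pdivrMr // (mulrC eps) -ler_pdivrMr //.
  by apply: le_trans Weps; have -> : 20%:R * 2 = 40%:R :> R by ring.
have bad10 : bad <= 10%:R^-1.
  by rewrite /bad ler_pdivrMr //; lra.
have NR : N%:R = W%:R * L%:R :> R by rewrite natrM.
have LR : (0 : R) < L%:R by rewrite ltr0n level_gt0.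
have Nd : N%:R * (delta / (2 * W%:R)) = L%:R * delta / 2.
  by rewrite NR; field; rewrite gt_eqF.
have hN : 4%:R^-1 <= N%:R * mass (unif R (U := ('I_M'.+1 * 'I_(nv G))%type)) S' <= 2^-1.
  rewrite mS' Nd; apply/andP; split; lra.
have hbad : L.*2%:R * mass (unif R (U := ('I_M'.+1 * 'I_(nv G))%type)) S' +
    (N + L)%:R * flipb + mass (unif R (U := ('I_M'.+1 * 'I_(nv G))%type)) (first_copy G M') <= bad.
  rewrite mS' mass_first_copy // MR -mul2n natrM natrD NR.
  have -> : 2 * L%:R * (delta / (2 * W%:R)) = (L%:R * delta) / W%:R by field; rewrite gt_eqF.
  have -> : (W%:R * L%:R + L%:R) * flipb = (W%:R + 1) / W%:R * gam * (L%:R * delta).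
    by rewrite /flipb; field; rewrite gt_eqF.
  have e1 : L%:R * delta / W%:R <= W%:R^-1 by rewrite ler_piMl // invr_ge0 ltW.
  have e2 : (W%:R + 1) / W%:R * gam * (L%:R * delta) <= 2 * (4%:R * W%:R)^-1.
    apply: le_trans (_ : 2 * gam * 1 <= _); last by rewrite mulr1 ler_pM2l.
    apply: ler_pM => //.
    - by apply: mulr_ge0; [rewrite divr_ge0 ?addr_ge0 ?ler01 // ltW | exact: ltW].
    - by apply: mulr_ge0; exact: ltW.
    by rewrite ler_pM2r // ler_pdivrMr.
  have -> : bad = W%:R^-1 + (2 * (4%:R * W%:R)^-1 + (2 * W%:R)^-1).
    by rewrite /bad; field; rewrite gt_eqF.
  by rewrite addrA lerD2r lerD.
rewrite -flip in flip_le.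
have [A [A0 A1 A2 A3]] := gadget_complete k0 (copy_adj_reg greg) (copies_gt0 M' n0)
  (ord_edges_uniq G M') (@mem_ord_edges G M') level_gt0 W0
  flip_le hN hbad bad10.
by exists A; split=> //; apply: le_trans A3 badeps.
Qed.

Lemma reduction_sound (s : nat) :
  gam * (64%:R * W%:R ^+ 3 * (3 * (768 * W ^ 2)).+1%:R ^+ 2) <= 1 ->
  s%:R = delta * n -> (1 < s)%N ->
  (forall S : {set 'I_(nv G)}, measure R S = delta -> 1 - gam <= edge_expansion R k S) ->
  forall A : {set 'I_(nv G')}, A != set0 -> A != setT ->
  10%:R^-1 <= vertex_expansion R A.
Proof.
move=> gamW sn s1 hexp.
have /andP[Ld1 Ld2] := level_bounds.
have LR : (0 : R) < L%:R by rewrite ltr0n level_gt0.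
have s_le : (s <= nv G)%N by rewrite -(ler_nat R) sn -[leRHS]mul1r ler_wpM2r // ltW.
have hs (B : {set 'I_(nv G)}) : #|B| = s -> 1 - gam <= edge_expansion R k B.
  by move=> Bs; apply: hexp; rewrite /measure Bs sn mulfK // gt_eqF.
set P := (3 * (768 * W ^ 2)).+1 in gamW.
pose estar : R := P%:R ^+ 2 * gam * delta.
have NR : N%:R = W%:R * L%:R :> R by rewrite natrM.
apply: (@gadget_sound R _ _ k _ (@copy_adj_sym G M') k0 (copy_adj_reg greg)
  (copies_gt0 M' n0) (ord_edges_uniq G M') (@mem_ord_edges G M')
  _ W L level_gt0 W0 estar).
- by rewrite !mulr_ge0 ?exprn_ge0 // ltW.
- move=> S hS; have -> : estar = P%:R ^+ 2 * gam * (s%:R / (nv G)%:R).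
    by rewrite sn mulfK // gt_eqF.
  apply: (copies_sparse greg k0 n0 s1 s_le (ltW gam0) hs).
  rewrite -(ler_nat R) natrM sn.
  move: hS; rewrite mass_unif MR ler_pdivrMr ?mulr_gt0 // => hS.
  apply: le_trans hS _.
  (* Thus a set of mass at most [192 W / L] has at most [192 W * 2 delta * 2 W n = 768 W^2 s]
     elements, which is the source of the constant 768. *)
  have Linv : L%:R^-1 <= 2 * delta by rewrite -[L%:R^-1]mul1r ler_pdivrMr //; lra.
  rewrite natrM natrX -/n.
  have : 192%:R * W%:R / L%:R <= 192%:R * W%:R * (2 * delta).
    by rewrite ler_pM2l // mulr_gt0.
  move=> h; apply: le_trans (ler_wpM2r _ h) _.
    by rewrite !mulr_ge0 // ltW.
  rewrite le_eqVlt; apply/orP; left; apply/eqP; ring.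
rewrite mass_first_copy // MR NR /estar.
(* Here [delta] disappears: it occurs only in [L * delta <= 1]. *)
have -> : 16%:R * W%:R * (W%:R * L%:R) * (P%:R ^+ 2 * gam * delta) =
  (L%:R * delta) * (16%:R * W%:R ^+ 2 * P%:R ^+ 2 * gam) by ring.
apply: le_trans (_ : 1 * (16%:R * W%:R ^+ 2 * P%:R ^+ 2 * gam) <= _).
  by rewrite ler_wpM2r // !mulr_ge0 ?exprn_ge0 // ltW.
rewrite mul1r.
have -> : 16%:R * W%:R ^+ 2 * P%:R ^+ 2 * gam =
   (gam * (64%:R * W%:R ^+ 3 * P%:R ^+ 2)) * ((2 * W%:R)^-1 / 2).
  by field; rewrite gt_eqF.
by rewrite ler_piMl // divr_ge0 // invr_ge0 mulr_ge0 // ltW.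
Qed.

End Correctness.

(** * Structured programs for Turing machines *)

Section AbstractTape.
Variable A : finType.

(* A tape as its head position and its contents at absolute positions. *)
Definition atape : Type := (int * (int -> cell A))%type.

Definition scan (x : atape) : cell A := x.2 x.1.

Definition shift (m : move) (p : int) : int :=
  match m with MoveLeft => p - 1 | Stay => p | MoveRight => p + 1 end.

Definition awrite (x : atape) (a : cell A * move) : atape :=
  (shift a.2 x.1, fun z => if z == x.1 then a.1 else x.2 z).

Lemma awrite_scan x m : awrite x (scan x, m) = (shift m x.1, x.2).
Proof.
by rewrite /awrite /=; congr pair; apply: funext => z; case: eqP => // ->.
Qed.

Definition is_bit (c : cell A) : bool := if c is Some (inl _) then true else false.

Definition reads (x : atape) (o : word) : Prop :=
  (forall k, (k < size o)%N -> x.2 (x.1 + k%:Z) = Some (inl (nth false o k))) /\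
  ~~ is_bit (x.2 (x.1 + (size o)%:Z)).

Lemma read_bits_eq (s : seq (cell A)) o :
  (forall k, (k < size o)%N -> nth None s k = Some (inl (nth false o k))) ->
  ~~ is_bit (nth None s (size o)) -> read_bits s = o.
Proof.
elim: o s => [|b o IH] [|c s] //=.
- by move=> _; case: c => [[]|].
- by move/(_ 0%N isT).
move=> h1 h2; have /= -> := h1 0%N isT.
by rewrite (IH s) // => k ko; apply: (h1 k.+1).
Qed.

End AbstractTape.

Section Represents.
Variables (B A : finType) (g : cell B -> cell A).

(** The translation [g] of symbols is the identity for compiled programs, and embeds the alphabet of
    a machine that is simulated inside a larger one. *)
Definition represents (t : tape B) (x : atape A) : Prop :=
  [/\ x.2 x.1 = g (tape_head t),
      forall k : nat, x.2 (x.1 + 1 + k%:Z) = g (nth None (tape_right t) k) &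
      forall k : nat, x.2 (x.1 - 1 - k%:Z) = g (nth None (tape_left t) k)].

Lemma represents_write t x a m : represents t x ->
  represents (write_move t (a, m)) (awrite x (g a, m)).
Proof.
case: x => p f [/= h r l].
case: m; rewrite /represents /write_move /awrite /shift /=.
- split.
  + by rewrite ifF; [have := l 0%N; rewrite subr0 nth0 | lia].
  + case=> [|k] /=; first by rewrite ifT //; lia.
    by rewrite ifF; [rewrite -r; congr (f _) | ]; lia.
  + by move=> k; rewrite ifF; [rewrite nth_behead -l; congr (f _) | ]; lia.
- split.
  + by rewrite eqxx.
  + by move=> k; rewrite ifF ?r //; lia.
  + by move=> k; rewrite ifF ?l //; lia.
- split.
  + by rewrite ifF; [have := r 0%N; rewrite addr0 nth0 | lia].
  + by move=> k; rewrite ifF; [rewrite nth_behead -r; congr (f _) | ]; lia.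
  + case=> [|k] /=; first by rewrite ifT //; lia.
    by rewrite ifF; [rewrite -l; congr (f _) | ]; lia.
Qed.

End Represents.

Section Language.
Variables (J Q A : finType).
Local Notation name := (option J).
Local Notation scans := (name -> cell A).
Local Notation actions := (name -> cell A * move)%type.
Local Notation store := (name -> atape A).

(* Besides the tapes a command has a register with values in [Q]; tape [None] is
   the input and output tape. *)
Inductive cmd :=
| Act (f : Q -> scans -> Q * actions)
| Seq (c1 c2 : cmd)
| If (p : Q -> scans -> bool) (c1 c2 : cmd)
| While (p : Q -> scans -> bool) (c : cmd).

Definition scan_all (T : store) : scans := fun x => scan (T x).

Definition perform (T : store) (a : actions) : store := fun x => awrite (T x) (a x).

Definition idle (h : scans) : actions := fun x => (h x, Stay).

Lemma perform_idle T : perform T (idle (scan_all T)) = T.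
Proof.
by apply: funext => x; rewrite /perform /idle awrite_scan /=; case: (T x).
Qed.

(** The control points of a command. [None] is the test of a conditional or of a loop; it takes one
    step that leaves all tapes as they are. *)
Fixpoint point (c : cmd) : finType :=
  match c with
  | Act _ => unit
  | Seq c1 c2 => (point c1 + point c2)%type
  | If _ c1 c2 => option (point c1 + point c2)%type
  | While _ c => option (point c)
  end.

Fixpoint entry (c : cmd) : point c :=
  match c return point c with
  | Act _ => tt
  | Seq c1 c2 => inl (entry c1)
  | If _ c1 c2 => None
  | While _ c => None
  end.

Fixpoint next (c : cmd) : point c -> Q -> scans -> option (point c) * (Q * actions) :=
  match c return point c -> Q -> scans -> option (point c) * (Q * actions) with
  | Act f => fun _ q h => (None, f q h)
  | Seq c1 c2 => fun s q h =>
      match s with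
      | inl s1 => let r := next s1 q h in
          (Some (if r.1 is Some s' then inl s' else inr (entry c2)), r.2)
      | inr s2 => let r := next s2 q h in (omap inr r.1, r.2)
      end
  | If p c1 c2 => fun s q h =>
      match s with
      | None => (Some (Some (if p q h then inl (entry c1) else inr (entry c2))),
                 (q, idle h))
      | Some (inl s1) => let r := next s1 q h in
          (omap (fun s' => Some (inl s')) r.1, r.2)
      | Some (inr s2) => let r := next s2 q h in
          (omap (fun s' => Some (inr s')) r.1, r.2)
      end
  | While p c => fun s q h =>
      match s with
      | None => (if p q h then Some (Some (entry c)) else None, (q, idle h))
      | Some s1 => let r := next s1 q h in (Some r.1, r.2)
      end
  end.

Inductive run (c : cmd) : point c -> Q -> store -> nat -> Q -> store -> Prop :=
| RunLast s q T q' a :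
    next s q (scan_all T) = (None, (q', a)) -> run s q T 1 q' (perform T a)
| RunMore s q T s1 q1 a n q' T' :
    next s q (scan_all T) = (Some s1, (q1, a)) ->
    run s1 q1 (perform T a) n q' T' -> run s q T n.+1 q' T'.

Definition exec c q T n q' T' := run (entry c) q T n q' T'.

Lemma exec_act f q T :
  exec (Act f) q T 1 (f q (scan_all T)).1 (perform T (f q (scan_all T)).2).
Proof. by apply: RunLast => /=; case: (f _ _). Qed.

Lemma run_seq_right c1 c2 s q T n q' T' :
  @run c2 s q T n q' T' -> @run (Seq c1 c2) (inr s) q T n q' T'.
Proof.
elim=> [{}s {}q {}T {}q' a e|{}s {}q {}T s1 q1 a {}n {}q' {}T' e _ IH].
  by apply: RunLast; rewrite /= e.
by apply: RunMore IH; rewrite /= e.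
Qed.

Lemma exec_seq c1 c2 q T n q1 T1 m q' T' :
  exec c1 q T n q1 T1 -> exec c2 q1 T1 m q' T' ->
  exec (Seq c1 c2) q T (n + m) q' T'.
Proof.
rewrite /exec /=; move: (entry c1) => s r; elim: r m q' T' => /=.
  move=> {}s {}q {}T {}q1 a e m q' T' r2; rewrite add1n.
  by apply: (@RunMore (Seq c1 c2) _ _ _ (inr (entry c2))); [by rewrite /= e | exact: run_seq_right].
move=> {}s {}q {}T s1 q2 a {}n {}q1 {}T1 e _ IH m q' T' r2; rewrite addSn.
by apply: (@RunMore (Seq c1 c2) _ _ _ (inl s1)); [by rewrite /= e | exact: IH].
Qed.

Lemma run_if_left p c1 c2 s q T n q' T' :
  @run c1 s q T n q' T' -> @run (If p c1 c2) (Some (inl s)) q T n q' T'.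
Proof.
elim=> [{}s {}q {}T {}q' a e|{}s {}q {}T s1 q1 a {}n {}q' {}T' e _ IH].
  by apply: RunLast; rewrite /= e.
by apply: RunMore IH; rewrite /= e.
Qed.

Lemma run_if_right p c1 c2 s q T n q' T' :
  @run c2 s q T n q' T' -> @run (If p c1 c2) (Some (inr s)) q T n q' T'.
Proof.
elim=> [{}s {}q {}T {}q' a e|{}s {}q {}T s1 q1 a {}n {}q' {}T' e _ IH].
  by apply: RunLast; rewrite /= e.
by apply: RunMore IH; rewrite /= e.
Qed.

Lemma exec_if (p : Q -> scans -> bool) c1 c2 q T n q' T' :
  exec (if p q (scan_all T) then c1 else c2) q T n q' T' ->
  exec (If p c1 c2) q T n.+1 q' T'.
Proof.
rewrite /exec; case pT: (p _ _) => r.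
  apply: (@RunMore (If p c1 c2) _ _ _ (Some (inl (entry c1)))); first by rewrite /= pT.
  by rewrite perform_idle; apply: run_if_left.
apply: (@RunMore (If p c1 c2) _ _ _ (Some (inr (entry c2)))); first by rewrite /= pT.
by rewrite perform_idle; apply: run_if_right.
Qed.

Lemma exec_while_end (p : Q -> scans -> bool) c q T : ~~ p q (scan_all T) -> exec (While p c) q T 1 q T.
Proof.
move=> /negPf pT; rewrite -{2}(perform_idle T); apply: RunLast; by rewrite /= pT.
Qed.

Lemma run_while_body (p : Q -> scans -> bool) c s q T n q1 T1 m q' T' :
  @run c s q T n q1 T1 -> exec (While p c) q1 T1 m q' T' ->
  @run (While p c) (Some s) q T (n + m) q' T'.
Proof.
move=> r; elim: r m q' T' => /=.
  move=> {}s {}q {}T {}q1 a e m q' T' r2; rewrite add1n.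
  by apply: (@RunMore (While p c) _ _ _ None); [by rewrite /= e | exact: r2].
move=> {}s {}q {}T s1 q2 a {}n {}q1 {}T1 e _ IH m q' T' r2; rewrite addSn.
by apply: (@RunMore (While p c) _ _ _ (Some s1)); [by rewrite /= e | exact: IH].
Qed.

Lemma exec_while (p : Q -> scans -> bool) c q T n q1 T1 m q' T' : p q (scan_all T) ->
  exec c q T n q1 T1 -> exec (While p c) q1 T1 m q' T' ->
  exec (While p c) q T (n + m).+1 q' T'.
Proof.
move=> pT r1 r2; apply: (@RunMore (While p c) _ _ _ (Some (entry c))); first by rewrite /= pT.
by rewrite perform_idle; apply: run_while_body r1 r2.
Qed.

Definition ord_of_name (x : name) : 'I_#|J|.+1 :=
  if x is Some j then lift ord0 (enum_rank j) else ord0.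

Definition name_of_ord (i : 'I_#|J|.+1) : name := omap enum_val (unlift ord0 i).

Lemma ord_of_nameK : cancel ord_of_name name_of_ord.
Proof. by case=> [j|]; rewrite /name_of_ord /= ?liftK ?unlift_none //= enum_rankK. Qed.

Definition compile (c : cmd) (q0 : Q) : machine :=
  @Machine #|J| (option (point c) * Q)%type A (Some (entry c), q0)
    [pred s | s.1 == None]
    (fun s h =>
       if s.1 is Some s1 then
         let r := next s1 s.2 (fun x => h (ord_of_name x)) in
         ((r.1, r.2.1), [ffun i => r.2.2 (name_of_ord i)])
       else (s, [ffun i => (h i, Stay)])).

Lemma run_compile c q0 s q T n q' T' (tp : {ffun 'I_#|J|.+1 -> tape A}) :
  @run c s q T n q' T' ->
  (forall x, represents id (tp (ord_of_name x)) (T x)) ->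
  exists2 tp' : {ffun 'I_#|J|.+1 -> tape A},
    iter n (@step (compile c q0)) ((Some s, q), tp) = ((None, q'), tp') &
    forall x, represents id (tp' (ord_of_name x)) (T' x).
Proof.
move=> r; elim: r tp => {s q T n q' T'}.
  move=> s q T q' a e tp h; have eh : (fun x => [ffun i => tape_head (tp i)] (ord_of_name x)) = scan_all T.
    by apply: funext => x; rewrite ffunE /scan_all /scan; case: (h x) => ->.
  rewrite /= /step /= eh e /=; eexists; first by [].
  by move=> x; rewrite !ffunE ord_of_nameK /perform; case: (a x) => b m; apply: represents_write.
move=> s q T s1 q1 a n q' T' e _ IH tp h.
have eh : (fun x => [ffun i => tape_head (tp i)] (ord_of_name x)) = scan_all T.
  by apply: funext => x; rewrite ffunE /scan_all /scan; case: (h x) => ->.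
rewrite iterSr /step /= eh e /=; apply: IH.
by move=> x; rewrite !ffunE ord_of_nameK /perform; case: (a x) => b m; apply: represents_write.
Qed.

Definition list_tape (s : seq (cell A)) : int -> cell A :=
  fun z => if z is Posz k then nth None s k else None.

Lemma list_tape_nil z : list_tape [::] z = None.
Proof. by case: z => k //=; rewrite nth_nil. Qed.

Definition input_store (w : word) : store := fun x =>
  (0, list_tape (if x is None then [seq Some (inl b) | b <- w] else [::])).

Lemma represents_init c q0 w x :
  represents id ((init (compile c q0) w).2 (ord_of_name x)) (input_store w x).
Proof.
rewrite /= ffunE /input_store /word_tape.
have -> : (ord_of_name x == ord0) = (x == None) by case: x => [j|].
case: x => [j|]; split=> [|k|k]; rewrite /= ?list_tape_nil ?nth_nil //.
- by rewrite nth_behead.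
- by case: k.
Qed.

Lemma compile_exec c q0 w n q' T' o :
  exec c q0 (input_store w) n q' T' -> reads (T' None) o ->
  let cf := iter n (@step (compile c q0)) (init (compile c q0) w) in
  cf.1 \in halting (compile c q0) /\ output cf = o.
Proof.
move=> r [ro1 ro2].
have [tp e h] := run_compile q0 r (fun x => represents_init c q0 w x).
have -> : iter n (@step (compile c q0)) (init (compile c q0) w) = ((None, q'), tp).
  by rewrite -e; congr (iter n _ _).
split; first by rewrite inE.
suff : read_bits (tape_head (tp ord0) :: tape_right (tp ord0)) = o by [].
have [h1 h2 _] := h None; rewrite /= in h1 h2.
have hnth k : nth None (tape_head (tp ord0) :: tape_right (tp ord0)) k =
    (T' None).2 ((T' None).1 + k%:Z).
  case: k => [|k] /=; first by rewrite addr0 h1.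
  by rewrite -[nth _ _ _]/(id _) -h2; congr (_ _); move: (T' None).1 => p; clear; lia.
by apply: read_bits_eq => [k ko|]; rewrite hnth //; apply: ro1.
Qed.

End Language.

(** * Polynomial bounds on running times *)

Lemma halted_step_iter (M : machine) (c : config M) m :
  c.1 \in halting M -> iter m (@step M) c = c.
Proof. by move=> h; elim: m => //= m ->; rewrite /step h. Qed.

(** The base [s.+1] is positive even for [s = 0], so exponents can be raised freely when bounds are
    combined. *)
Definition poly_bound (t : nat -> nat) : Prop :=
  exists c d, forall s, (t s <= c * s.+1 ^ d)%N.

Lemma poly_bound_const c : poly_bound (fun=> c).
Proof. by exists c, 0%N => s; rewrite expn0 muln1. Qed.

Lemma poly_bound_id : poly_bound id.
Proof. by exists 1%N, 1%N => s; rewrite expn1 mul1n. Qed.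

Lemma poly_boundD t1 t2 : poly_bound t1 -> poly_bound t2 ->
  poly_bound (fun s => t1 s + t2 s)%N.
Proof.
case=> c1 [d1 h1] [c2 [d2 h2]]; exists (c1 + c2)%N, (d1 + d2)%N => s.
rewrite mulnDl; apply: leq_add.
  by apply: leq_trans (h1 s) _; rewrite leq_mul2l leq_pexp2l ?leq_addr ?orbT.
by apply: leq_trans (h2 s) _; rewrite leq_mul2l leq_pexp2l ?leq_addl ?orbT.
Qed.

Lemma poly_boundM t1 t2 : poly_bound t1 -> poly_bound t2 ->
  poly_bound (fun s => t1 s * t2 s)%N.
Proof.
case=> c1 [d1 h1] [c2 [d2 h2]]; exists (c1 * c2)%N, (d1 + d2)%N => s.
by rewrite expnD mulnACA; apply: leq_mul.
Qed.

Lemma poly_bound_le t1 t2 : (forall s, t1 s <= t2 s)%N -> poly_bound t2 -> poly_bound t1.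
Proof. by move=> le12 [c [d h]]; exists c, d => s; apply: leq_trans (h s). Qed.

Lemma poly_bound_comp t1 t2 : {homo t1 : m n / (m <= n)%N} ->
  poly_bound t1 -> poly_bound t2 -> poly_bound (fun s => t1 (t2 s)).
Proof.
move=> mono [c1 [d1 h1]] [c2 [d2 h2]].
exists (c1 * c2.+1 ^ d1)%N, (d2 * d1)%N => s.
apply: leq_trans (h1 _) _; rewrite -mulnA leq_mul2l; apply/orP; right.
rewrite expnM -expnMn; case: d1 h1 => [|d1] _; first by rewrite !expn0.
rewrite leq_exp2r // mulSn; apply: leq_ltn_trans (h2 s) _.
by rewrite -addn1 addnC leq_add2r expn_gt0.
Qed.

Lemma poly_bound_horner t : poly_bound t ->
  exists p : {poly nat}, forall s, (t s <= p.[s])%N.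
Proof.
case=> c [d h]; exists (c *: ('X + 1%:P) ^+ d) => s.
rewrite hornerZ horner_exp hornerD hornerX hornerC.
have -> : c * (s + 1) ^+ d = (c * (s + 1) ^ d)%N :> nat.
  by congr (_ * _)%N; elim: d {h} => // d IH; rewrite exprS expnS IH.
by rewrite addn1.
Qed.

Lemma horner_poly_bound (p : {poly nat}) : poly_bound (fun s => p.[s]).
Proof.
elim/poly_ind: p => [|p c IH].
  by apply: poly_bound_le (poly_bound_const 0) => s; rewrite horner0.
apply: poly_bound_le (poly_boundD (poly_boundM IH poly_bound_id) (poly_bound_const c)) => s.
by rewrite hornerMXaddC.
Qed.

Lemma horner_mono (p : {poly nat}) : {homo (fun s => p.[s]) : m n / (m <= n)%N}.
Proof.
move=> m n mn; elim/poly_ind: p => [|p c IH]; first by rewrite !horner0.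
by rewrite !hornerMXaddC; apply: leq_add => //; apply: leq_mul.
Qed.

Lemma polytime_exec (J Q A : finType) (c : cmd J Q A) (q0 : Q) (f : word -> word)
    (t : nat -> nat) : poly_bound t ->
  (forall w, exists n q' T', [/\ exec c q0 (input_store A w) n q' T',
     (n <= t (size w))%N & reads (T' None) (f w)]) ->
  polytime f.
Proof.
move=> /poly_bound_horner[p tp] h; exists (compile c q0), p => w.
have [n [q' [T' [r nt ro]]]] := h w.
have [h1 h2] := compile_exec r ro.
have np : (n <= p.[size w])%N by apply: leq_trans nt (tp _).
by rewrite -(subnK np) iterD (halted_step_iter _ h1).
Qed.

(** * Composition of polynomial-time functions *)

Section BasicCommands.
Variables (J Q A : finType).
Local Notation name := (option J).
Local Notation store := (name -> atape A).
Local Notation cmd := (cmd J Q A).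

Definition set_tape (T : store) (x : name) (v : atape A) : store :=
  fun y => if y == x then v else T y.

Lemma set_tape_set T x v v' : set_tape (set_tape T x v) x v' = set_tape T x v'.
Proof. by apply: funext => y; rewrite /set_tape; case: eqP. Qed.

Lemma set_tapeE T x v : set_tape T x v x = v.
Proof. by rewrite /set_tape eqxx. Qed.

Lemma set_tapeN T x y v : y != x -> set_tape T x v y = T y.
Proof. by rewrite /set_tape => /negPf ->. Qed.

Definition move_heads (m : name -> move) : cmd :=
  Act (fun q h => (q, fun y => (h y, m y))).

Lemma exec_move_heads m q T :
  exec (move_heads m) q T 1 q (fun y => (shift (m y) (T y).1, (T y).2)).
Proof.
have := exec_act (fun q h => (q, fun y => (h y, m y))) q T => /=.
by congr (run _ _ _ _ _ _); apply: funext => y; rewrite /perform /= awrite_scan.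
Qed.

Definition move_head (x : name) (m : move) : cmd :=
  move_heads (fun y => if y == x then m else Stay).

Lemma exec_move_head x m q T p f : T x = (p, f) ->
  exec (move_head x m) q T 1 q (set_tape T x (shift m p, f)).
Proof.
move=> Tx; have := exec_move_heads (fun y => if y == x then m else Stay) q T.
congr (run _ _ _ _ _ _); apply: funext => y; rewrite /set_tape.
by case: eqP => [->|_]; rewrite ?Tx //=; case: (T y).
Qed.

(** The first move is unconditional because the head starts one cell behind the block, where no bit
    need stand; the last one corrects the overshoot. *)
Definition rewind_bits (x : name) : cmd :=
  Seq (move_head x MoveLeft)
    (Seq (While (fun _ h => is_bit (h x)) (move_head x MoveLeft))
         (move_head x MoveRight)).

Lemma exec_rewind_bits x q T (p : int) f (n : nat) :
  T x = (p + n%:Z, f) -> (forall k : nat, (k < n)%N -> is_bit (f (p + k%:Z))) ->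
  ~~ is_bit (f (p - 1)) ->
  exec (rewind_bits x) q T (2 * n + 3)%N q (set_tape T x (p, f)).
Proof.
move=> Tx bits nb; rewrite (_ : 2 * n + 3 = 1 + ((2 * n).+1 + 1))%N; last by lia.
apply: exec_seq (exec_move_head MoveLeft q Tx) _.
apply: (exec_seq (q1 := q) (T1 := set_tape T x (p - 1, f))); last first.
  have := exec_move_head MoveRight q (set_tapeE T x (p - 1, f)).
  by rewrite set_tape_set /= subrK.
rewrite /=; elim: n bits {Tx} => [|n IH] bits.
  by rewrite addr0; apply: exec_while_end; rewrite /scan_all /scan set_tapeE.
rewrite (_ : (2 * n.+1).+1 = (1 + (2 * n).+1).+1)%N; last by lia.
apply: (exec_while (q1 := q) (T1 := set_tape T x (p + n%:Z - 1, f))).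
- rewrite /scan_all /scan set_tapeE /=.
  by rewrite (_ : p + n.+1%:Z - 1 = p + n%:Z) ?bits //; lia.
- have := exec_move_head MoveLeft q (set_tapeE T x (p + n.+1%:Z - 1, f)).
  by rewrite set_tape_set /= (_ : p + n.+1%:Z - 1 = p + n%:Z) //; lia.
by apply: IH => k kn; apply: bits; apply: ltnW.
Qed.

Definition write_word (f : int -> cell A) (p : int) (o : word) : int -> cell A :=
  fun z => if (p <= z) && (z < p + (size o)%:Z)
           then Some (inl (nth false o (absz (z - p)))) else f z.

Definition erase (f : int -> cell A) (p : int) (n : nat) : int -> cell A :=
  fun z => if (p <= z) && (z < p + n%:Z) then None else f z.

(** The source is erased so that tape [None] is clean when it later becomes the input tape of the
    second machine. *)
Definition transfer (a b : name) : cmd :=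
  While (fun _ h => is_bit (h a))
    (Act (fun q h => (q, fun y =>
       if y == b then (h a, MoveRight)
       else if y == a then (None, MoveRight) else (h y, Stay)))).

Lemma exec_transfer a b q T pa fa pb fb o : a != b ->
  T a = (pa, fa) -> T b = (pb, fb) -> reads (T a) o ->
  exec (transfer a b) q T (2 * size o).+1 q
    (set_tape (set_tape T a (pa + (size o)%:Z, erase fa pa (size o)))
       b (pb + (size o)%:Z, write_word fb pb o)).
Proof.
move=> ab; elim: o T pa fa pb fb => [|c o IH] T pa fa pb fb Ta Tb [r1 r2].
  have -> : set_tape (set_tape T a (pa + 0%:Z, erase fa pa 0)) b
      (pb + 0%:Z, write_word fb pb [::]) = T.
    apply: funext => y; rewrite /set_tape !addr0.
    case: eqP => [->|_]; last case: eqP => [->|_] //.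
      rewrite Tb; congr pair; apply: funext => z; rewrite /write_word /=.
      by rewrite ifF //; lia.
    by rewrite Ta; congr pair; apply: funext => z; rewrite /erase ifF //; lia.
  apply: exec_while_end; rewrite /scan_all /scan.
  by move: r2; rewrite addr0.
rewrite (_ : (2 * size (c :: o)).+1 = (1 + (2 * size o).+1).+1)%N /=; last by lia.
have ha : scan (T a) = Some (inl c) by have := r1 0%N isT; rewrite addr0.
apply: (exec_while _ (exec_act _ _ _)); first by rewrite /scan_all ha.
set T1 := perform _ _.
have T1a : T1 a = (pa + 1, fun z => if z == pa then None else fa z).
  by rewrite /T1 /perform /= (negPf ab) eqxx Ta.
have T1b : T1 b = (pb + 1, fun z => if z == pb then Some (inl c) else fb z).
  by rewrite /T1 /perform /= eqxx Tb /awrite /= /scan_all ha.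
have T1y y : y != a -> y != b -> T1 y = T y.
  by move=> /negPf ya /negPf yb; rewrite /T1 /perform /= ya yb awrite_scan /=; case: (T y).
have r1' : reads (T1 a) o.
  rewrite T1a; split=> [k ko|] /=.
    rewrite ifF; last by lia.
    have := r1 k.+1 ko; rewrite Ta /= => <-; congr fa; lia.
  rewrite ifF; last by lia.
  by move: r2; rewrite Ta /=; congr (~~ is_bit (fa _)); lia.
have := IH T1 _ _ _ _ T1a T1b r1'.
congr (run _ _ _ _ _ _); apply: funext => y; rewrite /set_tape.
case: (altP eqP) => [_|yb]; last case: (altP eqP) => [_|ya]; last exact: T1y.
- congr pair; first by lia.
  apply: funext => z; rewrite /write_word /=.
  case: (altP (z =P pb)) => [->|zb].
    by rewrite ifF ?ifT ?subrr //; lia.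
  case: ifP => h.
    rewrite ifT; last by lia.
    by rewrite (_ : absz (z - pb) = (absz (z - (pb + 1)%R)).+1) //; lia.
  by rewrite ifF //; lia.
- congr pair; first by lia.
  apply: funext => z; rewrite /erase /=.
  case: (altP (z =P pa)) => [->|zb].
    by rewrite ifF ?ifT //; lia.
  case: ifP => h; first by rewrite ifT //; lia.
  by rewrite ifF //; lia.
Qed.

End BasicCommands.

Section Simulation.
Variables (J Q A : finType) (M : machine).
Local Notation name := (option J).
Local Notation store := (name -> atape A).
Variables (g : cell (aux M) -> cell A) (g' : cell A -> cell (aux M)).
Hypothesis gK : cancel g g'.
Variables (nm : 'I_(extra_tapes M).+1 -> name)
  (nm' : name -> option 'I_(extra_tapes M).+1).
Hypotheses (nmK : forall i, nm' (nm i) = Some i).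
Variables (inQ : state M -> Q) (outQ : Q -> option (state M)).
Hypothesis QK : forall s, outQ (inQ s) = Some s.

Definition simulate_step (q : Q) (h : name -> cell A) : Q * (name -> cell A * move) :=
  if outQ q is Some s then
    let qa := trans s [ffun i => g' (h (nm i))] in
    (inQ qa.1, fun x => if nm' x is Some i then (g (qa.2 i).1, (qa.2 i).2)
                        else (h x, Stay))
  else (q, fun x => (h x, Stay)).

Definition simulate : cmd J Q A :=
  While (fun q _ => if outQ q is Some s then s \notin halting M else false)
    (Act simulate_step).

Lemma exec_simulate n (c : config M) (T : store) :
  (forall i, represents g (c.2 i) (T (nm i))) ->
  (iter n (@step M) c).1 \in halting M ->
  exists k T', [/\ exec simulate (inQ c.1) T k (inQ (iter n (@step M) c).1) T',
    (k <= (2 * n).+1)%N,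
    forall i, represents g ((iter n (@step M) c).2 i) (T' (nm i)) &
    forall x, nm' x = None -> T' x = T x].
Proof.
elim: n c T => [|n IH] c T rep halt.
  exists 1%N, T; split=> //; apply: exec_while_end; by rewrite QK /= negbK.
case: (boolP (c.1 \in halting M)) => hc.
  rewrite halted_step_iter //; exists 1%N, T; split=> //.
  by apply: exec_while_end; rewrite QK negbK.
rewrite iterSr in halt *.
have ea := exec_act simulate_step (inQ c.1) T.
set r := simulate_step _ _ in ea.
have er : r = (inQ (step c).1, r.2).
  rewrite /r /simulate_step QK /step (negPf hc) /=; congr (inQ _, _).
  congr (trans _ _).1; apply/ffunP => i; rewrite !ffunE /scan_all /scan.
  by have [-> _ _] := rep i; rewrite gK.
have rep1 i : represents g ((step c).2 i) (perform T r.2 (nm i)).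
  rewrite /step (negPf hc) /= ffunE /perform /r /simulate_step QK /= nmK.
  have -> : [ffun i0 => g' (scan_all T (nm i0))] = [ffun i0 => tape_head (c.2 i0)].
    by apply/ffunP => j; rewrite !ffunE /scan_all /scan; have [-> _ _] := rep j; rewrite gK.
  case: ((trans _ _).2 i) => a m; exact: represents_write.
have oth x : nm' x = None -> perform T r.2 x = T x.
  move=> nx; rewrite /perform /r /simulate_step QK /= nx awrite_scan /=.
  by case: (T x).
have [k [T' [e1 e2 e3 e4]]] := IH _ _ rep1 halt.
exists (1 + k).+1, T'; split=> //.
- rewrite er /= in ea; apply: exec_while ea e1; by rewrite QK.
- by lia.
by move=> x nx; rewrite e4 // oth.
Qed.

End Simulation.

Lemma size_read_bits (A : finType) (s : seq (cell A)) : (size (read_bits s) <= size s)%N.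
Proof. by elim: s => [|[[b|a]|] s IH]. Qed.

Lemma size_write_move (A : finType) (t : tape A) a :
  (size (tape_right (write_move t a)) <= (size (tape_right t)).+1)%N.
Proof. by case: a => a []; rewrite /write_move /= ?size_behead; lia. Qed.

Lemma size_output_iter (M : machine) (c : config M) n :
  (size (output (iter n (@step M) c)) <= (size (tape_right (c.2 ord0)) + n).+1)%N.
Proof.
apply: leq_trans (size_read_bits _) _; rewrite /= ltnS.
elim: n => [|n IH]; first by rewrite addn0.
rewrite iterS /step; case: ifP => _; first by rewrite addnS ltnW.
rewrite [X in tape_right X]/= ffunE addnS.
by apply: leq_trans (size_write_move _ _) _; rewrite ltnS.
Qed.

Lemma reads_output (M : machine) (A : finType) (g : cell (aux M) -> cell A)
    (c : config M) x :
  (forall b, g (Some (inl b)) = Some (inl b)) ->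
  (forall a, is_bit (g a) = is_bit a) -> represents g (c.2 ord0) x ->
  reads x (output c).
Proof.
move=> gb gi [h r _]; rewrite /output.
have hnth k : x.2 (x.1 + k%:Z) =
    g (nth None (tape_head (c.2 ord0) :: tape_right (c.2 ord0)) k).
  case: k => [|k]; first by rewrite addr0 h.
  by rewrite -[nth _ _ _]/(nth None (tape_right (c.2 ord0)) k) -r; congr (_ _);
     move: x.1 => p; clear; lia.
move: (_ :: _) hnth => s hnth; split.
  move=> k ks; rewrite hnth -gb; congr g.
  elim: s k ks {hnth} => [|[[b|a]|] s IH] [|k] //=; exact: IH.
rewrite hnth gi; elim: s {hnth} => [|[[b|a]|] s IH] //=.
Qed.

Section RepresentsWord.
Variables (B A : finType) (g : cell B -> cell A).
Hypotheses (g0 : g None = None) (gb : forall b, g (Some (inl b)) = Some (inl b)).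

Lemma represents_word w p :
  represents g (word_tape B w) (p, write_word (fun=> None) p w).
Proof.
have e (k : nat) : write_word (fun=> None) p w (p + k%:Z) =
    g (nth None [seq Some (inl b) | b <- w] k).
  rewrite /write_word; case: (ltnP k (size w)) => kw.
    rewrite ifT; last by lia.
    by rewrite (nth_map false) // gb (_ : absz (p + k%:Z - p)%R = k) //; lia.
  rewrite ifF; last by lia.
  by rewrite nth_default ?size_map.
split=> [|k|k] /=.
- by rewrite -nth0 -e addr0.
- by rewrite nth_behead -e; congr write_word; lia.
- by rewrite nth_nil g0 /write_word ifF //; lia.
Qed.

Lemma represents_blank p : represents g (word_tape B [::]) (p, fun=> None).
Proof. by split=> [|k|k] /=; rewrite ?nth_nil g0. Qed.

End RepresentsWord.

Lemma list_tape_bits (A : finType) (w : word) :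
  list_tape [seq Some (inl b) : cell A | b <- w] = write_word (fun=> None) 0 w.
Proof.
apply: funext => z; rewrite /write_word /list_tape; case: z => k /=; last by [].
case: (ltnP k (size w)) => kw.
  by rewrite (nth_map false) // ifT ?addn0 //; lia.
by rewrite ifF ?nth_default ?size_map //; lia.
Qed.

Lemma reads_write_word (A : finType) (p : int) w :
  reads ((p, write_word (fun=> None) p w) : atape A) w.
Proof.
split=> [k kw|] /=; rewrite /write_word.
  rewrite ifT; last by lia.
  by have -> : absz (p + k%:Z - p)%R = k by lia.
by rewrite ifF //; lia.
Qed.

Lemma erase_write_word (A : finType) (p : int) w :
  erase (write_word (fun=> None) p w) p (size w) = (fun=> None) :> (int -> cell A).
Proof. by apply: funext => z; rewrite /erase /write_word; case: (_ && _). Qed.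

Section Composition.
Variables (M1 M2 : machine).
Let J : finType := ('I_(extra_tapes M1).+1 + 'I_(extra_tapes M2))%type.
Let Q : finType := (state M1 + state M2)%type.
Let A : finType := (aux M1 + aux M2)%type.

Definition cell_inl (c : cell (aux M1)) : cell A :=
  match c with None => None | Some (inl b) => Some (inl b)
  | Some (inr a) => Some (inr (inl a)) end.

Definition cell_of_inl (c : cell A) : cell (aux M1) :=
  match c with Some (inl b) => Some (inl b) | Some (inr (inl a)) => Some (inr a)
  | _ => None end.

Definition cell_inr (c : cell (aux M2)) : cell A :=
  match c with None => None | Some (inl b) => Some (inl b)
  | Some (inr a) => Some (inr (inr a)) end.

Definition cell_of_inr (c : cell A) : cell (aux M2) :=
  match c with Some (inl b) => Some (inl b) | Some (inr (inr a)) => Some (inr a)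
  | _ => None end.

Let K1 : cancel cell_inl cell_of_inl. Proof. by case=> [[]|]. Qed.
Let K2 : cancel cell_inr cell_of_inr. Proof. by case=> [[]|]. Qed.

(** All tapes of the first machine are inner ones, including its input tape; tape [ord0] of the
    second machine is the outer tape [None]. *)
Definition name1 (i : 'I_(extra_tapes M1).+1) : option J := Some (inl i).
Definition name1_inv (x : option J) : option 'I_(extra_tapes M1).+1 :=
  if x is Some (inl i) then Some i else None.
Definition name2 (i : 'I_(extra_tapes M2).+1) : option J :=
  omap inr (unlift ord0 i).
Definition name2_inv (x : option J) : option 'I_(extra_tapes M2).+1 :=
  match x with None => Some ord0 | Some (inr j) => Some (lift ord0 j)
  | Some (inl _) => None end.

Let nK1 i : name1_inv (name1 i) = Some i. Proof. by []. Qed.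
Let nK2 i : name2_inv (name2 i) = Some i.
Proof. by rewrite /name2; case: unliftP => [j ->|->]. Qed.

Definition state1 (q : Q) : option (state M1) := if q is inl s then Some s else None.
Definition state2 (q : Q) : option (state M2) := if q is inr s then Some s else None.

Let work : option J := Some (inl ord0).

Definition compose : cmd J Q A :=
  Seq (transfer Q A None work) (Seq (rewind_bits Q A work)
    (Seq (simulate cell_inl cell_of_inl name1 name1_inv inl state1)
      (Seq (transfer Q A work None) (Seq (rewind_bits Q A None)
        (Seq (Act (fun _ h => (inr (start M2), fun x => (h x, Stay))))
          (simulate cell_inr cell_of_inr name2 name2_inv inr state2)))))).

Lemma exec_compose w n1 n2 :
  (iter n1 (@step M1) (init M1 w)).1 \in halting M1 ->
  let v := output (iter n1 (@step M1) (init M1 w)) in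
  (iter n2 (@step M2) (init M2 v)).1 \in halting M2 ->
  exists k q T, [/\ exec compose (inl (start M1)) (input_store A w) k q T,
    (k <= 20 * (size w + size v + n1 + n2 + 1))%N &
    reads (T None) (output (iter n2 (@step M2) (init M2 v)))].
Proof.
move=> halt1 v halt2.
pose T0 : option J -> atape A := input_store A w.
have T0n : T0 None = (0, write_word (fun=> None) 0 w) by rewrite /T0 /input_store list_tape_bits.
have blank : list_tape [::] = (fun=> None) :> (int -> cell A).
  by apply: funext => z; rewrite list_tape_nil.
have T0s j : T0 (Some j) = (0, fun=> None) by rewrite /T0 /input_store blank.
have r0 : reads (T0 None) w by rewrite T0n; apply: reads_write_word.
have e1 := exec_transfer (inl (start M1) : Q) (isT : None != work) T0n (T0s (inl ord0)) r0.
rewrite erase_write_word !add0r in e1.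
set T1 := set_tape _ _ _ in e1.
have T1w : T1 work = (0 + (size w)%:Z, write_word (fun=> None) 0 w).
  by rewrite /T1 set_tapeE add0r.
have e2 := @exec_rewind_bits J Q A work (inl (start M1)) T1 _ _ _ T1w _ _.
have {}e2 : exec (rewind_bits Q A work) (inl (start M1) : Q) T1 (2 * size w + 3)%N
    (inl (start M1)) (set_tape T1 work (0, write_word (fun=> None) 0 w)).
  apply: e2 => [k kw|]; rewrite /write_word; [by rewrite ifT //; lia | by []].
set T2 := set_tape T1 _ _ in e2.
have rep1 i : represents cell_inl ((init M1 w).2 i) (T2 (name1 i)).
  rewrite /= ffunE; case: (altP (i =P ord0)) => [->|i0].
    by rewrite /T2 set_tapeE; apply: represents_word.
  have ni : name1 i != work by apply: contraNneq i0 => -[->].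
  rewrite /T2 set_tapeN // /T1 set_tapeN // set_tapeN // T0s.
  exact: represents_blank.
have [k3 [T3 [e3 k3le rep3 oth3]]] := exec_simulate (Q := Q) K1 nK1
  (inQ := inl) (outQ := state1) (fun _ => erefl) rep1 halt1.
have T3n : T3 None = ((size w)%:Z, fun=> None).
  by rewrite oth3 // /T2 set_tapeN // /T1 set_tapeN // set_tapeE.
have r3 : reads (T3 work) v.
  by apply: reads_output (rep3 ord0) => //; case=> [[]|].
case ew : (T3 work) => [pw fw].
pose q3 : Q := inl (iter n1 (@step M1) (init M1 w)).1.
(* The output of the first machine may stand anywhere and next to other symbols, whereas [init]
   requires a tape that is blank apart from the input; hence the move to the erased tape. *)
have e4 := exec_transfer q3 (isT : work != None) ew T3n r3.
set T4 := set_tape _ _ _ in e4.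
have T4n : T4 None = ((size w)%:Z + (size v)%:Z, write_word (fun=> None) (size w)%:Z v).
  by rewrite /T4 set_tapeE.
have e5 : exec (rewind_bits Q A None) q3 T4 (2 * size v + 3)%N q3
    (set_tape T4 None ((size w)%:Z, write_word (fun=> None) (size w)%:Z v)).
  apply: exec_rewind_bits T4n _ _ => [k kw|]; rewrite /write_word;
    [by rewrite ifT //; lia | by rewrite ifF //; lia].
set T5 := set_tape T4 _ _ in e5.
have e6 := exec_act (fun (_ : Q) (h : option J -> cell A) =>
  (inr (start M2) : Q, fun x => (h x, Stay))) q3 T5.
rewrite /= perform_idle in e6.
have rep5 i : represents cell_inr ((init M2 v).2 i) (T5 (name2 i)).
  rewrite /= ffunE /name2; case: unliftP => [j ->|->] /=.
    rewrite /T5 set_tapeN // /T4 set_tapeN // set_tapeN // oth3 //.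
    rewrite /T2 set_tapeN // /T1 set_tapeN // set_tapeN // T0s.
    exact: represents_blank.
  by rewrite /T5 set_tapeE; apply: represents_word.
have [k7 [T7 [e7 k7le rep7 _]]] := exec_simulate (Q := Q) K2 nK2
  (inQ := inr) (outQ := state2) (fun _ => erefl) rep5 halt2.
do 3 eexists; split.
- apply: exec_seq e1 _; apply: exec_seq e2 _; apply: exec_seq e3 _.
  apply: exec_seq e4 _; apply: exec_seq e5 _; apply: exec_seq e6 _; exact: e7.
- by lia.
have := rep7 ord0; rewrite /name2 unlift_none /= => h.
by apply: reads_output h => //; case=> [[]|].
Qed.

End Composition.

Lemma polytime_comp f g : polytime f -> polytime g -> polytime (fun w => g (f w)).
Proof.
case=> M1 [p1 h1] [M2 [p2 h2]].
pose len s := (s + p1.[s]).+1.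
have size_f w : (size (f w) <= len (size w))%N.
  have [_ <-] := h1 w; apply: leq_trans (size_output_iter _ _) _.
  by rewrite /= ffunE /= size_behead size_map /len; lia.
have len_pb : poly_bound len.
  apply: poly_bound_le (poly_boundD (poly_boundD poly_bound_id (horner_poly_bound p1))
    (poly_bound_const 1)) => s; by rewrite /len; lia.
pose t s := (20 * (s + len s + p1.[s] + p2.[len s] + 1))%N.
apply: (@polytime_exec _ _ _ (compose M1 M2) (inl (start M1)) _ t).
  apply: poly_boundM (poly_bound_const 20) _.
  apply: poly_boundD (poly_bound_const 1); apply: poly_boundD.
    apply: poly_boundD (horner_poly_bound p1); exact: poly_boundD poly_bound_id len_pb.
  exact: poly_bound_comp (@horner_mono p2) (horner_poly_bound p2) len_pb.
move=> w; have [a1 b1] := h1 w; have [a2 b2] := h2 (f w).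
have := @exec_compose M1 M2 w _ p2.[size (f w)] a1; rewrite /= b1 => /(_ a2).
case=> k [q [T [e kle r]]]; exists k, q, T; split=> //; last by rewrite -b2.
apply: leq_trans kle _; rewrite /t leq_mul2l; apply/orP; right.
have := horner_mono p2 (size_f w); have := size_f w; lia.
Qed.

Lemma reduces_trans P1 P2 P3 : reduces P1 P2 -> reduces P2 P3 -> reduces P1 P3.
Proof.
case=> f [pf yf nf] [g [pg yg ng]]; exists (fun w => g (f w)); split.
- exact: polytime_comp.
- by move=> w /yf /yg.
- by move=> w /nf /ng.
Qed.

Lemma write_word_rcons (A : finType) (f : int -> cell A) p o b :
  (fun z => if z == p + (size o)%:Z then Some (inl b) else write_word f p o z) =
  write_word f p (rcons o b).
Proof.
apply: funext => z; rewrite /write_word size_rcons nth_rcons.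
case: (altP (z =P p + (size o)%:Z)) => [->|zp].
  rewrite ifT; last by lia.
  by have -> : absz (p + (size o)%:Z - p)%R = size o by [lia]; rewrite ltnn eqxx.
case: ifP => h.
  rewrite ifT; last by lia.
  by rewrite ifT //; lia.
by rewrite ifF //; lia.
Qed.

(** * Programs with read-only tapes *)

Section Scanning.
Variables (J Q : finType) (inp : int -> cell unit) (base : int).
Variable cont : J -> seq (cell unit).

Definition marker : cell unit := Some (inr tt).
Definition tick : cell unit := Some (inl true).

Hypothesis cont_marker : forall j, marker \notin cont j.

Local Notation name := (option J).
Local Notation store := (name -> atape unit).
Local Notation env := (J -> nat).
Local Notation cmd := (cmd J Q unit).
Local Notation move_heads := (@move_heads J Q unit).

(* Tape [None] carries the output from position [base] on; the others are
   read-only, with a marker at position 0 and the head of tape [j] at [e j]. *)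
Definition reading (e : env) (out : word) : store := fun x =>
  if x is Some j then ((e j)%:Z, list_tape (marker :: cont j))
  else (base + (size out)%:Z, write_word inp base out).

(** The clause [size o <= k] bounds the length of the output by the time spent, which later pays for
    returning to its first bit. *)
Definition does (c : cmd) (e : env) (o : word) (e' : env) (t : nat) : Prop :=
  forall q out, exists k, [/\ (k <= t)%N, (size o <= k)%N &
    exec c q (reading e out) k q (reading e' (out ++ o))].

Lemma does_le c e o e' t t' : (t <= t')%N -> does c e o e' t -> does c e o e' t'.
Proof.
by move=> tt' h q out; have [k [k1 k2 k3]] := h q out; exists k; split=> //; apply: leq_trans tt'.
Qed.

Lemma does_seq c1 c2 e e1 e2 o1 o2 t1 t2 :
  does c1 e o1 e1 t1 -> does c2 e1 o2 e2 t2 ->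
  does (Seq c1 c2) e (o1 ++ o2) e2 (t1 + t2).
Proof.
move=> h1 h2 q out; have [k1 [k1t o1k r1]] := h1 q out.
have [k2 [k2t o2k r2]] := h2 q (out ++ o1).
exists (k1 + k2)%N; split; [exact: leq_add | by rewrite size_cat leq_add |].
by rewrite catA; apply: exec_seq r1 r2.
Qed.

Definition skip : cmd := move_heads (fun=> Stay).

Definition emit (b : bool) : cmd :=
  Act (fun q h => (q, fun x => if x is None then (Some (inl b), MoveRight)
                               else (h x, Stay))).

Lemma does_emit b e : does (emit b) e [:: b] e 1.
Proof.
move=> q out; exists 1%N; split=> //.
have := exec_act (fun q h => (q, fun x : name =>
  if x is None then (Some (inl b), MoveRight) else (h x, Stay))) q (reading e out).
congr (run _ _ _ _ _ _); apply: funext => -[j|]; rewrite /perform /=.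
  by rewrite /scan_all awrite_scan.
rewrite /awrite /= cats1 write_word_rcons size_rcons.
by congr pair; lia.
Qed.

Definition shift_nat (m : move) (p : nat) : nat :=
  match m with MoveLeft => p.-1 | Stay => p | MoveRight => p.+1 end.

Definition moves (m : J -> move) : cmd :=
  move_heads (fun x => if x is Some j then m j else Stay).

Lemma does_moves m e : (forall j, m j = MoveLeft -> (0 < e j)%N) ->
  does (moves m) e [::] (fun j => shift_nat (m j) (e j)) 1.
Proof.
move=> pos q out; exists 1%N; split=> //; rewrite cats0.
have := exec_move_heads (fun x : name => if x is Some j then m j else Stay)
  q (reading e out).
congr (run _ _ _ _ _ _); apply: funext => -[j|] //=.
by congr pair; have := pos j; case: (m j) => //= [/(_ erefl)|_]; lia.
Qed.

Definition here (e : env) (j : J) : cell unit := nth None (marker :: cont j) (e j).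

Lemma here_marker e j : (here e j == marker) = (e j == 0%N).
Proof.
rewrite /here; case: (e j) => [|p] //=; apply/negP => /eqP h.
have := cont_marker j; rewrite -h mem_nth //.
by rewrite ltnNge; apply/negP => sp; rewrite nth_default in h.
Qed.

Definition reads_only (p : (J -> cell unit) -> bool) : Q -> (name -> cell unit) -> bool :=
  fun _ h => p (fun j => h (Some j)).

Lemma does_if (p : (J -> cell unit) -> bool) c1 c2 e o e' t :
  does (if p (here e) then c1 else c2) e o e' t ->
  does (If (reads_only p) c1 c2) e o e' t.+1.
Proof.
move=> h q out; have [k [kt ok r]] := h q out.
by exists k.+1; split=> //; [exact: leqW | exact: exec_if].
Qed.

Lemma does_while_end (p : (J -> cell unit) -> bool) c e : ~~ p (here e) -> does (While (reads_only p) c) e [::] e 1.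
Proof.
by move=> np q out; exists 1%N; split=> //; rewrite cats0; apply: exec_while_end.
Qed.

Lemma does_while (p : (J -> cell unit) -> bool) c e o1 e1 t1 o2 e2 t2 : p (here e) ->
  does c e o1 e1 t1 -> does (While (reads_only p) c) e1 o2 e2 t2 ->
  does (While (reads_only p) c) e (o1 ++ o2) e2 (t1 + t2).+1.
Proof.
move=> pe h1 h2 q out; have [k1 [k1t o1k r1]] := h1 q out.
have [k2 [k2t o2k r2]] := h2 q (out ++ o1).
exists (k1 + k2).+1; split; first by rewrite ltnS leq_add.
  by rewrite size_cat leqW // leq_add.
by rewrite catA; apply: exec_while r1 r2.
Qed.

Lemma does_skip e : does skip e [::] e 1.
Proof.
by move=> q out; exists 1%N; split=> //; rewrite cats0; have := exec_move_heads
  (fun x : name => Stay) q (reading e out);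
  congr (run _ _ _ _ _ _); apply: funext => -[].
Qed.

Definition set_pos (e : env) (j : J) (p : nat) : env :=
  fun i => if i == j then p else e i.

Definition rewind (j : J) : cmd :=
  Seq (While (reads_only (fun h => h j != marker))
         (moves (fun i => if i == j then MoveLeft else Stay)))
      (moves (fun i => if i == j then MoveRight else Stay)).

Lemma does_rewind j e : does (rewind j) e [::] (set_pos e j 1) (2 * e j + 2).
Proof.
rewrite (_ : 2 * e j + 2 = (2 * e j).+1 + 1)%N; last by lia.
apply: (does_seq (o1 := [::]) (e1 := set_pos e j 0)); last first.
  have := @does_moves (fun i => if i == j then MoveRight else Stay) (set_pos e j 0).
  have -> : (fun i => shift_nat (if i == j then MoveRight else Stay) (set_pos e j 0 i)) =
    set_pos e j 1 by apply: funext => i; rewrite /set_pos; case: (i == j).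
  by apply=> i; case: (i == j).
have e_id : e = set_pos e j (e j).
  by apply: funext => i; rewrite /set_pos; case: eqP => [->|].
rewrite {1}e_id; elim: (e j) => [|p IH].
  by apply: does_while_end; rewrite here_marker /set_pos eqxx.
rewrite (_ : (2 * p.+1).+1 = (1 + (2 * p).+1).+1)%N; last by lia.
apply: (does_while (o1 := [::]) (e1 := set_pos e j p)) => //.
  by rewrite here_marker /set_pos eqxx.
have := @does_moves (fun i => if i == j then MoveLeft else Stay) (set_pos e j p.+1).
have -> : (fun i => shift_nat (if i == j then MoveLeft else Stay) (set_pos e j p.+1 i)) =
  set_pos e j p by apply: funext => i; rewrite /set_pos; case: (i == j).
by apply=> i; rewrite /set_pos; case: (i == j).
Qed.

Section EqualityTest.
Variables (x y s : J) (c1 c2 : cmd).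
Hypotheses (xy : x != y) (xs : x != s) (ys : y != s).

Let down i := if (i == x) || (i == y) then MoveLeft else if i == s then MoveRight else Stay.
Let up i := if (i == x) || (i == y) then MoveRight else if i == s then MoveLeft else Stay.

Definition restore : cmd := While (reads_only (fun h => h s != marker)) (moves up).

(** Numbers are head positions. Both heads go left until one meets its marker while the scratch head
    counts the steps; both are then on markers exactly when the positions were equal. [restore]
    undoes the descent before the branch runs. *)
Definition test_eq : cmd :=
  Seq (While (reads_only (fun h => (h x != marker) && (h y != marker))) (moves down))
    (If (reads_only (fun h => (h x == marker) && (h y == marker)))
       (Seq restore c1) (Seq restore c2)).

Let descend (e : env) (r : nat) (i : J) : nat :=
  if (i == x) || (i == y) then (e i - r)%N else if i == s then r else e i.

Lemma does_test_eq e o e' t : e s = 0%N ->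
  does (if e x == e y then c1 else c2) e o e' t ->
  does test_eq e o e' (t + 4 * e x + 4).
Proof.
move=> es h; pose r := minn (e x) (e y).
have dx p : descend e p x = (e x - p)%N by rewrite /descend eqxx.
have dy p : descend e p y = (e y - p)%N by rewrite /descend eqxx orbT.
have ds p : descend e p s = p.
  by rewrite /descend (eq_sym s x) (eq_sym s y) (negPf xs) (negPf ys) eqxx.
have d0 : descend e 0 = e.
  apply: funext => i; rewrite /descend subn0; case: ifP => // _.
  by case: eqP => // ->.
have go_down p : (p <= r)%N ->
    does (While (reads_only (fun h => (h x != marker) && (h y != marker))) (moves down))
      (descend e (r - p)) [::] (descend e r) (2 * p).+1.
  elim: p => [|p IH] pr.
    rewrite subn0; apply: does_while_end; rewrite !here_marker dx dy; lia.
  rewrite (_ : (2 * p.+1).+1 = (1 + (2 * p).+1).+1)%N; last by lia.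
  apply: (does_while (o1 := [::]) (e1 := descend e (r - p))); last by apply: IH; lia.
    by rewrite !here_marker dx dy; lia.
  have := @does_moves down (descend e (r - p.+1)).
  have -> : (fun i => shift_nat (down i) (descend e (r - p.+1) i)) = descend e (r - p).
    apply: funext => i; rewrite /down /descend; case: ifP => [ixy|_] /=.
      by lia.
    by case: eqP => //= _; lia.
  apply=> i; rewrite /down /descend; case: ifP => [/orP[]/eqP ->|_] //.
  - by move=> _; lia.
  - by move=> _; lia.
  - by case: eqP.
have go_up p : (p <= r)%N -> does restore (descend e p) [::] e (2 * p).+1.
  elim: p => [|p IH] pr.
    by rewrite d0; apply: does_while_end; rewrite here_marker es.
  rewrite (_ : (2 * p.+1).+1 = (1 + (2 * p).+1).+1)%N; last by lia.
  apply: (does_while (o1 := [::]) (e1 := descend e p)); last by apply: IH; lia.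
    by rewrite here_marker ds.
  have := @does_moves up (descend e p.+1).
  have -> : (fun i => shift_nat (up i) (descend e p.+1 i)) = descend e p.
    apply: funext => i; rewrite /up /descend; case: ifP => [/orP[]/eqP ->|_] /=.
    - by lia.
    - by lia.
    by case: eqP.
  apply=> i; rewrite /up /descend; case: ifP => // _.
  by case: eqP.
apply: (@does_le _ _ _ _ ((2 * r).+1 + ((2 * r).+1 + t).+1)); first by rewrite /r; lia.
apply: (does_seq (o1 := [::]) (e1 := descend e r)).
  by have := go_down r (leqnn r); rewrite subnn d0.
apply: does_if; rewrite !here_marker dx dy.
have -> : ((e x - r == 0) && (e y - r == 0))%N = (e x == e y) by rewrite /r; lia.
by case: ifP h => _ h; apply: (does_seq (o1 := [::]) (go_up r (leqnn r)) h).
Qed.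

End EqualityTest.

Section Codes.
Variable s : J.

(** In continuation-passing style the index found is kept in the control state: there is one copy of
    [k i] for each of the boundedly many [i]. *)
Fixpoint find_index (v : J) (ws : seq J) (i : nat) (k : nat -> cmd) : cmd :=
  if ws is w :: ws' then
    if v == w then k i else test_eq v w s (k i) (find_index v ws' i.+1 k)
  else k i.

Fixpoint find_codes (vs ws : seq J) (k : seq nat -> cmd) : cmd :=
  if vs is v :: vs' then
    find_index v ws 0 (fun i => find_codes vs' ws (fun l => k (i :: l)))
  else k [::].

Lemma does_find_index v ws i k e o e' t : e s = 0%N -> v != s -> s \notin ws ->
  does (k (i + index (e v) (map e ws))%N) e o e' t ->
  does (find_index v ws i k) e o e' (t + size ws * (4 * e v + 4)).
Proof.
move=> es vs; elim: ws i => [|w ws IH] i /=; first by rewrite !addn0.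
rewrite inE negb_or => /andP[sw sws] h.
case: (altP (v =P w)) h => [<-|vw] h.
  by move: h; rewrite eqxx addn0; apply: does_le; lia.
apply: (@does_le _ _ _ _ ((t + size ws * (4 * e v + 4)) + 4 * e v + 4)).
  by rewrite (mulSn (size ws)); lia.
apply: does_test_eq => //; first by rewrite eq_sym.
rewrite eq_sym; case: ifP h => _ h; first by move: h; rewrite addn0; apply: does_le; lia.
by apply: IH => //; rewrite addSnnS.
Qed.

Lemma does_find_codes vs ws k e o e' t b : e s = 0%N -> s \notin vs -> s \notin ws ->
  {in vs, forall v, e v <= b}%N ->
  does (k [seq index (e v) (map e ws) | v <- vs]) e o e' t ->
  does (find_codes vs ws k) e o e' (t + size vs * (size ws * (4 * b + 4))).
Proof.
move=> es + sws; elim: vs k => [|v vs IH] k /=; first by rewrite addn0.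
rewrite inE negb_or => /andP[sv svs] bd h.
apply: (@does_le _ _ _ _ (t + size vs * (size ws * (4 * b + 4)) + size ws * (4 * e v + 4))).
  have bv := bd v (mem_head _ _).
  have : (size ws * (4 * e v + 4) <= size ws * (4 * b + 4))%N.
    by rewrite leq_mul2l; apply/orP; right; lia.
  by move=> le1; rewrite (mulSn (size vs)) -addnA leq_add2l addnC leq_add2r.
apply: does_find_index => //; first by rewrite eq_sym.
apply: IH => // x xv; apply: bd; exact: mem_behead.
Qed.

End Codes.

Section ArcLoop.
Variables (X Y Z : J) (n : nat) (bits : word).
Hypotheses (XY : X != Y) (XZ : X != Z) (YZ : Y != Z).
Hypotheses (contX : cont X = nseq n tick) (contY : cont Y = nseq n tick).
Hypothesis contZ : cont Z = [seq Some (inl b) | b <- bits].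

(** The head on [Z] advances with the one on [Y] and is not reset between rows, so at the pair
    [(x, y)] it scans bit [x * n + y] of the matrix. *)
Definition arc_loop (c : cmd) : cmd :=
  Seq (While (reads_only (fun h => h X == tick))
        (Seq (While (reads_only (fun h => h Y == tick))
                (Seq (If (reads_only (fun h => h Z == tick)) c skip)
                     (moves (fun i => if (i == Y) || (i == Z) then MoveRight else Stay))))
             (Seq (rewind Y) (moves (fun i => if i == X then MoveRight else Stay)))))
      (Seq (rewind X) (rewind Z)).

Definition arc_env (e : env) (a b c : nat) : env := fun i =>
  if i == X then a else if i == Y then b else if i == Z then c else e i.

Lemma arc_envX e a b c : arc_env e a b c X = a.
Proof. by rewrite /arc_env eqxx. Qed.

Lemma arc_envY e a b c : arc_env e a b c Y = b.
Proof. by rewrite /arc_env eq_sym (negPf XY) eqxx. Qed.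

Lemma arc_envZ e a b c : arc_env e a b c Z = c.
Proof. by rewrite /arc_env ![Z == _]eq_sym (negPf XZ) (negPf YZ) eqxx. Qed.

Let bit x y := nth false bits (x * n + y).

Lemma one_nseq p : (0 < p)%N -> (nth None (marker :: nseq n tick) p == tick) = (p <= n)%N.
Proof. by case: p => //= p _; rewrite nth_nseq; case: ifP. Qed.

Lemma one_bits p : (nth None (marker :: [seq Some (inl b) | b <- bits]) p.+1 == tick) =
  nth false bits p.
Proof.
rewrite /=; case: (ltnP p (size bits)) => h; last by rewrite !nth_default ?size_map.
by rewrite (nth_map false) // /tick; case: (nth false bits p).
Qed.

Variables (c : cmd) (e : env) (o : nat -> nat -> word) (t : nat).
Hypothesis body : forall x y, (x < n)%N -> (y < n)%N -> bit x y ->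
  does c (arc_env e x.+1 y.+1 (x * n + y).+1) (o x y)
         (arc_env e x.+1 y.+1 (x * n + y).+1) t.

Lemma does_inner x m : (x < n)%N -> (m <= n)%N ->
  does (While (reads_only (fun h => h Y == tick))
         (Seq (If (reads_only (fun h => h Z == tick)) c skip)
              (moves (fun i => if (i == Y) || (i == Z) then MoveRight else Stay))))
    (arc_env e x.+1 (n - m).+1 (x * n + (n - m)).+1)
    (flatten [seq o x y | y <- [seq y <- iota (n - m) m | bit x y]])
    (arc_env e x.+1 n.+1 (x * n + n).+1) (m * (t + 4) + 1).
Proof.
move=> xn; elim: m => [|m IH] mn.
  rewrite subn0 mul0n add0n; apply: does_while_end.
  by rewrite /here contY arc_envY one_nseq // ltnn.
set y := (n - m.+1)%N; have yn : (y < n)%N by rewrite /y; lia.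
have ey : (n - m = y.+1)%N by rewrite /y; lia.
rewrite ey in IH.
have -> : flatten [seq o x y0 | y0 <- [seq y0 <- iota y m.+1 | bit x y0]] =
   ((if bit x y then o x y else [::]) ++ [::]) ++
    flatten [seq o x y0 | y0 <- [seq y0 <- iota y.+1 m | bit x y0]].
  by rewrite cats0 /=; case: (bit x y).
apply: (@does_le _ _ _ _ ((t.+1.+1 + 1) + (m * (t + 4) + 1)).+1).
  by rewrite mulSn; lia.
apply: (does_while (e1 := arc_env e x.+1 y.+2 (x * n + y.+1).+1)); last exact: IH (ltnW mn).
  by rewrite /here contY arc_envY one_nseq.
apply: (does_seq (e1 := arc_env e x.+1 y.+1 (x * n + y).+1)).
  apply: does_if.
  have -> : (here (arc_env e x.+1 y.+1 (x * n + y).+1) Z == tick) = bit x y.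
    by rewrite /here contZ arc_envZ one_bits.
  case: ifP => b; first by apply: does_le (body xn yn b); lia.
  by apply: does_le (does_skip _); lia.
have := @does_moves (fun i => if (i == Y) || (i == Z) then MoveRight else Stay)
   (arc_env e x.+1 y.+1 (x * n + y).+1).
have -> : (fun i => shift_nat (if (i == Y) || (i == Z) then MoveRight else Stay)
    (arc_env e x.+1 y.+1 (x * n + y).+1 i)) = arc_env e x.+1 y.+2 (x * n + y.+1).+1.
  apply: funext => i; rewrite /arc_env addnS.
  case: (altP (i =P X)) => [->|_]; first by rewrite (negPf XY) (negPf XZ).
  by case: (altP (i =P Y)) => //= _; case: (altP (i =P Z)).
by apply=> i; case: (_ || _).
Qed.

Lemma does_outer m : (m <= n)%N ->
  does (While (reads_only (fun h => h X == tick))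
        (Seq (While (reads_only (fun h => h Y == tick))
                (Seq (If (reads_only (fun h => h Z == tick)) c skip)
                     (moves (fun i => if (i == Y) || (i == Z) then MoveRight else Stay))))
             (Seq (rewind Y) (moves (fun i => if i == X then MoveRight else Stay)))))
    (arc_env e (n - m).+1 1 ((n - m) * n).+1)
    (flatten [seq flatten [seq o x y | y <- [seq y <- iota 0 n | bit x y]]
                | x <- iota (n - m) m])
    (arc_env e n.+1 1 (n * n).+1) (m * (n * (t + 4) + 2 * n + 8) + 1).
Proof.
elim: m => [|m IH] mn.
  rewrite subn0 mul0n add0n; apply: does_while_end.
  by rewrite /here contX arc_envX one_nseq // ltnn.
set x := (n - m.+1)%N; have xn : (x < n)%N by rewrite /x; lia.
have ex : (n - m = x.+1)%N by rewrite /x; lia.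
rewrite ex in IH.
have -> : flatten [seq flatten [seq o x0 y | y <- [seq y <- iota 0 n | bit x0 y]] |
      x0 <- iota x m.+1] =
  (flatten [seq o x y | y <- [seq y <- iota 0 n | bit x y]] ++ [::] ++ [::]) ++
  flatten [seq flatten [seq o x0 y | y <- [seq y <- iota 0 n | bit x0 y]] | x0 <- iota x.+1 m].
  by rewrite !cats0.
apply: (@does_le _ _ _ _ (((n * (t + 4) + 1) + ((2 * n.+1 + 2) + 1)) +
   (m * (n * (t + 4) + 2 * n + 8) + 1)).+1); first by rewrite mulSn; lia.
apply: (does_while (e1 := arc_env e x.+2 1 (x.+1 * n).+1)); last exact: IH (ltnW mn).
  by rewrite /here contX arc_envX one_nseq.
apply: (does_seq (e1 := arc_env e x.+1 n.+1 (x * n + n).+1)).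
  by have := does_inner xn (leqnn n); rewrite subnn addn0.
apply: (does_seq (e1 := arc_env e x.+1 1 (x.+1 * n).+1)).
  have := does_rewind Y (arc_env e x.+1 n.+1 (x * n + n).+1).
  have -> : set_pos (arc_env e x.+1 n.+1 (x * n + n).+1) Y 1 = arc_env e x.+1 1 (x.+1 * n).+1.
    apply: funext => i; rewrite /set_pos /arc_env mulSn addnC.
    case: (altP (i =P Y)) => [->|_] //.
    by rewrite eq_sym (negPf XY).
  by rewrite arc_envY.
have := @does_moves (fun i => if i == X then MoveRight else Stay)
   (arc_env e x.+1 1 (x.+1 * n).+1).
have -> : (fun i => shift_nat (if i == X then MoveRight else Stay)
    (arc_env e x.+1 1 (x.+1 * n).+1 i)) = arc_env e x.+2 1 (x.+1 * n).+1.
  by apply: funext => i; rewrite /arc_env; case: (altP (i =P X)).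
by apply=> i; case: (_ == _).
Qed.

Lemma does_arc_loop : e X = 1%N -> e Y = 1%N -> e Z = 1%N ->
  does (arc_loop c) e (flatten [seq o p.1 p.2 | p <- arcs n bit]) e
    (n.+1 ^ 2 * (t + 9)).
Proof.
move=> eX eY eZ.
have e_id : e = arc_env e 1 1 1.
  apply: funext => i; rewrite /arc_env.
  by do 3 (case: eqP => [->|_] //).
have -> : flatten [seq o p.1 p.2 | p <- arcs n bit] =
  flatten [seq flatten [seq o x y | y <- [seq y <- iota 0 n | bit x y]] | x <- iota 0 n]
   ++ [::] ++ [::].
  rewrite !cats0; have key l (F : nat -> seq nat) :
      flatten [seq o p.1 p.2 | p <- [seq (x, y) | x <- l, y <- F x]] =
      flatten [seq flatten [seq o x y | y <- F x] | x <- l].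
    by elim: l => //= x l IH; rewrite map_cat flatten_cat IH -map_comp.
  exact: key.
apply: (@does_le _ _ _ _ ((n * (n * (t + 4) + 2 * n + 8) + 1) +
   ((2 * n.+1 + 2) + (2 * (n * n).+1 + 2)))).
  by rewrite expnS expn1; nia.
apply: (does_seq (e1 := arc_env e n.+1 1 (n * n).+1)).
  by have := does_outer (leqnn n); rewrite subnn mul0n -e_id.
apply: (does_seq (e1 := arc_env e 1 1 (n * n).+1)).
  have := does_rewind X (arc_env e n.+1 1 (n * n).+1).
  rewrite arc_envX; congr (does _ _ _ _ _).
  by apply: funext => i; rewrite /set_pos /arc_env; case: (i == X).
have := does_rewind Z (arc_env e 1 1 (n * n).+1).
rewrite arc_envZ.
congr (does _ _ _ _ _); rewrite [RHS]e_id.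
apply: funext => i; rewrite /set_pos /arc_env.
by case: (altP (i =P Z)) => [->|_] //; rewrite ![Z == _]eq_sym (negPf XZ) (negPf YZ).
Qed.

End ArcLoop.

End Scanning.

(** * The program writing the gadget *)

Local Notation arc := ((nat * nat) * (nat * nat))%type.

Lemma flatten_allpairs (S T U Z : Type) (f : S -> T -> U) (g : U -> seq Z) s t :
  flatten [seq g z | z <- [seq f x y | x <- s, y <- t]] =
  flatten [seq flatten [seq g (f x y) | y <- t] | x <- s].
Proof. by elim: s => //= x s IH; rewrite map_cat flatten_cat IH -map_comp. Qed.

Section Recode.
Variable L : nat.

Definition arc_copy (p : arc) : nat := p.1.1.

(** Successors, because the marker occupies position 0 of the tapes whose heads hold these
    vertices. *)
Definition arc_ends (w : seq arc) : seq nat :=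
  flatten [seq [:: p.1.2.+1; p.2.2.+1] | p <- w].

Fixpoint rebuild (rs cs : seq nat) : seq arc :=
  match rs, cs with
  | r :: rs', c :: d :: cs' => ((r, c), (r, d)) :: rebuild rs' cs'
  | _, _ => [::]
  end.

(** Its arguments are known when the command is built, so the adjacency of words is a constant at
    each leaf of the program and needs no computation on tapes. *)
Definition decide (rs rs' cs : seq nat) : bool :=
  let w := rebuild (rs ++ rs') cs in
  word_rel first_copy_nat L (take (size rs) w) (drop (size rs) w).

(* Equality of vertices is all that [word_rel] looks at, so a vertex may be
   replaced by the first place where it occurs. *)
Lemma decide_codes (w w' : seq arc) (vals := arc_ends (w ++ w')) :
  {in w ++ w', forall p, p.1.1 = p.2.1} ->
  decide (map arc_copy w) (map arc_copy w') [seq index z vals | z <- vals] =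
  word_rel first_copy_nat L w w'.
Proof.
move=> same.
(* Vertices that do not occur are sent beyond all codes, which makes [phi] injective on all
   numbers. *)
pose phi x := if x.+1 \in vals then index x.+1 vals else (size vals + x)%N.
have phi_inj : injective phi.
  move=> x y; rewrite /phi; case: ifP => xv; case: ifP => yv.
  - by move=> e; have := congr1 (nth 0%N vals) e; rewrite !nth_index // => -[].
  - by move=> e; move: xv; rewrite -index_mem e ltnNge leq_addr.
  - by move=> e; move: yv; rewrite -index_mem -e ltnNge leq_addr.
  - exact: addnI.
pose f (b : nat * nat) := (b.1, phi b.2).
have f_inj : injective f by move=> [a b] [c d] [-> /phi_inj ->].
have key : forall v : seq arc, {subset v <= w ++ w'} ->
    rebuild (map arc_copy v) [seq index z vals | z <- arc_ends v] = map (map_pair f) v.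
  elim=> [|p v IH] sub //=.
  have pw : p \in w ++ w' by apply: sub; rewrite mem_head.
  rewrite IH; last by move=> x xv; apply: sub; rewrite in_cons xv orbT.
  congr cons; have mem_ends x : x \in [:: p.1.2.+1; p.2.2.+1] -> x \in vals.
    move=> xp; apply/flattenP; exists [:: p.1.2.+1; p.2.2.+1] => //.
    by apply/mapP; exists p.
  rewrite /map_pair /f /phi !mem_ends ?inE ?eqxx ?orbT // /arc_copy -(same p pw).
  by [].
rewrite /decide -map_cat key //.
rewrite -map_take -map_drop size_map take_size_cat // drop_size_cat //.
exact: word_rel_map.
Qed.

End Recode.

Section Program.
Variables (V Q : finType) (M L : nat).
Local Notation J := (option (V * option bool)).
Local Notation cmd := (cmd J Q unit).

(** Every edge variable owns three tapes: two unary ones whose heads mark its ends, and a copy of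
    the adjacency matrix. *)
Definition src v : J := Some (v, Some false).
Definition tgt v : J := Some (v, Some true).
Definition mat v : J := Some (v, None).
Definition scratch : J := None.

Definition contents (n : nat) (bits : word) (j : J) : seq (cell unit) :=
  match j with
  | None => [::]
  | Some (_, None) => [seq Some (inl b) | b <- bits]
  | Some (_, Some _) => nseq n tick
  end.

Lemma contents_marker n bits j : marker \notin contents n bits j.
Proof.
case: j => [[v [b|]]|] //=; last by apply/negP => /mapP[].
by rewrite mem_nseq andbF.
Qed.

(** The number of copies is constant, so the choice of the copy is unrolled and handed to [k]; the
    ends of the edges stay in the head positions. *)
Fixpoint loops (vs : seq V) (k : seq nat -> cmd) : cmd :=
  if vs is v :: vs' then
    foldr (fun r => Seq (arc_loop (src v) (tgt v) (mat v) (loops vs' (fun rs => k (r :: rs)))))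
      (skip J Q) (iota 0 M)
  else k [::].

Section LoopsSpec.
Variables (inp : int -> cell unit) (base : int) (n : nat) (bits : word).
Let bit x y := nth false bits (x * n + y).
Local Notation E := (copy_edges M n bit).
Local Notation does := (@does J Q inp base (contents n bits)).
Local Notation env := (J -> nat).

Definition var_env (e : env) (v : V) (p : arc) : env :=
  arc_env (src v) (tgt v) (mat v) e p.1.2.+1 p.2.2.+1 (p.1.2 * n + p.2.2).+1.

Fixpoint word_env (e : env) (vs : seq V) (w : seq arc) : env :=
  match vs, w with
  | v :: vs', p :: w' => word_env (var_env e v p) vs' w'
  | _, _ => e
  end.

Definition at_start (e : env) (v : V) : Prop :=
  [/\ e (src v) = 1%N, e (tgt v) = 1%N & e (mat v) = 1%N].

Fixpoint loop_time (m : nat) (k t : nat) : nat :=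
  if k is k'.+1 then (M * (m.+1 ^ 2 * (loop_time m k' t + 9))).+1 else t.

Lemma var_env_other e v p v' b : v' != v -> var_env e v p (Some (v', b)) = e (Some (v', b)).
Proof.
move=> ne; rewrite /var_env /arc_env /src /tgt /mat.
by rewrite !ifF //; apply/eqP => -[] h; rewrite h eqxx in ne.
Qed.

Lemma does_loops vs e k (o : seq arc -> word) t :
  uniq vs -> {in vs, forall v, at_start e v} ->
  (forall w, w \in words E (size vs) ->
     does (k (map arc_copy w)) (word_env e vs w) (o w) (word_env e vs w) t) ->
  does (loops vs k) e (flatten [seq o w | w <- words E (size vs)]) e
    (loop_time n (size vs) t).
Proof.
elim: vs e k o => [|v vs IH] e k o /=.
  by move=> _ _ h; rewrite cats0; apply: (h [::]); rewrite inE.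
move=> /andP[vvs uvs] st h.
have [s1 s2 s3] := st v (mem_head _ _).
rewrite flatten_allpairs /copy_edges flatten_allpairs.
suff gen l : {subset l <= iota 0 M} -> does (foldr (fun r =>
    Seq (arc_loop (src v) (tgt v) (mat v) (loops vs (fun rs => k (r :: rs))))) (skip J Q) l) e
    (flatten [seq flatten [seq flatten [seq o (((r, a.1), (r, a.2)) :: w) |
       w <- words E (size vs)] | a <- arcs n bit] | r <- l]) e
    (size l * (n.+1 ^ 2 * (loop_time n (size vs) t + 9))).+1.
  by have := gen (iota 0 M) (fun _ => id); rewrite size_iota.
elim: l => [|r l IHl] sub /=; first exact: does_skip.
apply: (@does_le _ _ _ _ _ _ _ _ _ (n.+1 ^ 2 * (loop_time n (size vs) t + 9) +
  (size l * (n.+1 ^ 2 * (loop_time n (size vs) t + 9))).+1)).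
  by rewrite mulSn addnS.
apply: (does_seq (e1 := e)); last by apply: IHl => x xl; apply: sub; rewrite in_cons xl orbT.
have rM : r \in iota 0 M by apply: sub; rewrite mem_head.
apply: (@does_arc_loop J Q inp base (contents n bits) (@contents_marker n bits)
  (src v) (tgt v) (mat v) n bits _ _ _ _ _ _ _ e (fun x y =>
  flatten [seq o (((r, x), (r, y)) :: w) | w <- words E (size vs)])) => //;
  try by apply/eqP.
move=> x y xn yn bxy; apply: IH => //.
  move=> v' v'vs; have ne : v' != v by apply: contraNneq vvs => <-.
  have [t1 t2 t3] : at_start e v' by apply: st; rewrite in_cons v'vs orbT.
  have va := @var_env_other e v ((r, x), (r, y)) v' _ ne.
  by split; rewrite [LHS]va.
move=> w ww; apply: (h (((r, x), (r, y)) :: w)).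
apply/allpairsP; exists (((r, x), (r, y)), w); split=> //=.
apply/allpairsP; exists (r, (x, y)); split=> //=.
apply/allpairsPdep; exists x, y; split=> //; first by rewrite mem_iota.
by rewrite mem_filter mem_iota /= add0n yn andbT; exact: bxy.
Qed.

Lemma word_env_other e vs w v b : v \notin vs ->
  word_env e vs w (Some (v, b)) = e (Some (v, b)).
Proof.
elim: vs w e => [|v' vs IH] [|p w] e //=; rewrite inE negb_or => /andP[ne nv].
by rewrite IH // var_env_other.
Qed.

Lemma word_env_scratch e vs w : word_env e vs w scratch = e scratch.
Proof. by elim: vs w e => [|v vs IH] [|p w] e //=; rewrite IH. Qed.

Lemma word_env_cat e vs vs' w w' : size vs = size w ->
  word_env e (vs ++ vs') (w ++ w') = word_env (word_env e vs w) vs' w'.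
Proof. by elim: vs w e => [|v vs IH] [|p w] e //= [/IH]. Qed.

Definition end_tapes (vs : seq V) : seq J := flatten [seq [:: src v; tgt v] | v <- vs].

Lemma map_word_env e vs w : uniq vs -> size vs = size w ->
  map (word_env e vs w) (end_tapes vs) = arc_ends w.
Proof.
elim: vs w e => [|v vs IH] [|p w] e //= /andP[nv uvs] [/IH IHw].
rewrite !word_env_other // IHw //; congr [:: _, _ & _].
  by rewrite /var_env arc_envX.
by rewrite /var_env arc_envY //; apply/eqP => -[].
Qed.

Lemma mem_words_arcs k w p : w \in words E k -> p \in w ->
  [/\ p.1.1 = p.2.1, (p.1.2 < n)%N & (p.2.2 < n)%N].
Proof.
elim: k w => [|k IH] w /=; first by rewrite inE => /eqP ->.
case/allpairsP => [[q v] /= [qE vv ->]]; rewrite inE => /orP[/eqP ->|]; last exact: IH.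
case/allpairsP: qE => [[r [x y]] /= [_ + ->]] /=.
case/allpairsPdep => x0 [y0 [+ + [-> ->]]].
by rewrite mem_filter !mem_iota !add0n => /= x0n /andP[_ y0n].
Qed.

Variables (vs1 vs2 : seq V).
Hypotheses (uvs : uniq (vs1 ++ vs2)) (svs : size vs1 = size vs2).
Let K := size vs1.

Definition main : cmd :=
  Seq (loops vs1 (fun _ => emit J Q true)) (Seq (emit J Q false)
    (loops vs1 (fun rs => loops vs2 (fun rs' =>
       find_codes scratch (end_tapes (vs1 ++ vs2)) (end_tapes (vs1 ++ vs2))
         (fun cs => emit J Q (decide L rs rs' cs)))))).

Definition main_time (m : nat) : nat :=
  let c := size (end_tapes (vs1 ++ vs2)) in
  (loop_time m K 1 + (1 + loop_time m K (loop_time m K (1 + c * (c * (4 * m + 4))))))%N.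

Lemma scratch_end_tapes vs : scratch \notin end_tapes vs.
Proof. by apply/negP => /flattenP[s /mapP[v _ ->]]. Qed.

Lemma does_main e : {in vs1 ++ vs2, forall v, at_start e v} -> e scratch = 0%N ->
  does main e (gadget_word M L K n bit) e (main_time n).
Proof.
move=> st es; rewrite /gadget_word -cat1s; set ws := words _ _.
have [uv1 uv2] : uniq vs1 /\ uniq vs2 by move: uvs; rewrite cat_uniq => /and3P[].
have st1 : {in vs1, forall v, at_start e v}.
  by move=> v v1; apply: st; rewrite mem_cat v1.
apply: does_seq.
  have -> : nseq (size ws) true = flatten [seq [:: true] | w <- ws].
    by elim: ws => //= w ws' <-.
  apply: does_loops => // w _; exact: does_emit.
apply: does_seq; first exact: does_emit.
have -> : [seq word_rel first_copy_nat L w w' | w <- ws, w' <- ws] =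
   flatten [seq flatten [seq [:: word_rel first_copy_nat L w w'] | w' <- ws] | w <- ws].
  congr flatten; apply: eq_map => w; elim: ws => //= w' ws' <-; by [].
apply: does_loops => // w wws.
have sw : size w = size vs1 by exact: size_mem_words wws.
rewrite /ws /K svs.
apply: does_loops => //.
  move=> v v2; have nv1 : v \notin vs1.
    by move: uvs; rewrite cat_uniq => /and3P[_ /hasPn /(_ v v2)].
  have [t1 t2 t3] : at_start e v by apply: st; rewrite mem_cat v2 orbT.
  by split; rewrite word_env_other.
move=> w' w'ws; have sw' : size w' = size vs2 by exact: size_mem_words w'ws.
rewrite -word_env_cat //; set e2 := word_env _ _ _.
have svw : size (vs1 ++ vs2) = size (w ++ w') by rewrite !size_cat sw sw'.
have ends := map_word_env e uvs svw.
have arcs_ok : {in w ++ w', forall p, [/\ p.1.1 = p.2.1, (p.1.2 < n)%N & (p.2.2 < n)%N]}.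
  move=> p; rewrite mem_cat => /orP[]; first exact: mem_words_arcs wws.
  exact: mem_words_arcs w'ws.
apply: does_find_codes => //.
- exact: contents_marker.
- by rewrite /e2 word_env_scratch.
- exact: scratch_end_tapes.
- exact: scratch_end_tapes.
- move=> j jin; have : e2 j \in arc_ends (w ++ w') by rewrite -ends map_f.
  case/flattenP => s /mapP[p pw ->]; have [_ h1 h2] := arcs_ok p pw.
  by rewrite !inE => /orP[] /eqP ->.
have -> : [seq index (e2 j) (map e2 (end_tapes (vs1 ++ vs2))) | j <- end_tapes (vs1 ++ vs2)] =
   [seq index z (arc_ends (w ++ w')) | z <- arc_ends (w ++ w')].
  by rewrite -ends -map_comp.
rewrite decide_codes; first exact: does_emit.
by move=> p /arcs_ok[].
Qed.

End LoopsSpec.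

Lemma loop_time_mono m m' k t t' : (m <= m')%N -> (t <= t')%N ->
  (loop_time m k t <= loop_time m' k t')%N.
Proof.
move=> mm tt; elim: k => //= k IH; rewrite ltnS leq_mul2l; apply/orP; right.
by apply: leq_mul; [rewrite leq_exp2r | rewrite leq_add2r].
Qed.

Lemma main_time_mono vs1 vs2 : {homo main_time vs1 vs2 : m n / (m <= n)%N}.
Proof.
move=> m n mn; rewrite /main_time; apply: leq_add; first exact: loop_time_mono.
rewrite leq_add2l; apply: loop_time_mono => //; apply: loop_time_mono => //.
by rewrite leq_add2l !leq_mul2l leq_add2r leq_mul2l mn !orbT.
Qed.

Lemma loop_time_bound k t : poly_bound t -> poly_bound (fun m => loop_time m k (t m)).
Proof.
move=> pt; elim: k => //= k IH.
apply: (@poly_bound_le _ (fun m => M * ((m + 1) * (m + 1) * (loop_time m k (t m) + 9)) + 1)%N).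
  by move=> m; rewrite -mulnn !addn1.
apply: poly_boundD (poly_bound_const 1); apply: poly_boundM (poly_bound_const M) _.
apply: poly_boundM; last exact: poly_boundD IH (poly_bound_const 9).
by apply: poly_boundM; apply: poly_boundD poly_bound_id (poly_bound_const 1).
Qed.

Lemma main_time_bound vs1 vs2 : poly_bound (main_time vs1 vs2).
Proof.
apply: poly_boundD; first exact: loop_time_bound (poly_bound_const 1).
apply: poly_boundD (poly_bound_const 1) _.
apply: loop_time_bound; apply: loop_time_bound; apply: poly_boundD (poly_bound_const 1) _.
apply: poly_boundM (poly_bound_const _) _; apply: poly_boundM (poly_bound_const _) _.
apply: poly_boundD (poly_bound_const 4); exact: poly_boundM (poly_bound_const 4) poly_bound_id.
Qed.

End Program.

Lemma list_tape_rcons (A : finType) (s : seq (cell A)) c :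
  (fun z => if z == (size s)%:Z then c else list_tape s z) = list_tape (rcons s c).
Proof.
apply: funext => z; rewrite /list_tape; case: z => k; last by [].
rewrite nth_rcons eqz_nat; case: ltngtP => // h.
by rewrite nth_default // ltnW.
Qed.

Lemma nseq_rcons (T : Type) n (x : T) : rcons (nseq n x) x = nseq n.+1 x.
Proof. by elim: n => //= n ->. Qed.

(** * Loading the input and assembling the program *)

Section Transducer.
Variables (Q : finType) (step_count : Q -> Q) (q0 : Q) (good : pred Q).
Variables (M L K : nat) (default : word).
Let V : finType := 'I_(K + K).
Local Notation J := (option (V * option bool)).
Local Notation name := (option J).
Local Notation store := (name -> atape unit).
Local Notation cmd := (cmd J Q unit).

Definition leading_ones (w : word) : nat := find negb w.

Definition rest (w : word) : word := drop (leading_ones w).+1 w.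

(** The register runs a finite automaton on the leading ones while they are copied, and its final
    state chooses between the gadget and the fixed word. *)
Definition transducer_fun (w : word) : word :=
  let n := leading_ones w in
  if good (iter n step_count q0)
  then gadget_word M L K n (fun x y => nth false (rest w) (x * n + y))
  else default.

Let vs1 : seq V := take K (enum V).
Let vs2 : seq V := drop K (enum V).

Lemma vars_cat : vs1 ++ vs2 = enum V. Proof. exact: cat_take_drop. Qed.

Lemma size_vs1 : size vs1 = K.
Proof. by rewrite size_takel // size_enum_ord leq_addr. Qed.

Lemma size_vs2 : size vs1 = size vs2.
Proof. by rewrite size_vs1 size_drop size_enum_ord addnK. Qed.

Lemma uniq_vars : uniq (vs1 ++ vs2).
Proof. by rewrite vars_cat enum_uniq. Qed.

Definition loading (inp : int -> cell unit) (p n : nat) (bits : word) : store := fun x =>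
  match x with
  | None => (p%:Z, inp)
  | Some None => (0, list_tape [:: marker])
  | Some (Some (v, None)) => ((size bits).+1%:Z, list_tape (marker :: contents n bits (mat v)))
  | Some (Some (v, Some b)) => (n.+1%:Z, list_tape (marker :: contents n bits (src v)))
  end.

Definition write_markers : cmd :=
  Act (fun q h => (q, fun x => match x with
    | None => (h x, Stay)
    | Some None => (marker, Stay)
    | Some (Some _) => (marker, MoveRight)
    end)).

Definition count_ones : cmd :=
  While (fun _ h => h None == tick)
    (Act (fun q h => (step_count q, fun x => match x with
      | None => (h x, MoveRight)
      | Some (Some (_, Some _)) => (tick, MoveRight)
      | _ => (h x, Stay)
      end))).

Definition copy_bits : cmd :=
  While (fun _ h => is_bit (h None))
    (Act (fun q h => (q, fun x => match x with
      | None => (h x, MoveRight)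
      | Some (Some (_, None)) => (h None, MoveRight)
      | _ => (h x, Stay)
      end))).

Lemma write_at0 (c : cell unit) :
  (fun z => if z == 0 then c else list_tape [::] z) = list_tape [:: c].
Proof. exact: (list_tape_rcons [::] c). Qed.

Lemma exec_write_markers q w :
  exec write_markers q (input_store unit w) 1 q
    (loading (list_tape [seq Some (inl b) | b <- w]) 0 0 [::]).
Proof.
have := exec_act (J := J) (A := unit) (fun (q : Q) (h : name -> cell unit) =>
   (q, fun x : name => match x with
    | None => (h x, Stay)
    | Some None => (marker, Stay)
    | Some (Some _) => (marker, MoveRight)
    end)) q (input_store unit w).
congr (run _ _ _ _ _ _); apply: funext => -[[[v [b|]]|]|]; rewrite /perform /=.
- by rewrite /awrite /= write_at0.
- by rewrite /awrite /= write_at0.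
- by rewrite /awrite /= write_at0.
- by rewrite awrite_scan.
Qed.

Lemma exec_count_ones inp i k q :
  (forall j, (j < i + k)%N -> inp j%:Z = tick) -> inp (i + k)%N%:Z <> tick ->
  exec count_ones q (loading inp i i [::]) (2 * k).+1 (iter k step_count q)
    (loading inp (i + k) (i + k) [::]).
Proof.
elim: k i q => [|k IH] i q ones stop.
  rewrite addn0 in stop *; apply: exec_while_end.
  by rewrite /scan_all /scan /=; apply/eqP.
rewrite (_ : (2 * k.+1).+1 = (1 + (2 * k).+1).+1)%N; last by lia.
rewrite iterSr; apply: (exec_while (q1 := step_count q) (T1 := loading inp i.+1 i.+1 [::])).
- by rewrite /scan_all /scan /= ones //; lia.
- have := exec_act (J := J) (A := unit) (fun (q : Q) (h : name -> cell unit) =>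
    (step_count q, fun x => match x with
      | None => (h x, MoveRight)
      | Some (Some (_, Some _)) => (tick, MoveRight)
      | _ => (h x, Stay)
      end)) q (loading inp i i [::]).
  congr (run _ _ _ _ _ _); apply: funext => -[[[v [b|]]|]|]; rewrite /perform /=.
  + rewrite /awrite /=; congr pair; first by lia.
    have := list_tape_rcons (marker :: nseq i tick) tick.
    by rewrite /= size_nseq nseq_rcons.
  + by rewrite /scan_all awrite_scan.
  + by rewrite /scan_all awrite_scan.
  + by rewrite /scan_all awrite_scan /=; congr pair; lia.
rewrite -addSnnS; apply: IH; first by move=> j; rewrite addSnnS; apply: ones.
by rewrite addSnnS.
Qed.

Lemma exec_copy_bits inp p n (m1 m2 : word) q :
  (forall j, (j < size m2)%N -> inp (p + j)%N%:Z = Some (inl (nth false m2 j))) ->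
  ~~ is_bit (inp (p + size m2)%N%:Z) ->
  exec copy_bits q (loading inp p n m1) (2 * size m2).+1 q
    (loading inp (p + size m2) n (m1 ++ m2)).
Proof.
elim: m2 p m1 => [|b m2 IH] p m1 bits stop.
  rewrite /= addn0 cats0 in stop *; apply: exec_while_end.
  by rewrite /scan_all /scan.
rewrite [size (b :: m2)]/= (_ : (2 * (size m2).+1).+1 = (1 + (2 * size m2).+1).+1)%N; last by lia.
have hb : inp p%:Z = Some (inl b) by have := bits 0%N isT; rewrite addn0.
apply: (exec_while (q1 := q) (T1 := loading inp p.+1 n (rcons m1 b))).
- by rewrite /scan_all /scan /= hb.
- have := exec_act (J := J) (A := unit) (fun (q : Q) (h : name -> cell unit) =>
    (q, fun x => match x with
      | None => (h x, MoveRight)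
      | Some (Some (_, None)) => (h None, MoveRight)
      | _ => (h x, Stay)
      end)) q (loading inp p n m1).
  congr (run _ _ _ _ _ _); apply: funext => -[[[v [c|]]|]|]; rewrite /perform /=.
  + by rewrite /scan_all awrite_scan.
  + rewrite /awrite /= size_rcons; congr pair; first by lia.
    rewrite /scan_all /scan /= hb.
    have := list_tape_rcons (marker :: [seq Some (inl b) | b <- m1]) (Some (inl b)).
    by rewrite /= size_map map_rcons.
  + by rewrite /scan_all awrite_scan.
  + by rewrite /scan_all awrite_scan /=; congr pair; lia.
rewrite -cat_rcons -addSnnS; apply: IH; last by rewrite addSnnS.
by move=> j jm; rewrite addSnnS; apply: (bits j.+1).
Qed.

Definition skip_zero : cmd :=
  If (fun _ h => h None == Some (inl false)) (move_head Q unit None MoveRight) (skip J Q).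

(** The last move leaves a blank between input and output, at which the final [rewind_bits]
    stops. *)
Definition load : cmd :=
  Seq write_markers (Seq count_ones (Seq skip_zero (Seq copy_bits
    (move_head Q unit None MoveRight)))).

Definition init_pos (n m : nat) (j : J) : nat :=
  match j with None => 0 | Some (_, None) => m.+1 | Some (_, Some _) => n.+1 end.

Lemma exec_load w (n := leading_ones w) (m := rest w) :
  exists k, (k <= 2 * n + 2 * size m + 6)%N /\
  exec load q0 (input_store unit w) k (iter n step_count q0)
    (reading (list_tape [seq Some (inl b) | b <- w]) (size w).+1%:Z (contents n m)
       (init_pos n (size m)) [::]).
Proof.
set inp := list_tape _.
have inpE (j : nat) : inp j%:Z = if (j < size w)%N then Some (inl (nth false w j)) else None.
  rewrite /inp /list_tape; case: ltnP => h; first by rewrite (nth_map false).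
  by rewrite nth_default ?size_map.
have e1 := exec_write_markers q0 w; rewrite -/inp in e1.
clearbody inp.
have nw : (n <= size w)%N by apply: find_size.
have e2 : exec count_ones q0 (loading inp 0 0 [::]) (2 * n).+1 (iter n step_count q0)
    (loading inp n n [::]).
  apply: (@exec_count_ones inp 0 n q0).
    move=> j; rewrite add0n => jn; rewrite inpE (leq_trans jn nw) /tick; congr (Some (inl _)).
    by have := before_find false jn => /negbFE.
  rewrite add0n inpE; case: ltnP => // nlt [h].
  by have := @nth_find _ false negb w; rewrite has_find -/(leading_ones w) nlt h => /(_ isT).
(* On a word without a separating 0 the head is already on the blank and stays there; the matrix is
   then empty. *)
pose p := minn n.+1 (size w).
have e3 : exists2 k, (k <= 2)%N & exec skip_zero (iter n step_count q0)
    (loading inp n n [::]) k (iter n step_count q0) (loading inp p n [::]).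
  case: (ltnP n (size w)) => h.
    have nth0w : nth false w n = false.
      apply/negbTE; have := @nth_find _ false negb w; rewrite has_find h; exact.
    exists 2%N => //; apply: exec_if.
    rewrite /scan_all /scan /= inpE h nth0w eqxx.
    have := @exec_move_head J Q unit None MoveRight (iter n step_count q0)
      (loading inp n n [::]) n%:Z inp erefl.
    congr (run _ _ _ _ _ _); apply: funext => -[[[v [b|]]|]|] //=.
    by rewrite /set_tape /=; congr pair; rewrite /p; lia.
  exists 2%N => //; apply: exec_if.
  rewrite /scan_all /scan /= inpE ltnNge h /=.
  have -> : p = n by rewrite /p; lia.
  have := @exec_move_heads J Q unit (fun=> Stay) (iter n step_count q0) (loading inp n n [::]).
  by congr (run _ _ _ _ _ _); apply: funext => -[[[v [b|]]|]|].
have pm : (p + size m = size w)%N by rewrite /m /rest -/n size_drop /p; lia.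
have e4 : exec copy_bits (iter n step_count q0) (loading inp p n [::]) (2 * size m).+1
    (iter n step_count q0) (loading inp (size w) n m).
  have := @exec_copy_bits inp p n [::] m (iter n step_count q0); rewrite pm; apply.
    move=> j jm; have np : p = n.+1.
      by move: jm; rewrite /m /rest -/n size_drop /p; lia.
    by rewrite inpE ifT; [rewrite /m /rest nth_drop np | lia].
  by rewrite inpE ltnn.
have e5 := @exec_move_head J Q unit None MoveRight (iter n step_count q0)
  (loading inp (size w) n m) (size w)%:Z inp erefl.
have [k3 k3le {}e3] := e3.
exists (1 + ((2 * n).+1 + (k3 + ((2 * size m).+1 + 1))))%N; split; first by lia.
apply: exec_seq e1 _; apply: exec_seq e2 _; apply: exec_seq e3 _; apply: exec_seq e4 _.
move: e5; congr (run _ _ _ _ _ _); apply: funext => -[[[v [b|]]|]|] //=.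
rewrite /set_tape /=; congr pair; first by lia.
by apply: funext => z; rewrite /write_word /= ifF //; lia.
Qed.

Definition rewind_all : cmd :=
  foldr (fun v c => Seq (rewind Q (src v)) (Seq (rewind Q (tgt v)) (Seq (rewind Q (mat v)) c)))
    (skip J Q) (enum V).

Definition emit_word (o : word) : cmd := foldr (fun b => Seq (emit J Q b)) (skip J Q) o.

Definition work_part : cmd :=
  Seq rewind_all
    (If (fun q _ => good q) (main Q M L vs1 vs2) (emit_word default)).

Definition transducer : cmd := Seq load (Seq work_part (rewind_bits Q unit None)).

Section Work.
Variables (inp : int -> cell unit) (base : int) (n : nat) (bits : word).
Local Notation does := (@does J Q inp base (contents n bits)).

Lemma does_emit_word e o : does (emit_word o) e o e (size o).+1.
Proof.
elim: o => [|b o IH]; first exact: does_skip.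
have hb : does (emit J Q b) e [:: b] e 1 by apply: does_emit.
exact: does_seq hb IH.
Qed.

Definition rewound (e : J -> nat) (vs : seq V) (j : J) : nat :=
  if j is Some (v, _) then if v \in vs then 1%N else e j else e j.

Lemma does_rewind_list (vs : seq V) e c :
  (0 < c)%N -> (forall j, e j <= c)%N ->
  does (foldr (fun v c => Seq (rewind Q (src v)) (Seq (rewind Q (tgt v))
      (Seq (rewind Q (mat v)) c))) (skip J Q) vs) e [::] (rewound e vs)
    (size vs * (6 * c + 6) + 1).
Proof.
move=> c0; elim: vs e => [|v vs IH] e ec /=.
  have -> : rewound e [::] = e by apply: funext => -[[v b]|].
  exact: does_skip.
pose e1 := set_pos e (src v) 1; pose e2 := set_pos e1 (tgt v) 1.
pose e3 := set_pos e2 (mat v) 1.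
have set_le (f : J -> nat) j : (forall i, f i <= c)%N -> (forall i, set_pos f j 1 i <= c)%N.
  by move=> fc i; rewrite /set_pos; case: ifP.
have e1c := set_le _ (src v) ec; have e2c := set_le _ (tgt v) e1c.
have e3c := set_le _ (mat v) e2c.
have -> : rewound e (v :: vs) = rewound e3 vs.
  apply: funext => -[[v' b]|] //=; rewrite inE /e3 /e2 /e1 /set_pos /src /tgt /mat.
  case: (altP (v' =P v)) => [->|ne] /=.
    have eb c' : (Some (v, b) == Some (v, c') :> J) = (b == c').
      by apply/eqP/eqP => [[]|->].
    by rewrite !eb; case: ifP => // _; case: b {eb} => [[]|].
  case: ifP => // _; rewrite !ifF //; by apply/eqP => -[] h; rewrite h eqxx in ne.
apply: (@does_le _ _ _ _ _ _ _ _ _ ((2 * e (src v) + 2) + ((2 * e1 (tgt v) + 2) +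
  ((2 * e2 (mat v) + 2) + (size vs * (6 * c + 6) + 1))))).
  have h1 : (e1 (tgt v) <= c)%N by apply: e1c.
  have h2 : (e2 (mat v) <= c)%N by apply: e2c.
  rewrite (mulSn (size vs)); move: (ec (src v)) h1 h2.
  by move: (e _) (e1 _) (e2 _) (size vs * _)%N => a b d k; clear; lia.
apply: (does_seq (o1 := [::]) (e1 := e1)); first exact: does_rewind (@contents_marker V n bits) _ _.
apply: (does_seq (o1 := [::]) (e1 := e2)); first exact: does_rewind (@contents_marker V n bits) _ _.
apply: (does_seq (o1 := [::]) (e1 := e3)); first exact: does_rewind (@contents_marker V n bits) _ _.
exact: IH.
Qed.

End Work.

Definition work_time (s : nat) : nat :=
  (size (enum V) * (6 * s.+1 + 6) + 1 + (main_time M vs1 vs2 s + (size default).+1).+1)%N.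

Lemma exec_work w (n := leading_ones w) (m := rest w) inp base :
  let T := reading inp base (contents n m) in
  let q := iter n step_count q0 in
  exists k e, [/\ (k <= work_time (size w))%N, (size (transducer_fun w) <= k)%N &
    exec work_part q (T (init_pos n (size m)) [::]) k q (T e (transducer_fun w))].
Proof.
move=> T q.
have nw : (n <= size w)%N by apply: find_size.
have mw : (size m <= size w)%N by rewrite size_drop leq_subr.
have bound j : (init_pos n (size m) j <= (size w).+1)%N by case: j => [[v [b|]]|].
pose e1 := rewound (init_pos n (size m)) (enum V).
have st v : at_start e1 v by split; rewrite /e1 /rewound /src /tgt /mat mem_enum.
have [k1 [k1t _ r1]] := does_rewind_list inp base n m (enum V) (ltn0Sn (size w)) bound q [::].
have [k2 [k2t ok r2]] : exists k2, [/\ (k2 <= main_time M vs1 vs2 (size w) + (size default).+1)%N,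
    (size (transducer_fun w) <= k2)%N &
    exec (if good q then main Q M L vs1 vs2 else emit_word default) q (T e1 [::]) k2 q
      (T e1 (transducer_fun w))].
  rewrite /transducer_fun -/n -/q -/m; case: (good q).
    have [|//|k [kt ok r]] := @does_main V Q M L inp base n m vs1 vs2 uniq_vars size_vs2 e1 _ _ q [::].
      by move=> v _.
    rewrite size_vs1 in r ok; exists k; split=> //.
    apply: leq_trans kt (leq_trans (main_time_mono _ _ _ nw) (leq_addr _ _)).
  have [k [kt ok r]] := @does_emit_word inp base n m e1 default q [::].
  by exists k; split=> //; apply: leq_trans kt (leq_addl _ _).
exists (k1 + k2.+1)%N, e1; split; last by apply: exec_seq r1 _; apply: exec_if.
- by rewrite /work_time; lia.
- by lia.
Qed.

Lemma transducer_polytime : polytime transducer_fun.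
Proof.
pose t s := (3 * work_time s + 10 * s + 10)%N.
apply: (@polytime_exec _ _ _ transducer q0 _ t).
  apply: poly_boundD (poly_bound_const 10); apply: poly_boundD; last first.
    exact: poly_boundM (poly_bound_const 10) poly_bound_id.
  apply: poly_boundM (poly_bound_const 3) _; apply: poly_boundD.
    apply: poly_boundD (poly_bound_const 1); apply: poly_boundM (poly_bound_const _) _.
    apply: poly_boundD (poly_bound_const 6); apply: poly_boundM (poly_bound_const 6) _.
    by apply: poly_bound_le (poly_boundD poly_bound_id (poly_bound_const 1)) => s; rewrite addn1.
  apply: (@poly_bound_le _ (fun s => main_time M vs1 vs2 s + (size default).+2)%N).
    by move=> s; rewrite !addnS.
  exact: poly_boundD (main_time_bound _ _ _) (poly_bound_const _).
move=> w; set inp : int -> cell unit := list_tape [seq Some (inl b) | b <- w].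
have [k1 [k1t e1]] := exec_load w; rewrite -/inp in e1.
have [k2 [e [k2t ok e2]]] := exec_work w inp (size w).+1%:Z.
set o := transducer_fun w in ok e2 *.
set T2 := reading _ _ _ e o in e2.
have T2n : T2 None = ((size w).+1%:Z + (size o)%:Z, write_word inp (size w).+1%:Z o) by [].
have e3 : exec (rewind_bits Q unit None) (iter (leading_ones w) step_count q0) T2
    (2 * size o + 3)%N (iter (leading_ones w) step_count q0)
    (set_tape T2 None ((size w).+1%:Z, write_word inp (size w).+1%:Z o)).
  apply: exec_rewind_bits T2n _ _ => [k ko|]; rewrite /write_word.
    by rewrite ifT //; lia.
  rewrite ifF; last by lia.
  have -> : (size w).+1%:Z - 1 = (size w)%:Z by lia.
  by rewrite /inp /list_tape nth_default ?size_map.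
do 3 eexists; split.
- apply: exec_seq e1 _; apply: exec_seq e2 _; exact: e3.
- have : (leading_ones w <= size w)%N by apply: find_size.
  have : (size (rest w) <= size w)%N by rewrite size_drop leq_subr.
  by rewrite /t; lia.
rewrite set_tapeE; split=> [k ko|] /=; rewrite /write_word.
  rewrite ifT; last by lia.
  by have -> : absz ((size w).+1%:Z + k%:Z - (size w).+1%:Z)%R = k by lia.
rewrite ifF; last by lia.
rewrite /inp /list_tape (_ : (size w).+1%:Z + (size o)%:Z = ((size w).+1 + size o)%N%:Z) //.
by rewrite nth_default // size_map; lia.
Qed.

End Transducer.

(** * The reduction *)

Section Counter.
Variables (R : realType) (delta : R).
Hypothesis delta0 : 0 < delta.

(** Size 1 is excluded because [internal_edges] halves the size. No YES instance is lost: graphs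
    have no loops, so a singleton has edge expansion 1. *)
Definition usable (n : nat) : Prop := exists2 p : nat, (1 < p)%N & p%:R = delta * n%:R.

(* [delta] is an arbitrary real number, but the [n] such that [delta * n] is an
   integer greater than 1 form a regular set: a counter that wraps around from
   [q + q] to [q], where [q] is such an [n], recognises it. *)
Lemma usable_automaton : exists (Q : finType) (next : Q -> Q) (q0 : Q) (good : pred Q),
  forall n, good (iter n next q0) <-> delta <= 1 /\ usable n.
Proof.
case: (pselect (delta <= 1 /\ exists q, usable q)); last first.
  move=> none; exists unit, id, tt, pred0 => n; split=> // -[d1 un]; case: none.
  by split=> //; exists n.
case=> d1 [q [p p1 pq]].
have q0 : (0 < q)%N.
  by case: q pq => // /eqP; rewrite mulr0 pnatr_eq0; case: p p1.
pose d := (q + q).-1.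
pose next (i : 'I_d.+1) : 'I_d.+1 := inord (if i.+1 == (q + q)%N then q else i.+1).
exists 'I_d.+1, next, ord0, (fun s => `[< usable (nat_of_ord s) >]) => n.
have dE : (q + q)%N = d.+1 by rewrite prednK // addn_gt0 q0.
(* Here [t] counts the wrap-arounds. Each removes [q] from the counter and [p] from the size, and
   after the first one the state is at least [q], so the remaining size is at least [p]. *)
have [t [nE tq]] : exists t, n = (iter n next ord0 + q * t)%N /\
    ((0 < t)%N -> (q <= iter n next ord0)%N).
  elim: n => [|n [t [nE tq]]]; first by exists 0%N; rewrite muln0.
  rewrite iterS; move: (iter n next ord0) nE tq (ltn_ord (iter n next ord0)) => s nE tq sd.
  rewrite /next; case: eqP => sE.
    by exists t.+1; rewrite inordK -?dE ?mulnS; [split=> //; lia | lia].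
  exists t; rewrite inordK; last by clearbody d; lia.
  by split=> [|t0]; [lia | exact: leqW (tq t0)].
set s := iter n next ord0 in nE tq *.
have dn : delta * n%:R = delta * s%:R + t%:R * p%:R by rewrite {1}nE natrD natrM pq; ring.
split=> [/asboolP[p' p'1 p'E]|[_ [p' p'1 p'E]]].
  split=> //; exists (p' + t * p)%N; first by lia.
  by rewrite dn natrD natrM p'E.
apply/asboolP; case: (posnP t) => t0.
  by exists p' => //; rewrite p'E dn t0 mul0r addr0.
have le : (p + t * p <= p')%N.
  rewrite -(ler_nat R) natrD natrM p'E dn lerD2r pq ler_pM2l // ler_nat.
  exact: tq t0.
exists (p' - t * p)%N; first by lia.
by rewrite natrB ?natrM; [rewrite p'E dn addrK | lia].
Qed.

End Counter.

Lemma neq_sym (n : nat) : symmetric (fun i j : 'I_n => i != j).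
Proof. by move=> i j; rewrite eq_sym. Qed.

Lemma neq_irr (n : nat) : irreflexive (fun i j : 'I_n => i != j).
Proof. by move=> i; rewrite eqxx. Qed.

Definition complete_graph n : graph := Graph (@neq_sym n) (@neq_irr n).

Lemma complete_graph_expansion (R : realType) n (S : {set 'I_(nv (complete_graph n))}) :
  S != set0 -> S != setT -> 1 <= vertex_expansion R S.
Proof.
case/set0Pn=> u uS ST.
have NS : neighborhood S = ~: S.
  apply/setP=> v; rewrite !inE; case: (boolP (v \in S)) => //= vS.
  by apply/existsP; exists u; rewrite uS /=; apply: contraNneq vS => <-.
have S0 : (0 : R) < #|S|%:R by rewrite ltr0n; apply/card_gt0P; exists u.
have C0 : (0 : R) < #|~: S|%:R.
  by rewrite ltr0n card_gt0; apply: contraNneq ST => h; rewrite -[S]setCK h setC0.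
rewrite /vertex_expansion NS invfM [_ * (_^-1 * _)]mulrCA divff ?gt_eqF // mulr1.
rewrite ler_pdivlMr // mul1r ler_nat; apply: leq_trans (max_card _) _.
by rewrite card_ord.
Qed.

Lemma leading_ones_encode G : leading_ones (encode G) = nv G.
Proof. by rewrite /leading_ones /encode find_cat has_nseq /= andbF size_nseq addn0. Qed.

Lemma rest_encode G : rest (encode G) = matrix_bits G.
Proof.
rewrite /rest leading_ones_encode /encode -cat_rcons.
by rewrite drop_size_cat // size_rcons size_nseq.
Qed.

Lemma singleton_edge_expansion (R : realType) (G : graph) k (S : {set 'I_(nv G)}) :
  regular G k -> (0 < k)%N -> #|S| = 1%N -> edge_expansion R k S = 1.
Proof.
move=> greg k0 /eqP/cards1P[u ->]; rewrite /edge_expansion.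
have -> : #|cut_edges [set u]| = k.
  rewrite -(greg u) -(card_imset [set v | adj u v] (f := pair u)); last by move=> x y [].
  apply: eq_card => -[x y]; rewrite !inE /=.
  apply/and3P/imsetP => [[/eqP-> _ xy]|[v]]; first by exists y; rewrite ?inE.
  rewrite inE => uv [-> ->]; split=> //.
  by apply: contraTneq uv => ->; rewrite adj_irr.
by rewrite cards1 mulr1 divff // pnatr_eq0 -lt0n.
Qed.

Section Reduction.
Variables (R : realType) (eps : R).
Hypothesis eps0 : 0 < eps.

Let W := (Num.truncn (40%:R / eps) + 21)%N.
Let P := (3 * (768 * W ^ 2)).+1.

(** The largest value that [reduction_sound] admits. It depends on [eps] through [W] and not on
    [delta]. *)
Definition sse_gap : R := (64%:R * W%:R ^+ 3 * P%:R ^+ 2)^-1.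

Let W_ge : 21%:R <= W%:R :> R. Proof. by rewrite ler_nat leq_addl. Qed.

Let P_ge1 : 1 <= P%:R :> R. Proof. by rewrite ler1n. Qed.

Let gap_den : 4%:R * W%:R <= 64%:R * W%:R ^+ 3 * P%:R ^+ 2 :> R.
Proof.
move: (W%:R : R) (P%:R : R) W_ge P_ge1 => w p w21 p1.
have h1 : 1 <= w ^+ 2 by rewrite expr_ge1 //; lra.
have h2 : 1 <= p ^+ 2 by rewrite expr_ge1 //; lra.
have -> : 64%:R * w ^+ 3 * p ^+ 2 = (4 * w) * (16 * (w ^+ 2 * p ^+ 2)) by ring.
rewrite -[leLHS]mulr1 ler_pM2l; last by lra.
have : 1 * 1 <= w ^+ 2 * p ^+ 2 by apply: ler_pM.
lra.
Qed.

Lemma sse_gap_gt0 : 0 < sse_gap.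
Proof. by rewrite invr_gt0; apply: lt_le_trans gap_den; move: W_ge => ?; lra. Qed.

Let gap_le : sse_gap <= (4%:R * W%:R)^-1.
Proof.
rewrite lef_pV2 ?posrE //; first by rewrite -invr_gt0; apply: sse_gap_gt0.
by move: W_ge => ?; lra.
Qed.

Let gap_lt1 : sse_gap < 1.
Proof.
apply: le_lt_trans gap_le _; rewrite invf_lt1; move: W_ge => ?; lra.
Qed.

(** If [delta * n] is not an integer, the NO condition is vacuous and tells nothing about the graph.
    Graphs without a usable size cannot be YES instances, so all of them are sent to a complete
    graph on two vertices, whose vertex expansion is at least 1. *)
Lemma small_set_expansion_reduces (delta : R) : 0 < delta ->
  reduces (small_set_expansion sse_gap delta) (vertex_expansion_gap eps 10^-1).
Proof.
move=> delta0; have [Q [next [q0 [good goodP]]]] := usable_automaton delta0.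
pose L := Num.truncn delta^-1; pose M' := (2 * W).-1.
have EM : M'.+1 = (2 * W)%N by rewrite prednK // /W; lia.
have W0 : (0 < W)%N by rewrite /W addnS.
pose f := transducer_fun next q0 good M'.+1 L (W * L + L) (encode (complete_graph 2)).
have fE G : f (encode G) = encode (if good (iter (nv G) next q0)
    then gadget_graph G M' L (W * L + L) else complete_graph 2).
  rewrite /f /transducer_fun leading_ones_encode rest_encode.
  by case: ifP => // _; rewrite encode_gadget_graph.
exists f; split; first exact: transducer_polytime.
- move=> _ [G -> [k [n0 k0 greg [S [mS eS]]]]].
  have Sn : #|S|%:R = delta * (nv G)%:R by rewrite -mS divfK // pnatr_eq0 -lt0n.
  have d1 : delta <= 1.
    rewrite -mS ler_pdivrMr ?ltr0n // mul1r ler_nat.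
    by apply: leq_trans (max_card _) _; rewrite card_ord.
  (* A singleton would have edge expansion 1, which exceeds the gap. *)
  have S1 : (1 < #|S|)%N.
    rewrite ltn_neqAle -(ltr_nat R) Sn mulr_gt0 ?ltr0n // andbT.
    apply: contraTneq eS => S1; rewrite -ltNge.
    by rewrite (singleton_edge_expansion R greg k0 (esym S1)).
  have gn : good (iter (nv G) next q0) by apply/goodP; split=> //; exists #|S|.
  rewrite fE gn; eexists; first by [].
  apply: (reduction_complete greg k0 n0 W0 EM delta0 d1 sse_gap_gt0 _ _ gap_le eps0 mS eS).
    have /truncn_itv/andP[_ /ltW h] : 0 <= 40%:R / eps by rewrite divr_ge0 // ltW.
    by apply: le_trans h _; rewrite ler_nat /W addnS ltnS leq_addr.
  by move: W_ge => ?; lra.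
move=> _ [G -> [k [n0 k0 greg hS]]]; rewrite fE.
case: ifPn => [/goodP[d1 [s s1 sE]]|_]; (eexists; first by []) => A A0 AT.
  apply: (reduction_sound greg k0 n0 W0 EM delta0 d1 sse_gap_gt0 _ sE s1 hS A0 AT).
  by rewrite mulVf // gt_eqF // -invr_gt0 sse_gap_gt0.
by apply: le_trans (complete_graph_expansion R A0 AT); lra.
Qed.

End Reduction.

Theorem theorem1p3 (R : realType) :
  exists delta0 : R, 0 < delta0 /\
    forall eps : R, 0 < eps -> SSE_hard R (vertex_expansion_gap eps delta0).
Proof.
exists 10^-1; split=> [|eps eps0]; first by rewrite invr_gt0.
have red := small_set_expansion_reduces eps0; split; last first.
  by exists (sse_gap eps); split=> //; apply: sse_gap_gt0.
move=> /(_ _ (sse_gap_gt0 eps))[delta [delta0 hard]] L NPL.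
exact: reduces_trans (hard L NPL) (red delta delta0).
Qed.
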